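(* Let $\lambda>1$ and let $$K=\mathrm{SO}(2)U_1\cup \mathrm{SO}(2)U_2\subset\mathbb{R}^{2\times 2},\qquad U_1=\begin{pmatrix}\lambda&0\\0&1/\lambda\end{pmatrix},\quad U_2=\begin{pmatrix}1/\lambda&0\\0&\lambda\end{pmatrix}.$$ Let $O=\{(x,y,d)\in\mathbb{R}^3:\ x,y>0,\ xy>|d|\}$ with closure $\overline O$, and define $A,g:\overline O\to\mathbb{R}$ by $$A(x,y,d)=(x^2+y^2)\frac{|U_1|^2}{2}+\Big(\lambda^2-\frac{1}{\lambda^2}\Big)\sqrt{x^2y^2-d^2}+2d,\qquad g(x,y,d)=x^2+y^2+|U_1|^2-2\sqrt{A(x,y,d)},$$ where $|U_1|^2=\lambda^2+\lambda^{-2}$. Let $\theta:\mathbb{R}\to[0,\infty]$ be convex and lower semicontinuous, and define $W:\mathbb{R}^{2\times2}\to\mathbb{R}\cup\{\infty\}$ by $$W(F)=\mathrm{dist}^2(F,K)+\theta(\det F),$$ where $\mathrm{dist}$ is the Euclidean (Frobenius) distance. Then $W^{\mathrm{rc}}=W^{\mathrm{qc}}=W^{\mathrm{pc}}$, and for every $F\in\mathbb{R}^{2\times2}$ $$W^{\mathrm{qc}}(F)=h\big(x(F),y(F),d(F)\big)+\theta(\det F),$$ where $h:\overline O\to\mathbb{R}$ is given by $$h(x,y,d)=\min_{\xi\in[x,\infty),\ \eta\in[y,\infty)} g(\xi,\eta,d),$$ and $x(F)=|Fv|$, $y(F)=|Fw|$, $d(F)=\det F$ with $v=\tfrac{1}{\sqrt2}(1,1)^T$,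 $w=\tfrac{1}{\sqrt2}(1,-1)^T$.
   Context: $\mathrm{SO}(2)$ denotes the group of proper rotations of $\mathbb{R}^2$; $|\cdot|$ on matrices is the Frobenius norm, $|A|^2=\mathrm{tr}(AA^T)$. For $f:\mathbb{R}^{2\times2}\to\mathbb{R}\cup\{\infty\}$: $f$ is quasiconvex if $f(F)\le\int_{(0,1)^2} f(F+D\varphi)\,dx$ for all $F\in\mathbb{R}^{2\times2}$ and all $\varphi\in W^{1,\infty}_0((0,1)^2;\mathbb{R}^2)$; $f$ is rank-one convex if $t\mapsto f(F+tR)$ is convex for all $F$ and all $R$ with $\mathrm{rank}\,R=1$; $f$ is polyconvex if $f(F)=G(F,\det F)$ for some convex lower semicontinuous $G:\mathbb{R}^5\to\mathbb{R}\cup\{\infty\}$. The envelopes $W^{\mathrm{rc}},W^{\mathrm{qc}},W^{\mathrm{pc}}$ are the largest rank-one convex, quasiconvex, and polyconvex functions, respectively, that are less than or equal to $W$. *)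

(* Defs.v *)
From HB Require Import structures.
From mathcomp Require Import all_boot all_order all_algebra.
From mathcomp Require Import all_classical all_reals all_analysis.
Set Implicit Arguments. Unset Strict Implicit. Unset Printing Implicit Defensive.
Import Order.TTheory GRing.Theory Num.Theory.
Import numFieldNormedType.Exports.
Local Open Scope classical_set_scope.
Local Open Scope ring_scope.

Section Defs.
Variable R : realType.
Local Notation M2 := 'M[R]_2.

Definition frob2 (A : M2) : R := \tr (A *m A^T).

Definition vnorm (u : 'cV[R]_2) : R := Num.sqrt (\sum_i u i 0 ^+ 2).

Definition SO2 : set M2 := [set Q | Q *m Q^T = 1%:M /\ \det Q = 1].

Definition U1 (lam : R) : M2 :=
  \matrix_(i, j) (if i == j then (if i == 0 then lam else lam^-1) else 0).
Definition U2 (lam : R) : M2 :=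
  \matrix_(i, j) (if i == j then (if i == 0 then lam^-1 else lam) else 0).

Definition Kset (lam : R) : set M2 :=
  [set Q *m U1 lam | Q in SO2] `|` [set Q *m U2 lam | Q in SO2].

Definition distK2 (lam : R) (F : M2) : R :=
  inf [set frob2 (F - G) | G in Kset lam].

Definition W (lam : R) (theta : R -> \bar R) (F : M2) : \bar R :=
  ((distK2 lam F)%:E + theta (\det F))%E.

Definition Obar : set (R * R * R) :=
  [set p | 0 <= p.1.1 /\ 0 <= p.1.2 /\ `|p.2| <= p.1.1 * p.1.2].

Definition Afun (lam x y d : R) : R :=
  (x ^+ 2 + y ^+ 2) * (frob2 (U1 lam) / 2)
  + (lam ^+ 2 - lam ^- 2) * Num.sqrt (x ^+ 2 * y ^+ 2 - d ^+ 2) + 2 * d.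

Definition gfun (lam x y d : R) : R :=
  x ^+ 2 + y ^+ 2 + frob2 (U1 lam) - 2 * Num.sqrt (Afun lam x y d).

(* h(x,y,d) = min over xi >= x, eta >= y of g(xi,eta,d) (written as inf;
   attainment is asserted separately in the theorem) *)
Definition hfun (lam x y d : R) : R :=
  inf [set gfun lam xi eta d | xi in [set xi | x <= xi] &
                               eta in [set eta | y <= eta]].

Definition vv : 'cV[R]_2 := (Num.sqrt 2)^-1 *: \col_(i < 2) 1.
Definition ww : 'cV[R]_2 :=
  (Num.sqrt 2)^-1 *: \col_(i < 2) (if i == 0 then 1 else -1).

Definition xF (F : M2) : R := vnorm (F *m vv).
Definition yF (F : M2) : R := vnorm (F *m ww).

Definition Hfun (lam : R) (theta : R -> \bar R) (F : M2) : \bar R :=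
  ((hfun lam (xF F) (yF F) (\det F))%:E + theta (\det F))%E.

Definition convex_ext (f : R -> \bar R) : Prop :=
  forall a b t : R, 0 < t < 1 ->
    (f (t * a + (1 - t) * b)%R <= t%:E * f a + (1 - t)%R%:E * f b)%E.

Definition rank_one_convex (f : M2 -> \bar R) : Prop :=
  forall F Rm : M2, \rank Rm = 1%N -> convex_ext (fun t => f (F + t *: Rm)).

(* R^5 identified with R^{2x2} x R *)
Definition convex_ext5 (G : M2 * R -> \bar R) : Prop :=
  forall a b : M2 * R, forall t : R, 0 < t < 1 ->
    (G (t *: a.1 + (1 - t) *: b.1, t * a.2 + (1 - t) * b.2)%R
     <= t%:E * G a + (1 - t)%R%:E * G b)%E.

Definition polyconvex (f : M2 -> \bar R) : Prop :=
  exists G : M2 * R -> \bar R,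
    [/\ forall z, G z != -oo%E, convex_ext5 G, lower_semicontinuous G &
        forall F, f F = G (F, \det F)].

Definition square : set (R * R) :=
  [set x | 0 < x.1 < 1 /\ 0 < x.2 < 1].

(* W^{1,oo}_0((0,1)^2; R^2): Lipschitz maps R^2 -> R^2 vanishing outside the
   open unit square (extension by zero) *)
Definition W1inf0 (phi : R * R -> R * R) : Prop :=
  (exists L : R, forall x y, `|phi x - phi y| <= L * `|x - y|) /\
  (forall x, ~ square x -> phi x = 0).

(* the gradient matrix (D phi)_{ij} = d phi_i / d x_j (defined a.e.) *)
Definition coord2 (i : 'I_2) (p : R * R) : R := if i == 0 then p.1 else p.2.
Definition e2 (j : 'I_2) : R * R := if j == 0 then (1, 0) else (0, 1).
Definition Dmat (phi : R * R -> R * R) (x : R * R) : M2 :=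
  \matrix_(i, j) coord2 i ('d phi x (e2 j)).

Definition leb2 := (@lebesgue_measure R \x @lebesgue_measure R)%E.

Definition quasiconvex (f : M2 -> \bar R) : Prop :=
  forall F (phi : R * R -> R * R), W1inf0 phi ->
    (f F <= \int[leb2]_(x in square) f (F + Dmat phi x)%R)%E.

End Defs.

(* Main.v *)
(** The squared distance to the wells is [g(x(F), y(F), det F)], by maximizing linear functions over
   SO(2). In the variables [(X, Y, d) = (x^2, y^2, d)] the function [g] is convex, since
   [sqrt (X Y - d^2)] is concave, and so is its monotone envelope [h]. As [x(F)^2] and [y(F)^2] are
   convex in [F], the function [H = h + theta] is polyconvex: it is a supremum of affine functions of
   [(F, det F)]. Quasiconvexity of [H] is Jensen's inequality for these minorants; it relies on
   Rademacher's theorem in the plane and on [\int D phi = 0] and [\int det D phi = 0], obtained from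
   difference quotients and dominated convergence.

   Conversely, let [f <= W] be rank-one convex or quasiconvex. Multiplying [F] on the right by shears
   along the diagonal directions keeps [det F] and one of [x(F)], [y(F)], while the other one is
   convex and quadratic along the shear; hence [F] is an average of two matrices with a prescribed
   larger value of [x] or [y]. This gives [f F <= g(xi, eta, det F) + theta (det F)] for all
   [xi >= x(F)] and [eta >= y(F)]. As [theta] may be infinite outside a single value of the
   determinant, a quasiconvex [f] has to be tested with laminates of constant determinant, that is with
   maps [x + phi x] that preserve area; commutators of piecewise affine shears provide them. *)
Require Import Defs.
From HB Require Import structures.
From mathcomp Require Import all_boot all_order all_algebra.
From mathcomp Require Import all_classical all_reals all_analysis.
From mathcomp Require Import measurable_realfun ring lra.
Set Implicit Arguments. Unset Strict Implicit. Unset Printing Implicit Defensive.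
Import Order.TTheory GRing.Theory Num.Theory.
Import numFieldNormedType.Exports.
Local Open Scope classical_set_scope.
Local Open Scope ring_scope.


(** * Rademacher's theorem *)

Section Rademacher1.
Context {R : realType}.
Local Notation mu := (@lebesgue_measure R).

(** The wells are exactly the matrices with [x(F)^2 = y(F)^2 = (lam^2 + lam^-2) / 2] and determinant
    1, and the diagonal directions are the only ones in which [U1] and [U2] stretch equally; this
    singles out [v], [w] and the shears along them. Two obstacles shape the treatment of a
    quasiconvex [f]. It is an arbitrary extended-valued function, so [f (F + D phi)] may fail to be
    measurable: its integral is only ever compared, by monotonicity, with that of an explicit
    measurable function. And nothing bounds [f] where [theta] is infinite, so a test map must keep
    the determinant exactly, in its transition layers too. The laminate does not fill the square. A
    single strip of width proportional to [dl] carries the slopes [s] and [- s]; the transition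
    regions at its ends have area of order [dl ^+ 2] and gradients bounded independently of [dl].
    Dividing by [dl] and letting it tend to 0 gives midpoint convexity along shears, and the upper
    bound by [W] turns this into a bound between arbitrary end points. *)

Lemma lipschitz_continuous (V W : normedModType R) (f : V -> W) (K : R) :
  (forall x y, `|f x - f y| <= K * `|x - y|) -> continuous f.
Proof.
move=> fK x; apply/cvgrPdist_lt => e e0; near=> y.
have K1 : 0 < `|K| + 1 by rewrite ltr_wpDl.
apply: le_lt_trans (fK _ _) _.
apply: (@le_lt_trans _ _ ((`|K| + 1) * `|x - y|)).
  by rewrite ler_wpM2r// (le_trans (ler_norm _))// lerDl.
rewrite mulrC -ltr_pdivlMr//; near: y.
by apply: cvgr_dist_lt => //; rewrite divr_gt0.
Unshelve. all: by end_near. Qed.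

(** Both sides are infima over countable covers by half-open intervals, and the Lipschitz bound
    compares the lengths interval by interval. *)
Lemma stieltjes_le_lebesgue (G : cumulative R R) (K : R) : 0 < K ->
  (forall x y, `|G x - G y| <= K * `|x - y|) ->
  forall A, (lebesgue_stieltjes_measure G A <= K%:E * mu A)%E.
Proof.
move=> K0 GK A; rewrite -lee_pdivrMl//; apply: le_ereal_inf_tmp => _ [C [mC AC] <-].
rewrite lee_pdivrMl// -nneseriesZl; last by move=> n _; exact: wlength_ge0.
apply: (@le_trans _ _ (\sum_(0 <= k <oo) wlength G (C k))%E).
  by apply: ereal_inf_lbound; exists C.
apply: lee_nneseries => n _; first by move=> _; exact: wlength_ge0.
have [[x y] _ <-] := mC n.
rewrite wlength_itv /= lte_fin; case: (ltP x y) => xy;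
  last by rewrite mule_ge0 ?lee_fin ?(ltW K0)//; exact: (@wlength_ge0 R idfun).
rewrite wlength_itv_bnd ?(ltW xy)// -EFinB -EFinM lee_fin (le_trans (ler_norm _))// (le_trans (GK _ _))//.
by rewrite ger0_norm// subr_ge0 ltW.
Qed.

Lemma stieltjes_itv (G : cumulative R R) (a b : R) : a <= b ->
  lebesgue_stieltjes_measure G `]a, b]%classic = (G b - G a)%:E.
Proof.
move=> ab; rewrite /lebesgue_stieltjes_measure /measure_extension.
by rewrite measurable_mu_extE/=; [rewrite wlength_itv_bnd|exact: is_ocitv].
Qed.

(* A Lipschitz distribution function is the primitive of the Radon-Nikodym density of its measure. *)
Lemma cdf_derivable_ae (G : R -> R) (K a b : R) :
  (forall x y, `|G x - G y| <= K * `|x - y|) -> nondecreasing G ->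
  (forall x, x <= a -> G x = 0) -> (forall x, b <= x -> G x = 1) ->
  {ae mu, forall x, a < x -> derivable G x 1}.
Proof.
move=> GK Gnd Ga Gb.
have cG := lipschitz_continuous GK.
have K0 : 0 <= K.
  have := GK 0 1; rewrite sub0r normrN normr1 mulr1; exact: le_trans.
have GNy : G @ -oo --> (0:R).
  apply: cvg_near_cst; near=> x; apply: Ga; near: x; apply: nbhs_ninfty_le; exact: num_real.
have Gy : G @ +oo --> (1:R).
  apply: cvg_near_cst; near=> x; apply: Gb; near: x; apply: nbhs_pinfty_ge; exact: num_real.
pose Gc : cumulativeBounded (0:R) (1:R) := HB.pack G
  (isCumulative.Build R _ R G Gnd (right_continuousW cG))
  (isCumulativeBounded.Build R 0 1 G GNy Gy).
pose nu : probability _ R := lebesgue_stieltjes_measure Gc.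
(* [K] may be 0, while the comparison of measures takes a positive constant. *)
have K1 : 0 < K + 1 by rewrite ltr_wpDl.
have nuK A : (nu A <= (K + 1)%:E * mu A)%E.
  apply: (@stieltjes_le_lebesgue Gc) => // x y.
  by rewrite (le_trans (GK x y))// ler_wpM2r// lerDl.
have numu : nu `<< mu.
  move=> A muA B mB BA; have := nuK B.
  rewrite (muA _ mB BA) mule0 => nuB0.
  by apply/eqP; rewrite eq_le nuB0 measure_ge0.
have [f0 [_ f0fin f0int f0E]] := @radon_nikodym_sigma_finite _ _ _ mu nu numu.
pose g := fine \o f0.
have gE : EFin \o g = f0 by apply/funext => x /=; rewrite fineK.
have intg : mu.-integrable setT (EFin \o g) by rewrite gE.
have locg : locally_integrable setT g.
  exact: open_integrable_locally openT intg.
have GE x : a < x -> G x = (\int[mu]_(t in `]a, x]) g t)%R.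
  move=> ax; transitivity (fine (nu `]a, x]%classic)).
    rewrite /= [lebesgue_stieltjes_measure _ _](stieltjes_itv Gc (ltW ax))/=.
    by rewrite (Ga a)// subr0.
  by congr fine; rewrite [LHS]f0E// -gE.
(* Differentiability holds at every Lebesgue point of the density. *)
have := lebesgue_differentiation locg.
apply: filterS; first exact: (ae_filter_ringOfSetsType mu).
move=> x gx ax.
have [] := @FTC1_lebesgue_pt R g (BRight a) x (x + 1) _ _ _ gx => //.
- by rewrite ltrDl.
- exact: integrableS intg.
move=> dF _.
apply: near_eq_derivable dF.
near=> y; rewrite -GE//; near: y; exact: lt_nbhsr.
Unshelve. all: by end_near. Qed.

(** Reduction to a distribution function: the argument is clamped to [[- N, N]], the function is
    made increasing by adding [(K + 1) * c x], and the result is normalised to total mass 1. The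
    slope [K + 1] rather than [K] makes the total increase [M] positive. *)
Lemma lipschitz_derivable_ae (f : R -> R) (K : R) :
  (forall x y, `|f x - f y| <= K * `|x - y|) ->
  {ae mu, forall x, derivable f x 1}.
Proof.
move=> fK.
have K0 : 0 <= K.
  have := fK 0 1; rewrite sub0r normrN normr1 mulr1; exact: le_trans.
suff H (n : nat) : {ae mu, forall x, - n.+1%:R < x < n.+1%:R -> derivable f x 1}.
  apply: filterS (ae_foralln H).
  move=> x Hx.
  apply: (Hx (Num.bound `|x|)); rewrite -ltr_norml.
  by rewrite (lt_trans (archi_boundP (normr_ge0 x)))// ?ltr_nat.
pose N : R := n.+1%:R.
have N0 : 0 < N by rewrite ltr0n.
pose c x : R := Num.max (- N) (Num.min N x).
have cP x : [\/ x <= - N /\ c x = - N, - N <= x <= N /\ c x = x | N <= x /\ c x = N].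
  rewrite /c; case: (leP x (- N)) => xN.
    by constructor 1; split => //; rewrite min_r ?max_l//; lra.
  case: (leP x N) => xN'.
    by constructor 2; split; [lra|rewrite max_r//; lra].
  by constructor 3; split; [lra|rewrite max_r//; lra].
have cN x : - N <= c x <= N by case: (cP x) => -[? ->]; lra.
have cl x y : `|c x - c y| <= `|x - y|.
  by rewrite ler_norml; case: (ger0P (x - y)) => ?; case: (cP x) => -[? ->]; case: (cP y) => -[? ->]; lra.
have cm x y : x <= y -> c x <= c y.
  by case: (cP x) => -[? ->]; case: (cP y) => -[? ->]; lra.
pose g x := f (c x) + (K + 1) * c x.
have gl x y : `|g x - g y| <= (K + (K + 1)) * `|x - y|.
  rewrite /g opprD addrACA -mulrBr (le_trans (ler_normD _ _))// [leRHS]mulrDl; apply: lerD.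
    by rewrite (le_trans (fK _ _))// ler_wpM2l.
  by rewrite normrM ger0_norm ?addr_ge0// ler_wpM2l// addr_ge0.
have gs x y : x <= y -> c y - c x <= g y - g x.
  move=> xy; have := fK (c y) (c x); rewrite (@ger0_norm _ (c y - c x)) ?subr_ge0 ?cm//.
  by rewrite ler_norml /g; lra.
have cNl x : x <= - N -> c x = - N.
  by move=> xN; case: (cP x) => -[? ->]; lra.
have cNr x : N <= x -> c x = N.
  by move=> xN; case: (cP x) => -[? ->]; lra.
pose M := g N - g (- N).
have M0 : 0 < M.
  have := gs (- N) N; rewrite (cNr N)// (cNl (- N))// /M; lra.
have Mi : 0 <= M^-1 by rewrite invr_ge0 ltW.
pose G x := (g x - g (- N)) / M.
have := @cdf_derivable_ae G ((K + (K + 1)) / M) (- N) N.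
have gNl x : x <= - N -> g x = g (- N) by move=> ?; rewrite /g !cNl.
have gNr x : N <= x -> g x = g N by move=> ?; rewrite /g !cNr.
case=> [x y|x y xy|x xN|x xN|A [mA muA HA]].
- rewrite (_ : G x - G y = (g x - g y) / M); last by rewrite /G; ring.
  rewrite normrM (ger0_norm Mi) [leRHS]mulrAC ler_wpM2r//.
- by rewrite /G ler_wpM2r// lerD2r -subr_ge0 (le_trans _ (gs _ _ xy))// subr_ge0 cm.
- by rewrite /G gNl// subrr mul0r.
- by rewrite /G gNr// divff// gt_eqF.
exists A; split => // x xP; apply: HA; apply: contra_not xP => dG /andP[xl xr].
have {}dG := dG xl.
have : derivable (fun y => M * G y + g (- N) - (K + 1) * y) x 1.
  by apply: derivableB; [apply: derivableD|]; [apply: derivableM| |apply: derivableM].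
apply: near_eq_derivable.
have : \forall y \near x, - N < y < N.
  near=> y; apply/andP; split; near: y; [exact: lt_nbhsr|exact: lt_nbhsl].
apply: filterS => y /andP[yl yr]; rewrite /G mulrCA divff ?gt_eqF// mulr1 subrK.
have -> : g y = f y + (K + 1) * y.
  have cy : c y = y by case: (cP y) => -[? ->]; lra.
  by rewrite /g cy.
by rewrite addrK.
Unshelve. all: by end_near. Qed.

End Rademacher1.

Lemma aeS d (T : measurableType d) (R : realType) (m : {measure set T -> \bar R})
    (P Q : T -> Prop) :
  (forall x, P x -> Q x) -> {ae m, forall x, P x} -> {ae m, forall x, Q x}.
Proof. by move=> PQ; apply: (@filterS _ _ (ae_filter_ringOfSetsType m)). Qed.

Lemma aeI d (T : measurableType d) (R : realType) (m : {measure set T -> \bar R})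
    (P Q : T -> Prop) :
  {ae m, forall x, P x} -> {ae m, forall x, Q x} -> {ae m, forall x, P x /\ Q x}.
Proof. by move=> mP mQ; apply: (@filterI _ _ (ae_filter_ringOfSetsType m)). Qed.

(** * Borel sets and null sets of the plane *)

Section PlaneMeasure.
Context {R : realType}.
Local Notation mu := (@lebesgue_measure R).
Local Notation mu2 := ((@lebesgue_measure R \x @lebesgue_measure R)%E).

(** Open sets are countable unions of squares with rational centres and radii [n.+1%:R^-1], which
    are products of measurable sets. *)
Lemma open_measurable2 (A : set (R * R)) : open A -> measurable A.
Proof.
move=> oA.
pose B (p q : rat) (n : nat) : set (R * R) :=
  ball (ratr p : R) n.+1%:R^-1 `*` ball (ratr q : R) n.+1%:R^-1.
have -> : A = \bigcup_p \bigcup_q \bigcup_(n in [set n | B p q n `<=` A]) B p q n.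
  apply/seteqP; split => [[x y] Axy|z [p _ [q _ [n /= BA Bz]]]]; last exact: BA.
  have [e /= e0 eA] := (nbhs_ballP _ _).1 (open_nbhs_nbhs (conj oA Axy)).
  pose n := Num.bound (2 / e); pose d : R := n.+1%:R^-1.
  have d0 : 0 < d by rewrite invr_gt0.
  have de : d < e / 2.
    have ne : 2 / e < n.+1%:R.
      rewrite (lt_trans (archi_boundP _))// ?ltr_nat// divr_ge0// ltW//.
    by rewrite /d invf_plt ?posrE// ?divr_gt0// invf_div.
  have [x' [+ [p _ px]]] := dense_rat (ex_intro _ x (ballxx x d0)) (ball_open x d); rewrite -{x'}px => xp.
  have [y' [+ [q _ qy]]] := dense_rat (ex_intro _ y (ballxx y d0)) (ball_open y d); rewrite -{y'}qy => yq.
  exists p => //; exists q => //; exists n => /=; last by split; exact: ball_sym.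
  move=> [s t] [/= ps qt]; apply: eA; split => /=.
    apply: (@le_ball _ _ _ (d + d)); first by lra.
    exact: ball_triangle xp ps.
  apply: (@le_ball _ _ _ (d + d)); first by lra.
  exact: ball_triangle yq qt.
apply: bigcupT_measurable_rat => p; apply: bigcupT_measurable_rat => q.
apply: bigcup_measurable => n _.
by apply: measurableX; exact: measurable_ball.
Qed.

Lemma closed_measurable2 (A : set (R * R)) : closed A -> measurable A.
Proof. by move/closed_openC/open_measurable2/measurableC; rewrite setCK. Qed.

Lemma continuous_measurable_fun2 (f : R * R -> R) :
  continuous f -> measurable_fun setT f.
Proof.
move=> /continuousP cf; apply: (measurability _ (RGenOpens.measurableE R)).
move=> _ [_ [a [b ->] <-]]; rewrite setTI; apply: open_measurable2.
exact/cf/interval_open.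
Qed.

Lemma leb2_xsection0 (A : set (R * R)) : measurable A ->
  {ae mu, forall x, mu (xsection A x) = 0%E} -> mu2 A = 0%E.
Proof.
move=> mA A0; rewrite /product_measure1.
rewrite (ae_eq_integral (cst 0%E))//; first exact: integral0.
- exact: measurable_fun_xsection.
- by apply: aeS A0 => x /= -> _.
Qed.

Lemma leb2_ysection0 (A : set (R * R)) : measurable A ->
  {ae mu, forall y, mu (ysection A y) = 0%E} -> mu2 A = 0%E.
Proof.
move=> mA A0.
(* The product measure integrates vertical sections by definition; its uniqueness permits horizontal
   ones. *)
have -> : mu2 A = (mu \x^ mu)%E A.
  apply: product_measure_unique => // B C mB mC/=.
  by rewrite product_measure2E.
rewrite /product_measure2 (ae_eq_integral (cst 0%E))//; first exact: integral0.
- exact: measurable_fun_ysection.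
- by apply: aeS A0 => x /= -> _.
Qed.

Lemma xsection_leb2_0 (A : set (R * R)) : measurable A -> mu2 A = 0%E ->
  {ae mu, forall x, mu (xsection A x) = 0%E}.
Proof.
move=> mA; rewrite /product_measure1 => A0.
have mf : measurable_fun setT (mu \o xsection A) by exact: measurable_fun_xsection.
have /(ae_eq_integral_abs mu measurableT mf) : (\int[mu]_(x in setT) `|(mu \o xsection A) x| = 0)%E.
  by rewrite -[RHS]A0; apply: eq_integral => x _; rewrite gee0_abs.
by apply: aeS => x /= ->.
Qed.

End PlaneMeasure.

(** * Gradients of functions on the plane *)

Section Gradient.
Context {R : realType}.
Implicit Types (u : R * R -> R) (z h : R * R).

Definition lin2 (p q : R) (h : R * R) : R := h.1 * p + h.2 * q.

Lemma lin2_is_linear (p q : R) : linear (lin2 p q).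
Proof. by move=> a x y; rewrite /lin2 /= /GRing.scale /=; ring. Qed.
HB.instance Definition _ (p q : R) :=
  GRing.isLinear.Build R (R * R)%type R *:%R (lin2 p q) (lin2_is_linear p q).

Lemma lin2_continuous (p q : R) : continuous (lin2 p q).
Proof.
move=> x; apply: cvgD; apply: cvgM; (exact: cvg_cst || exact: cvg_fst || exact: cvg_snd).
Qed.

(** Differentiability in epsilon-delta form with explicit slopes, ready for estimates on difference
    quotients; [gradient_at_is_diff] translates it into [is_diff]. *)
Definition gradient_at u z (p q : R) := forall e, 0 < e ->
  exists2 d, 0 < d & forall h, `|h| < d -> `|u (z + h) - u z - lin2 p q h| <= e * `|h|.

Lemma norm_fst_le h : `|h.1| <= `|h|. Proof. by rewrite prod_normE le_max lexx. Qed.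
Lemma norm_snd_le h : `|h.2| <= `|h|. Proof. by rewrite prod_normE le_max lexx orbT. Qed.

Lemma lin2_le (p q : R) h : `|lin2 p q h| <= (`|p| + `|q|) * `|h|.
Proof.
rewrite (le_trans (ler_normD _ _))// !normrM [leRHS]mulrC mulrDr.
by apply: lerD; apply: ler_wpM2r => //; [exact: norm_fst_le|exact: norm_snd_le].
Qed.

Lemma gradient_at_is_diff u z (p q : R) :
  gradient_at u z p q -> is_diff z u (lin2 p q).
Proof.
move=> gu.
have H : u \o shift z = cst (u z) + lin2 p q +o_ (0 : R * R) id.
  apply/eqaddoP => e e0; have [d d0 gd] := gu e e0.
  near=> h; have /gd : `|h| < d.
    near: h; change (\forall x \near (0 : R * R), `|x| < d); exact: nbhs0_lt.
  by rewrite /= !fctE /= [h + z]addrC -addrA -opprD.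
have D := diff_unique (@lin2_continuous p q) H.
split; last exact: D.
by apply/diff_locallyP; rewrite D; split => //; exact: lin2_continuous.
Unshelve. all: by end_near. Qed.

(** Slopes that depend on the tolerance are enough: they make the difference quotients along each
    axis Cauchy, so partial derivatives [p], [q] exist. The slopes for tolerance [e / 5] are then
    within [2 * (e / 5)] of [p] and [q], and the errors add up to [e]. *)
Lemma approx_gradient u z :
  (forall e, 0 < e -> exists p q, exists2 d, 0 < d & forall h, `|h| < d ->
     `|u (z + h) - u z - lin2 p q h| <= e * `|h|) ->
  exists p q, gradient_at u z p q.
Proof.
move=> H.
suff G (i : R * R) : i = (1, 0) \/ i = (0, 1) ->
    exists p, forall e, 0 < e -> exists2 d, 0 < d & forall t : R, `|t| < d ->
      `|u (z + t *: i) - u z - t * p| <= e * `|t|.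
  have [p Hp] := G (1, 0) (or_introl erefl).
  have [q Hq] := G (0, 1) (or_intror erefl).
  exists p, q => e e0.
  have e50 : 0 < e / 5 by rewrite divr_gt0.
  have [p' [q' [d d0 H']]] := H _ e50.
  have [d1 d10 Hp'] := Hp _ e50; have [d2 d20 Hq'] := Hq _ e50.
  have pp : `|p' - p| <= 2 * (e / 5).
    pose t := Num.min d d1 / 2.
    have t0 : 0 < t by rewrite divr_gt0// lt_min d0.
    have td : t < d by rewrite /t; case: (leP d d1); lra.
    have td1 : t < d1 by rewrite /t; case: (leP d d1); lra.
    have := H' (t *: (1, 0)); have := Hp' t.
    rewrite prod_normE /= /lin2 /= !(scaler0, normr0, mul0r, addr0) /GRing.scale/= mulr1.
    rewrite (max_l (normr_ge0 _)) gtr0_norm// => /(_ td1) A /(_ td) B.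
    rewrite -(ler_pM2r t0) -[t in leLHS](gtr0_norm t0) -normrM.
    rewrite ler_norml in A; rewrite ler_norml in B; rewrite ler_norml; lra.
  have qq : `|q' - q| <= 2 * (e / 5).
    pose t := Num.min d d2 / 2.
    have t0 : 0 < t by rewrite divr_gt0// lt_min d0.
    have td : t < d by rewrite /t; case: (leP d d2); lra.
    have td1 : t < d2 by rewrite /t; case: (leP d d2); lra.
    have := H' (t *: (0, 1)); have := Hq' t.
    rewrite prod_normE /= /lin2 /= !(scaler0, normr0, mul0r, add0r) /GRing.scale/= mulr1.
    rewrite (max_r (normr_ge0 _)) gtr0_norm// => /(_ td1) A /(_ td) B.
    rewrite -(ler_pM2r t0) -[t in leLHS](gtr0_norm t0) -normrM.
    rewrite ler_norml in A; rewrite ler_norml in B; rewrite ler_norml; lra.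
  exists d => // h hd.
  have -> : u (z + h) - u z - lin2 p q h =
      (u (z + h) - u z - lin2 p' q' h) + lin2 (p' - p) (q' - q) h.
    by rewrite /lin2; ring.
  rewrite (le_trans (ler_normD _ _))//.
  have := lin2_le (p' - p) (q' - q) h; have := H' h hd.
  have : (`|p' - p| + `|q' - q|) * `|h| <= 4 * (e / 5) * `|h|.
    by apply: ler_wpM2r => //; lra.
  lra.
move=> ii.
have ni : `|i| = 1.
  by rewrite prod_normE; case: ii => -> /=; rewrite normr0 normr1 ?(max_l ler01) ?(max_r ler01).
pose DQ (t : R) := t^-1 * (u (z + t *: i) - u z).
have : cauchy_ex (DQ @ 0^').
  move=> e e0; have e20 : 0 < e / 2 by rewrite divr_gt0.
  have [p [q [d d0 Hd]]] := H _ e20.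
  exists (lin2 p q i); rewrite /= nbhs_simpl /=.
  near=> t.
  have t0 : t != 0 by near: t; exact: nbhs_dnbhs_neq.
  have td : `|t| < d by near: t; apply: dnbhs0_lt.
  rewrite /ball /= distrC /DQ -[lin2 p q i](mulKf t0) -mulrBr normrM normfV.
  have := Hd (t *: i); rewrite normrZ ni mulr1 linearZ => /(_ td).
  rewrite [X in _ -> X < _]mulrC ltr_pdivrMr ?normr_gt0// => /le_lt_trans; apply.
  by rewrite ltr_pM2r ?normr_gt0//; lra.
move=> /cauchy_exP /cauchy_cvgP /cvg_ex [p Hp]; exists p => e e0.
have /cvgrPdist_le /(_ e e0) := Hp.
rewrite near_withinE => -[d /= d0 Hd]; exists d => // t td.
have [->|t0] := eqVneq t 0; first by rewrite scale0r addr0 subrr mul0r subr0 normr0 mulr0.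
have := Hd t; rewrite /= sub0r normrN => /(_ td t0).
rewrite distrC -(ler_pM2r (_ : 0 < `|t|)) ?normr_gt0// -normrM mulrBl /DQ.
by rewrite mulrAC mulVf// mul1r [p * t]mulrC.
Unshelve. all: by end_near. Qed.

End Gradient.

(** * Differentiability almost everywhere of Lipschitz functions on the plane *)

Section Rademacher2.
Context {R : realType}.
Local Notation mu := (@lebesgue_measure R).
Local Notation mu2 := ((@lebesgue_measure R \x @lebesgue_measure R)%E).

Lemma closed_forall_le (T : topologicalType) (I : Type) (P : I -> Prop)
    (f : I -> T -> R) (c : I -> R) :
  (forall i, continuous (f i)) -> closed [set z | forall i, P i -> f i z <= c i].
Proof.
move=> cf.
have -> : [set z | forall i, P i -> f i z <= c i] =
    \bigcap_(i in P) (f i @^-1` [set y | y <= c i]).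
  by apply/seteqP; split => z /=.
apply: closed_bigI => i _; apply: preimage_closed; last exact: closed_le.
by move=> x _; exact: cf.
Qed.

Lemma derivable_approx (f : R -> R) (a e : R) : derivable f a 1 -> 0 < e ->
  exists p : R, exists2 d, 0 < d &
    forall h, `|h| < d -> `|f (a + h) - f a - h * p| <= e * `|h|.
Proof.
move=> /cvg_ex[p Hp] e0; exists p.
have /cvgrPdist_le /(_ e e0) := Hp.
rewrite near_withinE => -[d /= d0 Hd]; exists d => // t td.
have [->|t0] := eqVneq t 0; first by rewrite addr0 subrr mul0r subr0 normr0 mulr0.
have := Hd t; rewrite /= sub0r normrN => /(_ td t0).
rewrite distrC -(ler_pM2r (_ : 0 < `|t|)) ?normr_gt0// -normrM mulrBl.
rewrite /GRing.scale /= mulr1 mulrAC mulVf// mul1r [t + a]addrC.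
by rewrite [p * t]mulrC.
Qed.

Lemma approx_rat (p e : R) : 0 < e -> exists q : rat, `|p - ratr q| < e.
Proof.
move=> e0; have [x [+ [q _ qx]]] := dense_rat (ex_intro _ p (ballxx p e0)) (ball_open p e).
rewrite -{x}qx => pq.
by exists q.
Qed.

Lemma eps_ex (e : R) : 0 < e -> exists k : nat, k.+1%:R^-1 < e.
Proof.
move=> e0; exists (Num.bound e^-1).
rewrite invf_plt ?posrE//.
by rewrite (lt_trans (archi_boundP _)) ?ltr_nat// invr_ge0 ltW.
Qed.

(** If the ball of radius [n * r] about [c], which lies in [ball b r], missed [A], then [A] would
    fill at most the fraction [1 - n] of [ball b r]; this is impossible for small [r] at a density
    point. *)
Lemma density_point_near (A : set R) (b n : R) : measurable A ->
  (mu (A `&` ball b r) * (mu (ball b r))^-1)%E @[r --> 0^'+] --> (1%:E : \bar R) ->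
  0 < n < 1 ->
  exists2 d, 0 < d & forall r c, 0 < r < d -> `|c - b| + n * r <= r ->
    exists2 y, A y & `|y - c| < n * r.
Proof.
move=> mA Ab /andP[n0 n1].
have o1 : nbhs (1%:E : \bar R) [set y | ((1 - n)%:E < y)%E].
  by apply: open_nbhs_nbhs; split; [exact: open_ereal_gt_ereal|rewrite /= lte_fin; lra].
have : \forall r \near 0^'+, ((1 - n)%:E < mu (A `&` ball b r) * (mu (ball b r))^-1)%E := Ab _ o1.
rewrite near_withinE => -[d /= d0 Hd]; exists d => // r c /andP[r0 rd] cr.
apply: contrapT => Hy.
have nr0 : 0 < n * r by rewrite mulr_gt0.
have mb (x e : R) : measurable (ball x e) := measurable_ball x e.
have mAb : measurable (A `&` ball b r) by apply: measurableI; [exact: mA|exact: mb].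
have := Hd r; rewrite /= sub0r normrN gtr0_norm// => /(_ rd r0).
rewrite lebesgue_measure_ball ?(ltW r0)// inver mulrn_eq0 /= gt_eqF//.
rewrite lte_pdivlMr ?pmulrn_lgt0// -EFinM => lt1.
have cb : ball c (n * r) `<=` ball b r.
  move=> y; rewrite /ball /= => cy; rewrite [b - y](_ : _ = (b - c) + (c - y)); last by ring.
  rewrite (le_lt_trans (ler_normD _ _))// distrC; lra.
have disj : (A `&` ball b r) `&` ball c (n * r) = set0.
  rewrite -subset0 => y [[Ay _] cy]; apply: Hy; exists y => //.
  by rewrite distrC.
have : (mu ((A `&` ball b r) `|` ball c (n * r)) <= mu (ball b r))%E.
  apply: le_measure; rewrite ?inE; [|exact: mb|by move=> y [[]|/cb]].
  by apply: measurableU; [exact: mAb|exact: mb].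
have -> : mu ((A `&` ball b r) `|` ball c (n * r)) = (mu (A `&` ball b r) + mu (ball c (n * r)))%E.
  by apply: measureU; [exact: mAb|exact: mb|exact: disj].
rewrite !lebesgue_measure_ball ?(ltW r0) ?(ltW nr0)//.
move: lt1; case: (mu (A `&` ball b r)) => [x lt1|//|//].
rewrite -EFinD lee_fin; move: lt1; rewrite lte_fin; lra.
Qed.

Variables (u : R * R -> R) (K : R).
Hypothesis uK : forall z w, `|u z - u w| <= K * `|z - w|.

Let ucont : continuous u := lipschitz_continuous uK.
Let eps (k : nat) : R := k.+1%:R^-1.

(** The points at which [u] has slopes [p], [q] up to [eps k] at scale [eps m], in the directions
    allowed by [P]: all of them, or the horizontal ones. With scale and slopes fixed the set is
    closed. *)
Definition approx_diff_set (P : R * R -> Prop) k m p q : set (R * R) :=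
  [set z | forall h, P h /\ `|h| < eps m ->
    `|u (z + h) - u z - lin2 p q h| <= eps k * `|h|].

Lemma closed_approx_diff_set P k m p q : closed (approx_diff_set P k m p q).
Proof.
apply: (@closed_forall_le (R * R)%type (R * R)%type (fun h => P h /\ `|h| < eps m)
  (fun h z => `|u (z + h) - u z - lin2 p q h|) (fun h => eps k * `|h|) _) => h z.
apply: cvg_norm; apply: cvgB; last exact: cvg_cst.
apply: cvgB; last exact: ucont.
have c1 : continuous (fun z : R * R => z + h).
  by move=> x; apply: cvgD; [exact: cvg_id|exact: cvg_cst].
by apply: (@continuous_comp _ _ _ (fun z : R * R => z + h) u); [exact: c1|exact: ucont].
Qed.

(* Rational slopes suffice up to [eps k], which makes the set of differentiability points Borel. *)
Definition diff_set : set (R * R) :=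
  \bigcap_k \bigcup_m \bigcup_(p : rat) \bigcup_(q : rat)
    approx_diff_set setT k m (ratr p) (ratr q).

Lemma measurable_diff_set : measurable diff_set.
Proof.
apply: bigcap_measurable => // k _; apply: bigcup_measurable => m _.
apply: bigcupT_measurable_rat => p; apply: bigcupT_measurable_rat => q.
exact: closed_measurable2 (@closed_approx_diff_set _ _ _ _ _).
Qed.

Lemma diff_set_gradient z : diff_set z -> exists p q, gradient_at u z p q.
Proof.
move=> Dz; apply: approx_gradient => e e0.
have [k ke] := eps_ex e0.
have [m _ [p _ [q _ H]]] := Dz k I.
exists (ratr p), (ratr q); exists (eps m); first by rewrite invr_gt0 ltr0n.
move=> h hm; rewrite (le_trans (H h _))//.
by apply: ler_wpM2r => //; exact: ltW.
Qed.

Definition xdiff_set : set (R * R) :=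
  \bigcap_k \bigcup_m \bigcup_(p : rat)
    approx_diff_set (fun h => h.2 = 0) k m (ratr p) 0.

Lemma measurable_xdiff_set : measurable xdiff_set.
Proof.
apply: bigcap_measurable => // k _; apply: bigcup_measurable => m _.
apply: bigcupT_measurable_rat => p.
exact: closed_measurable2 (@closed_approx_diff_set _ _ _ _ _).
Qed.

Lemma derivable_xdiff_set a b : derivable (fun s => u (s, b)) a 1 -> xdiff_set (a, b).
Proof.
move=> du k _.
have k0 : 0 < eps k / 2 by rewrite divr_gt0// invr_gt0 ltr0n.
have [p [d d0 Hd]] := derivable_approx du k0.
have [q pq] := approx_rat p k0.
have [m md] := eps_ex d0.
exists m => //; exists q => // h [h2 hm].
have hh : h = (h.1, 0) by rewrite -h2; case: (h).
have nh : `|h| = `|h.1| by rewrite prod_normE h2 normr0 max_l.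
rewrite nh /lin2 mulr0 addr0.
have -> : (a, b) + h = (a + h.1, b) by rewrite {1}hh; congr pair; rewrite /= addr0.
have /Hd : `|h.1| < d by rewrite -nh (lt_trans hm).
have : `|h.1 * (p - ratr q)| <= `|h.1| * (eps k / 2).
  by rewrite normrM ler_wpM2l// ltW.
have -> : u (a + h.1, b) - u (a, b) - h.1 * ratr q =
  (u (a + h.1, b) - u (a, b) - h.1 * p) + h.1 * (p - ratr q) by ring.
move=> A B; rewrite (le_trans (ler_normD _ _))//; lra.
Qed.

Lemma slice_lipschitz1 b s t : `|u (s, b) - u (t, b)| <= K * `|s - t|.
Proof.
rewrite (le_trans (uK _ _))//; have -> : (s, b) - (t, b) = (s - t, 0).
  by congr pair; rewrite /= subrr.
by rewrite prod_normE /= normr0 max_l.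
Qed.

Lemma slice_lipschitz2 a s t : `|u (a, s) - u (a, t)| <= K * `|s - t|.
Proof.
rewrite (le_trans (uK _ _))//; have -> : (a, s) - (a, t) = (0, s - t).
  by congr pair; rewrite /= subrr.
by rewrite prod_normE /= normr0 max_r.
Qed.

Lemma lip_ge0 : 0 <= K.
Proof. have := slice_lipschitz1 0 0 1; rewrite sub0r normrN normr1 mulr1; exact: le_trans. Qed.

(** Fubini used twice: the one-dimensional theorem makes the exceptional set null on every
    horizontal line, hence null in the plane, hence null on almost every vertical line. *)
Lemma xdiff_set_ae : {ae mu, forall a, mu (xsection (~` xdiff_set) a) = 0%E}.
Proof.
have mX : measurable (~` xdiff_set) by apply: measurableC; exact: measurable_xdiff_set.
apply: (xsection_leb2_0 mX); apply: (leb2_ysection0 mX).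
apply: aeW => b; apply/negligibleP; first exact: measurable_ysection.
have [N [mN N0 HN]] := lipschitz_derivable_ae (slice_lipschitz1 b).
exists N; split => // a; rewrite ysectionE /= => /= Xab; apply: HN => /= da; apply: Xab.
exact: derivable_xdiff_set.
Qed.

(** To expand [u] from [(a, b)] to [(a + h.1, b + h.2)], move vertically first and then
    horizontally. The horizontal move needs a point [(a, y)] with the same slope and scale as
    [(a, b)]; as [b] is a density point of such [y], one exists close to [b + h.2], and the
    Lipschitz bound pays for the difference. *)
Lemma diff_set_of_slices a b :
  derivable (fun t => u (a, t)) b 1 -> xdiff_set (a, b) ->
  (forall k m (p : rat), let A := xsection (approx_diff_set (fun h => h.2 = 0) k m (ratr p) 0) a in
    A b ->
    (mu (A `&` ball b r) * (mu (ball b r))^-1)%E @[r --> 0^'+] --> (1%:E : \bar R)) ->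
  diff_set (a, b).
Proof.
move=> du Xab dens k _.
have K0 := lip_ge0.
(* Error budget: [2 * K] for replacing [b + h.2] by [y] twice, and one each for the horizontal
   expansion, the vertical expansion and the rational slope. The value 4 instead of 3 also gives
   [4 * e <= 1]. *)
pose e := eps k / (2 * K + 4).
have k0 : 0 < eps k by rewrite invr_gt0 ltr0n.
have k1 : eps k <= 1 by rewrite invf_le1// ?ltr0n// ler1n.
have e0 : 0 < e by rewrite divr_gt0//; lra.
have ek : (2 * K + 3) * e <= eps k.
  have : (2 * K + 4) * e = eps k by rewrite /e mulrCA divff ?mulr1//; lra.
  lra.
have e1 : e <= 1 / 4.
  have : 4 * e <= (2 * K + 4) * e by apply: ler_wpM2r; [exact: ltW|lra].
  have : (2 * K + 4) * e = eps k by rewrite /e mulrCA divff ?mulr1//; lra.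
  lra.
have [k' ke] := eps_ex e0.
have [m _ [p _ Ep]] := Xab k' I.
have mA : measurable (xsection (approx_diff_set (fun h => h.2 = 0) k' m (ratr p) 0) a).
  by apply: measurable_xsection; exact: closed_measurable2 (@closed_approx_diff_set _ _ _ _ _).
have Ab : xsection (approx_diff_set (fun h => h.2 = 0) k' m (ratr p) 0) a b.
  by rewrite xsectionE.
have n01 : 0 < e / 2 < 1 by lra.
have [d d0 Hd] := density_point_near mA (dens _ _ _ Ab) n01.
have [q0 [d1 d10 Hq0]] := derivable_approx du e0.
have [q q0q] := approx_rat q0 e0.
have D0 : 0 < Num.min (d / 2) (Num.min d1 (eps m)).
  by rewrite !lt_min d10 divr_gt0//= invr_gt0 ltr0n.
have [m' Hm'] := eps_ex D0.
exists m' => //; exists p => //; exists q => // h [_ hm].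
set r := `|h| in hm *.
have [r0|r0] := eqVneq r 0.
  have -> : h = 0 by apply/eqP; rewrite -normr_eq0 -/r r0.
  by rewrite addr0 subrr linear0 subr0 r0 mulr0 normr0.
have {}r0 : 0 < r by rewrite lt_def r0 normr_ge0.
have : r < Num.min (d / 2) (Num.min d1 (eps m)) by exact: lt_trans Hm'.
rewrite !lt_min => /and3P[rd rd1 rm].
have h1r : `|h.1| <= r := norm_fst_le h.
have h2r : `|h.2| <= r := norm_snd_le h.
(* The radius is doubled because [b + h.2] may be at distance [r] from [b]; the fraction [e / 2] of
   it is [e * r]. *)
have r2 : 0 < 2 * r < d by rewrite mulr_gt0//=; lra.
have bh2 : `|b + h.2 - b| + e / 2 * (2 * r) <= 2 * r.
  by rewrite [b + _]addrC addrK; nra.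
have [y Ay yc] := Hd _ _ r2 bh2.
have {}yc : `|y - (b + h.2)| < e * r by lra.
rewrite xsectionE /= in Ay.
have ineq1 : `|u (a + h.1, y) - u (a, y) - h.1 * ratr p| <= e * r.
  have := Ay (h.1, 0); rewrite /lin2 /= mulr0 addr0 prod_normE /= normr0 max_l//.
  have -> : (a, y) + (h.1, 0) = (a + h.1, y) by congr pair; rewrite /= addr0.
  move=> /(_ (conj erefl (le_lt_trans h1r rm))) /le_trans; apply.
  apply: ler_pM => //; first by rewrite invr_ge0 ler0n.
  exact: ltW.
have ineq2 := slice_lipschitz2 (a + h.1) (b + h.2) y.
have ineq3 := slice_lipschitz2 a y (b + h.2).
have ineq4 := Hq0 _ (le_lt_trans h2r rd1).
have ineq5 : `|h.2 * (q0 - ratr q)| <= r * e.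
  by rewrite normrM; apply: ler_pM => //; exact: ltW.
have ineq6 : K * `|y - (b + h.2)| <= K * (e * r) by apply: ler_wpM2l => //; exact: ltW.
have ineq7 : e * `|h.2| <= e * r by apply: ler_wpM2l => //; exact: ltW.
have ineq8 : (2 * K + 3) * e * r <= eps k * r by apply: ler_wpM2r => //; exact: ltW.
have -> : (a, b) + h = (a + h.1, b + h.2) by [].
rewrite [`|b + h.2 - y|]distrC in ineq2.
rewrite !ler_norml in ineq1 ineq2 ineq3 ineq4 ineq5.
rewrite ler_norml /lin2; lra.
Qed.

(** On almost every vertical line, almost every point has a vertical derivative, belongs to
    [xdiff_set], and is a density point of each of the countably many sets [approx_diff_set]
    containing it. *)
Lemma diff_set_ae : mu2 (~` diff_set) = 0%E.
Proof.
have mD : measurable (~` diff_set) by apply: measurableC; exact: measurable_diff_set.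
apply: (leb2_xsection0 mD); apply: aeS xdiff_set_ae => a Xa.
apply/negligibleP; first exact: measurable_xsection.
have H1 := lipschitz_derivable_ae (slice_lipschitz2 a).
have H2 : {ae mu, forall b, xdiff_set (a, b)}.
  exists (xsection (~` xdiff_set) a); split => //.
    by apply: measurable_xsection; apply: measurableC; exact: measurable_xdiff_set.
  by move=> b; rewrite xsectionE.
have H3 : {ae mu, forall b k m (p : rat),
    let A := xsection (approx_diff_set (fun h => h.2 = 0) k m (ratr p) 0) a in A b ->
    (mu (A `&` ball b r) * (mu (ball b r))^-1)%E @[r --> 0^'+] --> (1%:E : \bar R)}.
  apply: ae_foralln => k; apply: ae_foralln => m.
  (* Rational slopes are indexed by natural numbers, so that a countable intersection applies. *)
  pose Q n (b : R) := if unpickle n is Some p then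
    let A := xsection (approx_diff_set (fun h => h.2 = 0) k m (ratr p) 0) a in A b ->
    (mu (A `&` ball b r) * (mu (ball b r))^-1)%E @[r --> 0^'+] --> (1%:E : \bar R)
    else True.
  have HQ n : {ae mu, forall b, Q n b}.
    rewrite /Q; case: (unpickle n) => [p|]; last exact: aeW.
    have mA : measurable (xsection (approx_diff_set (fun h => h.2 = 0) k m (ratr p) 0) a).
      by apply: measurable_xsection; exact: closed_measurable2 (@closed_approx_diff_set _ _ _ _ _).
    apply: aeS (lebesgue_density mA) => b; rewrite indicE => + Ab.
    by rewrite mem_set.
  apply: aeS (ae_foralln HQ) => b Hb p; have := Hb (pickle p).
  by rewrite /Q pickleK.
have H4 : {ae mu, forall b, diff_set (a, b)}.
  apply: (@aeS _ _ _ mu _ _ _ (aeI H1 (aeI H2 H3))) => b [b1 [b2 b3]].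
  exact: diff_set_of_slices.
by move: H4; rewrite /almost_everywhere; apply: negligibleS => b; rewrite xsectionE.
Qed.

End Rademacher2.

(** * Jensen's inequality for polyaffine minorants *)

Section Shear.
Context {R : realType}.
Local Notation T2 := (measurableTypeR R * measurableTypeR R)%type.
Local Notation mu := (@lebesgue_measure R).
Local Notation mu2 := ((@lebesgue_measure R \x @lebesgue_measure R)%E).

Lemma lebesgue_measure_shift (c : R) (A : set R) : measurable A ->
  mu ((fun x => x + c) @^-1` A) = mu A.
Proof.
move=> mA.
have mf : measurable_fun setT (fun x : measurableTypeR R => x + c : measurableTypeR R).
  by apply: continuous_measurable_fun => x; apply: cvgD; [exact: cvg_id|exact: cvg_cst].
pose sh : {mfun measurableTypeR R >-> measurableTypeR R} :=
  MeasurableFun.Pack (MeasurableFun.Class (isMeasurableFun.Build _ _ _ _ _ mf)).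
suff : mu A = pushforward mu sh A by move=> ->.
apply: lebesgue_measure_unique => //= _ [[a b] _ <-].
rewrite /pushforward /=.
have -> : (fun x => x + c) @^-1` `]a, b] = `]a - c, b - c]%classic.
  by apply/seteqP; split => x /=; rewrite !in_itv /= ltrBlDr lerBrDr.
rewrite !lebesgue_measure_itv /= !lte_fin ltrD2r; case: ifP => // _.
by rewrite -!EFinB; congr EFin; ring.
Qed.

Lemma leb2_xsection (A : set (R * R)) : mu2 A = (\int[mu]_x mu (xsection A x))%E.
Proof. by []. Qed.

Lemma leb2_ysection (A : set (R * R)) : measurable A ->
  mu2 A = (\int[mu]_y mu (ysection A y))%E.
Proof.
move=> mA; have -> : mu2 A = (mu \x^ mu)%E A.
  apply: product_measure_unique => // B C mB mC/=.
  by rewrite product_measure2E.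
by [].
Qed.

Definition xshear (s : R -> R) (z : R * R) : R * R := (z.1 + s z.2, z.2).
Definition yshear (s : R -> R) (z : R * R) : R * R := (z.1, z.2 + s z.1).

Lemma continuous_fst2 : continuous (@fst R R). Proof. by move=> x; exact: cvg_fst. Qed.
Lemma continuous_snd2 : continuous (@snd R R). Proof. by move=> x; exact: cvg_snd. Qed.

Lemma measurable_pair2 (f g : R * R -> R) :
  continuous f -> continuous g -> measurable_fun setT (fun z => (f z, g z)).
Proof.
by move=> cf cg; apply: measurable_fun_pair; exact: continuous_measurable_fun2.
Qed.

Lemma measurable_xshear s : continuous s -> measurable_fun setT (xshear s).
Proof.
move=> cs; apply: measurable_pair2; last exact: continuous_snd2.
move=> z; apply: cvgD; first exact: cvg_fst.
by apply: (@continuous_comp _ _ _ snd s); [exact: continuous_snd2|exact: cs].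
Qed.

Lemma measurable_yshear s : continuous s -> measurable_fun setT (yshear s).
Proof.
move=> cs; apply: measurable_pair2; first exact: continuous_fst2.
move=> z; apply: cvgD; first exact: cvg_snd.
by apply: (@continuous_comp _ _ _ fst s); [exact: continuous_fst2|exact: cs].
Qed.

(** Each horizontal section is merely translated, by an amount that depends on its height. *)
Lemma leb2_xshear s (A : set (R * R)) : continuous s -> measurable A ->
  mu2 (xshear s @^-1` A) = mu2 A.
Proof.
move=> cs mA.
have mS : measurable (xshear s @^-1` A).
  by rewrite -[X in measurable X]setTI; exact: (measurable_xshear cs).
rewrite (leb2_ysection mS) (leb2_ysection mA); apply: eq_integral => y _.
rewrite -(lebesgue_measure_shift (s y) (measurable_ysection y mA)).
by congr (mu _); apply/seteqP; split => x /=; rewrite !ysectionE.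
Qed.

Lemma leb2_yshear s (A : set (R * R)) : continuous s -> measurable A ->
  mu2 (yshear s @^-1` A) = mu2 A.
Proof.
move=> cs mA; rewrite !leb2_xsection; apply: eq_integral => x _.
rewrite -(lebesgue_measure_shift (s x) (measurable_xsection x mA)).
by congr (mu _); apply/seteqP; split => y /=; rewrite !xsectionE.
Qed.

Lemma leb2_shift (a : R * R) (A : set (R * R)) : measurable A ->
  mu2 ((fun z => z + a) @^-1` A) = mu2 A.
Proof.
move=> mA.
have c1 : continuous (fun _ : R => a.1) by move=> ?; exact: cvg_cst.
have c2 : continuous (fun _ : R => a.2) by move=> ?; exact: cvg_cst.
have mS : measurable (xshear (fun=> a.1) @^-1` A).
  by rewrite -[X in measurable X]setTI; exact: (measurable_xshear c1).
by rewrite -(leb2_xshear c1 mA) -(leb2_yshear c2 mS).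
Qed.

Definition shift2 (a z : R * R) : R * R := z + a.

Lemma integrable_shift (a : R * R) (f : R * R -> R) :
  mu2.-integrable setT (EFin \o f) ->
  mu2.-integrable setT (EFin \o (fun z => f (shift2 a z))) /\
  (\int[mu2]_z f (shift2 a z) = \int[mu2]_z f z)%R.
Proof.
move=> fi.
have mT : measurable_fun setT (shift2 a : T2 -> T2).
  apply: (@measurable_pair2 (fun z => z.1 + a.1) (fun z => z.2 + a.2)).
    by move=> z; apply: cvgD; [exact: cvg_fst|exact: cvg_cst].
  by move=> z; apply: cvgD; [exact: cvg_snd|exact: cvg_cst].
have mf := measurable_int _ fi.
have E (g : T2 -> \bar R) : measurable_fun setT g ->
    (forall z, 0 <= g z)%E -> (\int[mu2]_z g (shift2 a z) = \int[mu2]_z g z)%E.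
  move=> mg g0.
  have := @ge0_integral_pushforward _ _ _ _ _ (shift2 a : T2 -> T2) mT mu2 setT g
    measurableT mg (fun z _ => g0 z).
  rewrite preimage_setT => <-; apply: eq_measure_integral => A mA _.
  exact: leb2_shift.
have fi' : mu2.-integrable setT (EFin \o (fun z => f (shift2 a z))).
  move/integrableP : fi => [_ fi]; apply/integrableP; split.
    exact: (measurableT_comp mf mT).
  rewrite (E (abse \o EFin \o f))//.
    exact: (measurableT_comp (@abse_measurable R setT) mf).
  by move=> z /=; rewrite lee_fin.
split => //; congr fine.
have := @integral_pushforward _ _ _ _ _ (shift2 a : T2 -> T2) mT mu2 setT (EFin \o f) mf.
rewrite preimage_setT => /(_ fi' measurableT) <-.
by apply: eq_measure_integral => A mA _; rewrite -[RHS](leb2_shift a mA).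
Qed.
End Shear.

(** * Dominated convergence on a box and discrete integration by parts *)

Section NullLagrangian.
Context {R : realType}.
Local Notation T2 := (measurableTypeR R * measurableTypeR R)%type.
Local Notation mu2 := ((@lebesgue_measure R \x @lebesgue_measure R)%E).

(** Contains the support of [u (z + a)] for every [u] vanishing outside the unit square and every
    [|a| <= 1]: a common domain of finite measure for all the difference quotients. *)
Definition box : set (R * R) := `[(-3)%R, 3%R]%classic `*` `[(-3)%R, 3%R]%classic.

Lemma measurable_box : measurable (box : set T2).
Proof. by apply: measurableX; exact: measurable_itv. Qed.

Lemma boxE z : box z <-> `|z| <= 3.
Proof.
rewrite /box /= prod_normE ge_max !in_itv /= !ler_norml.
by split => [[-> ->]|/andP[-> ->]].
Qed.

Lemma box_fin : (mu2 box < +oo)%E.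
Proof.
rewrite product_measure1E; try exact: measurable_itv.
by rewrite /= !lebesgue_measure_itv /= !lte_fin; case: ifP => _; rewrite -?EFinB -?EFinM ?mule0 ltry.
Qed.

Lemma box_integrable (f : T2 -> R) (C : R) : measurable_fun setT f ->
  (forall z, `|f z| <= C) -> (forall z, ~ box z -> f z = 0) ->
  mu2.-integrable setT (EFin \o f).
Proof.
move=> mf fC f0.
have -> : EFin \o f = (EFin \o f) \_ box.
  apply/funext => z; rewrite /patch; case: ifPn => // /negP zb.
  by rewrite /= f0// => bz; apply: zb; exact/mem_set.
rewrite -(integrable_mkcond _ measurable_box).
apply: measurable_bounded_integrable; [exact: measurable_box|exact: box_fin| |].
  exact: measurable_funTS.
exists C; split; first exact: num_real.
by move=> M CM z _; apply: le_trans (fC z) (ltW CM).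
Qed.

Lemma box_dct (f_ : nat -> T2 -> R) (f : T2 -> R) (C : R) (N : set T2) :
  (forall n, measurable_fun setT (f_ n)) -> measurable_fun setT f ->
  measurable N -> mu2 N = 0%E ->
  (forall z, ~ N z -> f_ n z @[n --> \oo] --> f z) ->
  (forall n z, `|f_ n z| <= C) -> (forall n z, ~ box z -> f_ n z = 0) ->
  (\int[mu2]_z f_ n z)%R @[n --> \oo] --> (\int[mu2]_z f z)%R.
Proof.
move=> mf_ mf mN N0 ff fC f0.
pose g (z : T2) : R := C * \1_box z.
have iC : mu2.-integrable setT (EFin \o g).
  apply: (@box_integrable _ `|C|).
  - have mI : measurable_fun (setT : set T2) (\1_box : T2 -> R).
      by apply/measurable_indicP; exact: measurable_box.
    exact: (measurable_funM (measurable_cst C) mI).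
  - by move=> z; rewrite /g normrM indicE; case: (_ \in _); rewrite ?normr0 ?normr1 ?mulr0 ?mulr1.
  - by move=> z zb; rewrite /g indicE memNset// mulr0.
have H1 n : measurable_fun setT (EFin \o f_ n) by exact/measurable_EFinP.
have H2 : measurable_fun setT (EFin \o f) by exact/measurable_EFinP.
have H3 : {ae mu2, forall z, setT z -> (fun n => (EFin \o f_ n) z) @ \oo --> (EFin \o f) z}.
  exists N; split => // z /= zN; apply: contrapT => Nz; apply: zN => _.
  by apply/cvg_EFin; [exact: nearW|exact: ff].
have H4 : {ae mu2, forall z n, setT z ->
    (`|(EFin \o f_ n) z| <= (EFin \o g) z)%E}.
  apply: aeW => z n _ /=; rewrite lee_fin /g indicE.
  have [zb|zb] := pselect (box z); first by rewrite mem_set// mulr1.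
  by rewrite f0// normr0 memNset// mulr0.
have [fi _ H] := dominated_convergence measurableT H1 H2 H3 iC H4.
apply: fine_cvg; rewrite fineK; first exact: H.
exact: integrable_fin_num.
Qed.


Lemma integrable_EFinB (D : set T2) (f g : T2 -> R) : measurable D ->
  mu2.-integrable D (EFin \o f) -> mu2.-integrable D (EFin \o g) ->
  mu2.-integrable D (EFin \o (fun z => f z - g z)).
Proof. by move=> mD fi gi; exact: (integrableB mD fi gi). Qed.

Lemma integrable_EFinD (D : set T2) (f g : T2 -> R) : measurable D ->
  mu2.-integrable D (EFin \o f) -> mu2.-integrable D (EFin \o g) ->
  mu2.-integrable D (EFin \o (fun z => f z + g z)).
Proof. by move=> mD fi gi; exact: (integrableD mD fi gi). Qed.

Lemma integrable_EFinZ (D : set T2) (c : R) (f : T2 -> R) : measurable D ->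
  mu2.-integrable D (EFin \o f) ->
  mu2.-integrable D (EFin \o (fun z => c * f z)).
Proof. by move=> mD fi; exact: (integrableZl mD c fi). Qed.

Definition lip0 (K : R) (u : R * R -> R) : Prop :=
  (forall z w, `|u z - u w| <= K * `|z - w|) /\ (forall z, ~ square z -> u z = 0).

Lemma square_norm (z : R * R) : square z -> `|z| <= 1.
Proof.
move=> [/andP[? ?] /andP[? ?]]; rewrite prod_normE ge_max !ler_norml.
by apply/andP; split; lra.
Qed.

Lemma lip0_ge0 K u : lip0 K u -> 0 <= K.
Proof. by case=> uK _; exact: lip_ge0 uK. Qed.

Lemma lip0_bound K u z : lip0 K u -> `|u z| <= K.
Proof.
move=> /[dup] /lip0_ge0 K0 [uK u0].
have [sz|nz] := pselect (square z); last by rewrite u0// normr0.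
have -> : u z = u z - u 0 by rewrite (u0 0) ?subr0// => -[]; rewrite /= ltxx.
rewrite (le_trans (uK _ _))// subr0 -[leRHS]mulr1.
by rewrite ler_wpM2l// square_norm.
Qed.

Lemma lip0_continuous K u : lip0 K u -> continuous u.
Proof. by case=> uK _; exact: lipschitz_continuous uK. Qed.

Lemma shift2_continuous (a : R * R) : continuous (shift2 a).
Proof. by move=> z; apply: cvgD; [exact: cvg_id|exact: cvg_cst]. Qed.

Lemma lip0_shift_measurable K u a : lip0 K u ->
  measurable_fun (setT : set T2) (u \o shift2 a : T2 -> R).
Proof.
move=> /lip0_continuous cu; apply: continuous_measurable_fun2 => z.
by apply: (@continuous_comp _ _ _ (shift2 a) u); [exact: shift2_continuous|exact: cu].
Qed.

Lemma lip0_shift_box K u a z : lip0 K u -> `|a| <= 1 -> ~ box z -> u (shift2 a z) = 0.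
Proof.
move=> [_ u0] a1 zb; apply: u0 => /square_norm za; apply: zb; apply/boxE.
have -> : z = (z + a) - a by rewrite addrK.
by rewrite (le_trans (ler_normB _ _))//; rewrite /shift2 in za; lra.
Qed.

Definition corr u v (a b : R * R) : R :=
  (\int[mu2]_z (u (shift2 a z) * v (shift2 b z)))%R.

Lemma corr_integrable K L u v a b : lip0 K u -> lip0 L v -> `|a| <= 1 ->
  mu2.-integrable setT (EFin \o (fun z => u (shift2 a z) * v (shift2 b z))).
Proof.
move=> hu hv a1; apply: (@box_integrable _ (K * L)).
- by apply: measurable_funM; [exact: (lip0_shift_measurable a hu)|exact: (lip0_shift_measurable b hv)].
- by move=> z; rewrite normrM ler_pM// ?(lip0_bound _ hu)// (lip0_bound _ hv).
- by move=> z zb; rewrite (lip0_shift_box hu)// mul0r.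
Qed.

Lemma corr_shift K L u v a b c : lip0 K u -> lip0 L v -> `|a| <= 1 ->
  corr u v (a + c) (b + c) = corr u v a b.
Proof.
move=> hu hv a1; rewrite /corr.
have [_ <-] := integrable_shift c (corr_integrable b hu hv a1).
congr fine; apply: eq_integral => z _.
by rewrite /shift2 -![z + c + _]addrA ![c + _]addrC.
Qed.

Definition dif u (a z : R * R) : R := u (shift2 a z) - u z.

Lemma dif_corr K L u v a b : lip0 K u -> lip0 L v -> `|a| <= 1 -> `|b| <= 1 ->
  (\int[mu2]_z (dif u a z * dif v b z))%R = corr u v a b - corr u v a 0 - corr u v 0 b + corr u v 0 0.
Proof.
move=> hu hv a1 b1.
have n0 : `|0 : R * R| <= 1 by rewrite normr0.
have I (a b : R * R) : `|a| <= 1 -> _ := @corr_integrable K L u v a b hu hv.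
have I1 := integrable_EFinB measurableT (I _ b a1) (I _ 0 a1).
have I2 := integrable_EFinB measurableT I1 (I _ b n0).
rewrite /corr -(RintegralB measurableT (I _ b a1) (I _ 0 a1)).
rewrite -(RintegralB measurableT I1 (I _ b n0)).
rewrite -(RintegralD measurableT I2 (I _ 0 n0)).
congr fine; apply: eq_integral => z _; congr EFin.
by rewrite /dif /shift2 !addr0; ring.
Qed.

(* Summation by parts: expanding the products, only correlations occur, and these are translation
   invariant. It is the discrete form of [\int det D phi = 0]. *)
Lemma dif_swap K L u v a b : lip0 K u -> lip0 L v -> `|a| <= 1 -> `|b| <= 1 ->
  (\int[mu2]_z (dif u a z * dif v b z))%R = (\int[mu2]_z (dif u (- b) z * dif v (- a) z))%R.
Proof.
move=> hu hv a1 b1.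
rewrite (dif_corr hu hv)// (dif_corr hu hv) ?normrN//.
have n0 : `|0 : R * R| <= 1 by rewrite normr0.
have -> : corr u v (- b) (- a) = corr u v a b.
  rewrite -(corr_shift b (- a - b) hu hv a1); congr corr.
    by rewrite addrA subrr add0r.
  by rewrite addrCA subrr addr0.
have -> : corr u v (- b) 0 = corr u v 0 b.
  by rewrite -(corr_shift b (- b) hu hv n0) add0r subrr.
have -> : corr u v 0 (- a) = corr u v a 0.
  by rewrite -(corr_shift 0 (- a) hu hv a1) add0r subrr.
ring.
Qed.

Lemma lip0_integrable K u a : lip0 K u -> `|a| <= 1 ->
  mu2.-integrable setT (EFin \o (fun z => u (shift2 a z))).
Proof.
move=> hu a1; apply: (@box_integrable _ K).
- exact: (lip0_shift_measurable a hu).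
- by move=> z; exact: lip0_bound.
- by move=> z zb; rewrite (lip0_shift_box hu).
Qed.

Lemma dif_int0 K u a : lip0 K u -> `|a| <= 1 -> (\int[mu2]_z (dif u a z))%R = 0.
Proof.
move=> hu a1; have n0 : `|0 : R * R| <= 1 by rewrite normr0.
have i0 := lip0_integrable hu n0.
have iu : mu2.-integrable setT (EFin \o u).
  rewrite (_ : EFin \o u = EFin \o (fun z => u (shift2 0 z)))//.
  by apply/funext => z; rewrite /shift2 /= addr0.
rewrite /dif RintegralB//; last exact: (lip0_integrable hu a1).
by have [_ ->] := integrable_shift a iu; rewrite subrr.
Qed.

Lemma gradient_cvg u z p q (t : nat -> R) i : gradient_at u z p q ->
  t @ \oo --> (0 : R) -> (forall n, t n != 0) ->
  (t n)^-1 * dif u (t n *: i) z @[n --> \oo] --> lin2 p q i.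
Proof.
move=> gu t0 tn0; apply/cvgrPdist_le => e e0.
have i1 : 0 < `|i| + 1 by rewrite ltr_wpDl.
have ei : 0 < e / (`|i| + 1) by rewrite divr_gt0.
have [d d0 H] := gu _ ei.
have di : 0 < d / (`|i| + 1) by rewrite divr_gt0.
move/cvgrPdist_lt : t0 => /(_ _ di); apply: filterS => n.
rewrite sub0r normrN ltr_pdivlMr// => tn.
have tnd : `|t n *: i| < d.
  by rewrite normrZ (le_lt_trans _ tn)// ler_wpM2l// lerDl.
have := H _ tnd; rewrite normrZ linearZ /GRing.scale /= -/(shift2 (t n *: i) z) -/(dif u _ z) => A.
have -> : lin2 p q i - (t n)^-1 * dif u (t n *: i) z =
    - ((t n)^-1 * (dif u (t n *: i) z - t n * lin2 p q i)) by field.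
rewrite normrN normrM normfV ler_pdivrMl ?normr_gt0// (le_trans A)//.
by rewrite mulrCA ler_wpM2l// mulrAC ler_pdivrMr// ler_wpM2l ?(ltW e0)// lerDl.
Qed.

End NullLagrangian.

(** * Integrals of partial derivatives and of their products *)

Section GradientIntegrals.
Context {R : realType}.
Local Notation T2 := (measurableTypeR R * measurableTypeR R)%type.
Local Notation mu2 := ((@lebesgue_measure R \x @lebesgue_measure R)%E).
Implicit Types u v : R * R -> R.

(** The value 0 on the exceptional set makes the partial derivatives total functions that are
    bounded and measurable everywhere. *)
Definition grad_spec (N : set T2) u (g1 g2 : T2 -> R) : Prop :=
  (forall z, ~ N z -> gradient_at u z (g1 z) (g2 z)) /\
  (forall z, N z -> g1 z = 0 /\ g2 z = 0).

Definition unit_dir (i : R * R) : Prop := i = (1, 0) \/ i = (0, 1).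

Lemma unit_dir_norm i : unit_dir i -> `|i| = 1.
Proof.
by rewrite prod_normE => -[] -> /=; rewrite normr0 normr1 ?(max_l ler01) ?(max_r ler01).
Qed.

Definition step (n : nat) : R := n.+1%:R^-1.

Lemma step_gt0 n : 0 < step n. Proof. by rewrite invr_gt0 ltr0n. Qed.
Lemma step_le1 n : step n <= 1. Proof. by rewrite invf_le1 ?ltr0n// ler1n. Qed.

Lemma step_cvg : step @ \oo --> (0 : R).
Proof. exact: cvg_harmonic. Qed.

Lemma stepN_cvg : (fun n => - step n) @ \oo --> (0 : R).
Proof. by rewrite -oppr0; apply: cvgN; exact: step_cvg. Qed.

Definition quot u (i : R * R) (t : R) (z : T2) : R := t^-1 * dif u (t *: i) z.

Lemma quot_measurable K u i t : lip0 K u -> measurable_fun setT (quot u i t).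
Proof.
move=> hu.
have m1 := lip0_shift_measurable (t *: i) hu.
have m0 : measurable_fun setT (u : T2 -> R).
  by apply: continuous_measurable_fun2; exact: lip0_continuous hu.
exact: (measurable_funM (measurable_cst t^-1) (measurable_funB m1 m0)).
Qed.

Lemma quot_bound K u i t z : lip0 K u -> unit_dir i -> `|quot u i t z| <= K.
Proof.
move=> hu /unit_dir_norm i1; have K0 := lip0_ge0 hu.
have [t0|t0] := eqVneq t 0; first by rewrite /quot t0 invr0 mul0r normr0.
rewrite /quot normrM normfV ler_pdivrMl ?normr_gt0// mulrC.
rewrite /dif (le_trans (hu.1 _ _))// /shift2 addrC addKr.
by rewrite normrZ i1 mulr1.
Qed.

Lemma quot_box K u i t z : lip0 K u -> unit_dir i -> `|t| <= 1 ->
  ~ box z -> quot u i t z = 0.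
Proof.
move=> hu /unit_dir_norm i1 t1 zb; rewrite /quot /dif.
rewrite (lip0_shift_box hu _ zb) ?normrZ ?i1 ?mulr1//.
by have := lip0_shift_box (a := 0) hu _ zb; rewrite /shift2 addr0 => ->; rewrite ?normr0// subrr mulr0.
Qed.

(** By convexity, a point outside the square cannot lie between two points of the square on a
    line. *)
Lemma outside_square (z i : R * R) : unit_dir i -> ~ square z ->
  (forall t, 0 < t -> ~ square (shift2 (t *: i) z)) \/
  (forall t, 0 < t -> ~ square (shift2 (- t *: i) z)).
Proof.
move=> ii /= nz; have [H|H] := pselect (forall t, 0 < t -> ~ square (shift2 (t *: i) z)); first by left.
right=> t t0 sq; apply: H => s s0 sq'; apply: nz.
move: sq sq'; rewrite /square /shift2 /=.
case: ii => -> /=; rewrite /GRing.scale /= !mulr0 !mulr1 !addr0 => -[/andP[? ?] /andP[? ?]] [/andP[? ?] /andP[? ?]];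
 split; apply/andP; split; lra.
Qed.

Section one.
Variables (K : R) (u : R * R -> R) (N : set T2) (g1 g2 : T2 -> R).
Hypotheses (hu : lip0 K u) (mN : measurable N) (N0 : mu2 N = 0%E).
Hypothesis gs : grad_spec N u g1 g2.

Definition pd (i : R * R) (z : T2) : R := lin2 (g1 z) (g2 z) i.

Lemma pdN i z : N z -> pd i z = 0.
Proof. by move=> /gs.2 [z1 z2]; rewrite /pd /lin2 z1 z2 !mulr0 addr0. Qed.

Lemma quot_cvg i z (t : nat -> R) : t @ \oo --> (0 : R) -> (forall n, t n != 0) ->
  ~ N z -> quot u i (t n) z @[n --> \oo] --> pd i z.
Proof. by move=> t0 tn0 Nz; exact: gradient_cvg (gs.1 _ Nz) t0 tn0. Qed.

Lemma step_neq0 n : step n != 0. Proof. by rewrite gt_eqF// step_gt0. Qed.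
Lemma stepN_neq0 n : - step n != 0. Proof. by rewrite oppr_eq0 step_neq0. Qed.

(** The partial derivative is the pointwise limit of difference quotients cut off on [N]. *)
Lemma pd_measurable i : measurable_fun setT (pd i).
Proof.
have mI : measurable_fun (setT : set T2) (\1_(~` N) : T2 -> R).
  by apply/measurable_indicP; exact: measurableC.
apply: (@measurable_fun_cvg _ T2 R setT (fun n z => \1_(~` N) z * quot u i (step n) z)).
  by move=> n; exact: (measurable_funM mI (quot_measurable i (step n) hu)).
move=> z _; have [Nz|Nz] := pselect (N z).
  rewrite pdN// indicE memNset; last by move=> /(_ Nz).
  by under eq_fun do rewrite mul0r; exact: cvg_cst.
rewrite indicE mem_set//; under eq_fun do rewrite mul1r.
exact: quot_cvg step_cvg step_neq0 Nz.
Qed.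

Lemma pd_bound i z : unit_dir i -> `|pd i z| <= K.
Proof.
move=> ii; have [Nz|Nz] := pselect (N z); first by rewrite pdN// normr0 (lip0_ge0 hu).
have /cvg_norm H := quot_cvg (i := i) step_cvg step_neq0 Nz.
apply: (cvgr_to_le H).
by apply: nearW => n; exact: (quot_bound _ _ hu).
Qed.

(** This includes the boundary of the square: for steps of a suitable sign all the difference
    quotients there are 0. *)
Lemma pd_square i z : unit_dir i -> ~ square z -> pd i z = 0.
Proof.
move=> ii zs; have [Nz|Nz] := pselect (N z); first exact: pdN.
have cst0 (t : nat -> R) : t @ \oo --> (0 : R) -> (forall n, t n != 0) ->
    (forall n, ~ square (shift2 (t n *: i) z)) -> pd i z = 0.
  move=> t0 tn0 ts; have H := quot_cvg (i := i) t0 tn0 Nz.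
  have E n : quot u i (t n) z = 0.
    by rewrite /quot /dif (hu.2 _ (ts n)) (hu.2 _ zs) subrr mulr0.
  apply: (cvg_unique (@Rhausdorff R) H).
  rewrite (_ : (fun n => quot u i (t n) z) = fun=> 0); [exact: cvg_cst|exact/funext].
have [H|H] := outside_square ii zs.
  by apply: (cst0 step step_cvg step_neq0) => n; apply: H; exact: step_gt0.
by apply: (cst0 _ stepN_cvg stepN_neq0) => n; apply: H; exact: step_gt0.
Qed.

Lemma square_box (z : R * R) : square z -> box z.
Proof. by move=> /square_norm z1; apply/boxE; lra. Qed.

Lemma pd_box i z : unit_dir i -> ~ box z -> pd i z = 0.
Proof. by move=> ii zb; apply: pd_square => // /square_box. Qed.

Lemma pd_integrable i : unit_dir i -> mu2.-integrable setT (EFin \o pd i).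
Proof.
move=> ii; apply: (@box_integrable _ _ K); first exact: pd_measurable.
- by move=> z; exact: pd_bound.
- by move=> z; exact: pd_box.
Qed.

Lemma step_norm n : `|step n| <= 1.
Proof. by rewrite gtr0_norm ?step_gt0 ?step_le1. Qed.

(** Difference quotients have integral 0 by translation invariance; dominated convergence passes to
    the limit. *)
Lemma pd_int0 i : unit_dir i -> (\int[mu2]_z (pd i z))%R = 0.
Proof.
move=> ii.
have := @box_dct _ (fun n => quot u i (step n)) (pd i) K N (fun n => quot_measurable i _ hu)
  (pd_measurable i) mN N0 (fun z => quot_cvg (i := i) (z := z) step_cvg step_neq0)
  (fun n z => quot_bound _ z hu ii) (fun n z => quot_box hu ii (step_norm n)).
have E n : (\int[mu2]_z quot u i (step n) z)%R = 0.
  have si : `|step n *: i| <= 1 by rewrite normrZ (unit_dir_norm ii) mulr1 step_norm.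
  rewrite /quot RintegralZl//; first by rewrite (dif_int0 hu si) mulr0.
  apply: integrable_EFinB => //; first exact: lip0_integrable hu si.
  have := lip0_integrable (a := 0) hu; rewrite normr0 => /(_ ler01).
  by rewrite (_ : EFin \o _ = EFin \o u)//; apply/funext => z /=; rewrite /shift2 addr0.
rewrite (_ : (fun n => (\int[mu2]_z quot u i (step n) z)%R) = fun=> 0); last exact/funext.
move=> H; exact: (cvg_unique (@Rhausdorff R) H (cvg_cst _)).
Qed.

End one.

Section two.
Variables (K L : R) (u v : R * R -> R) (N : set T2) (g1 g2 h1 h2 : T2 -> R).
Hypotheses (hu : lip0 K u) (hv : lip0 L v) (mN : measurable N) (N0 : mu2 N = 0%E).
Hypotheses (gs : grad_spec N u g1 g2) (hs : grad_spec N v h1 h2).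

Lemma pd_prod_integrable i j : unit_dir i -> unit_dir j ->
  mu2.-integrable setT (EFin \o (fun z => pd g1 g2 i z * pd h1 h2 j z)).
Proof.
move=> ii jj; apply: (@box_integrable _ _ (K * L)).
- exact: (measurable_funM (pd_measurable hu mN gs i) (pd_measurable hv mN hs j)).
- by move=> z; rewrite normrM ler_pM// ?(pd_bound hu gs)// (pd_bound hv hs).
- by move=> z zb; rewrite (pd_box hu gs)// mul0r.
Qed.

Lemma quot_prod_cvg i j (t : nat -> R) : unit_dir i -> unit_dir j ->
  t @ \oo --> (0 : R) -> (forall n, t n != 0) -> (forall n, `|t n| <= 1) ->
  (\int[mu2]_z (quot u i (t n) z * quot v j (t n) z))%R @[n --> \oo] -->
  (\int[mu2]_z (pd g1 g2 i z * pd h1 h2 j z))%R.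
Proof.
move=> ii jj t0 tn0 t1; apply: (@box_dct _ _ _ (K * L) N) => //.
- by move=> n; exact: (measurable_funM (quot_measurable i _ hu) (quot_measurable j _ hv)).
- exact: (measurable_funM (pd_measurable hu mN gs i) (pd_measurable hv mN hs j)).
- by move=> z Nz; apply: cvgM; [exact: (quot_cvg gs)|exact: (quot_cvg hs)].
- by move=> n z; rewrite normrM ler_pM// ?(quot_bound _ _ hu)// (quot_bound _ _ hv).
- by move=> n z zb; rewrite (quot_box hu)// mul0r.
Qed.

(** [dif_swap] exchanges the two directions and reverses the steps. Hence the left side is the limit
    along the steps [step n] and the right side the limit along [- step n], of equal integrals. *)
Lemma pd_null_lagrangian i j : unit_dir i -> unit_dir j ->
  (\int[mu2]_z (pd g1 g2 i z * pd h1 h2 j z))%R =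
  (\int[mu2]_z (pd g1 g2 j z * pd h1 h2 i z))%R.
Proof.
move=> ii jj.
have A := quot_prod_cvg ii jj step_cvg step_neq0 step_norm.
have nN n : `|- step n| <= 1 by rewrite normrN step_norm.
have B := quot_prod_cvg jj ii stepN_cvg stepN_neq0 nN.
apply: (cvg_unique (@Rhausdorff R) A); rewrite (_ : (fun n => _) = (fun n =>
  (\int[mu2]_z (quot u j (- step n) z * quot v i (- step n) z))%R))//.
apply/funext => n.
have si k : unit_dir k -> `|step n *: k| <= 1.
  by move=> kk; rewrite normrZ (unit_dir_norm kk) mulr1 step_norm.
have di a b : `|a| <= 1 -> mu2.-integrable setT (EFin \o (fun z => dif u a z * dif v b z)).
  move=> a1; apply: (@box_integrable _ _ (2 * K * (2 * L))).
  - apply: measurable_funM.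
      apply: measurable_funB; first exact: (lip0_shift_measurable a hu).
      by apply: continuous_measurable_fun2; exact: lip0_continuous hu.
    apply: measurable_funB; first exact: (lip0_shift_measurable b hv).
    by apply: continuous_measurable_fun2; exact: lip0_continuous hv.
  - move=> z; rewrite normrM ler_pM// /dif (le_trans (ler_normB _ _))// mulr_natl mulr2n lerD//;
    by [exact: lip0_bound hu|exact: lip0_bound hv].
  - move=> z zb; rewrite /dif (lip0_shift_box hu a1 zb).
    have := lip0_shift_box (a := 0) hu _ zb; rewrite /shift2 addr0 => ->; last by rewrite normr0.
    by rewrite subrr mul0r.
have E (a b : R * R) (t : R) : `|a| <= 1 ->
    (\int[mu2]_z (t^-1 * dif u a z * (t^-1 * dif v b z)))%R =
    t^-1 * t^-1 * (\int[mu2]_z (dif u a z * dif v b z))%R.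
  move=> a1; rewrite -RintegralZl//; last exact: di.
  by congr fine; apply: eq_integral => z _; congr EFin; ring.
rewrite /quot E; last exact: si.
rewrite (dif_swap hu hv); [|exact: si|exact: si].
rewrite E; last by rewrite scaleNr normrN; exact: si.
by rewrite !scaleNr invrN mulrNN.
Qed.

End two.

End GradientIntegrals.

(** * Comparison of integrals of arbitrary functions *)

Section NonMeasurableIntegral.
Local Open Scope ereal_scope.
Context d (T : measurableType d) (R : realType).
Variable m : {measure set T -> \bar R}.

(* No measurability is required: [integral] is a difference of suprema over simple minorants of
   the positive and negative parts. *)
Lemma le_integral_nonmeas (D : set T) (f g : T -> \bar R) :
  (forall x, D x -> f x <= g x) -> \int[m]_(x in D) f x <= \int[m]_(x in D) g x.
Proof.
move=> fg; rewrite /integral; apply: leeB.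
  apply: ereal_sup_le => _ [h hf <-]; exists h => // x.
  apply: le_trans (hf x) _; rewrite !funeposE /patch; case: ifPn => // /set_mem Dx.
  by rewrite ge_max le_max fg//= le_max lexx orbT.
apply: ereal_sup_le => _ [h hf <-]; exists h => // x.
apply: le_trans (hf x) _; rewrite !funenegE /patch; case: ifPn => // /set_mem Dx.
by rewrite ge_max le_max leeN2 fg//= le_max lexx orbT.
Qed.

Variables (D N : set T) (mD : measurable D) (mN : measurable N) (N0 : m N = 0).

(** With [c] equal to [-oo] or [+oo], the measurable side of an inequality is modified on the null
    set so that the inequality holds there trivially; the other function is left as it is. *)
Let ae_patch (k : T -> \bar R) (c : \bar R) : measurable_fun D k ->
  \int[m]_(x in D) k x = \int[m]_(x in D) (if x \in N then c else k x).
Proof.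
move=> mk; apply: ae_eq_integral => //.
  apply: measurable_fun_if; [exact: mD| |exact: (@measurable_cst _ _ _ _ _ c)|exact: measurable_funS mk].
  apply: (measurable_fun_bool true); rewrite (_ : _ @^-1` _ = N); first exact: measurableI.
  by apply/seteqP; split => x /=; [move/set_mem|move/mem_set].
exists N; split => // x /= H; apply: contrapT => Nx; apply: H => Dx.
by rewrite memNset.
Qed.

Lemma ge_integral_nonmeas_ae (f k : T -> \bar R) : measurable_fun D k ->
  (forall x, D x -> ~ N x -> k x <= f x) ->
  \int[m]_(x in D) k x <= \int[m]_(x in D) f x.
Proof.
move=> mk kf; rewrite (ae_patch -oo mk); apply: le_integral_nonmeas => x Dx.
by case: ifPn => [_|/negP Nx]; [exact: leNye|apply: kf => // ?; apply: Nx; exact/mem_set].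
Qed.

Lemma le_integral_nonmeas_ae (f k : T -> \bar R) : measurable_fun D k ->
  (forall x, D x -> ~ N x -> f x <= k x) ->
  \int[m]_(x in D) f x <= \int[m]_(x in D) k x.
Proof.
move=> mk kf; rewrite (ae_patch +oo mk); apply: le_integral_nonmeas => x Dx.
by case: ifPn => [_|/negP Nx]; [exact: leey|apply: kf => // ?; apply: Nx; exact/mem_set].
Qed.

End NonMeasurableIntegral.

(** * Gradients of test maps and Jensen's inequality *)

Section Jensen.
Context {R : realType}.
Local Notation T2 := (measurableTypeR R * measurableTypeR R)%type.
Local Notation mu2 := ((@lebesgue_measure R \x @lebesgue_measure R)%E).
Local Notation M2 := 'M[R]_2.

Lemma det2 (A : M2) : \det A = A 0 0 * A 1 1 - A 0 1 * A 1 0.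
Proof.
rewrite (expand_det_row A 0) !big_ord_recl big_ord0 addr0 /cofactor !det_mx11 !mxE /=.
have -> : lift 0 0 = 1 :> 'I_2 by exact/val_inj.
have -> : lift 1 0 = 0 :> 'I_2 by exact/val_inj.
by rewrite expr0 mul1r expr1; ring.
Qed.

Lemma measurable_square : measurable (@square R : set T2).
Proof.
have -> : @square R = `]0%R, 1%R[%classic `*` `]0%R, 1%R[%classic.
  by apply/seteqP; split => z; rewrite /square /= !in_itv.
by apply: measurableX; exact: measurable_itv.
Qed.

Lemma square_measure : mu2 (@square R) = 1%E.
Proof.
have -> : @square R = `]0%R, 1%R[%classic `*` `]0%R, 1%R[%classic.
  by apply/seteqP; split => z; rewrite /square /= !in_itv.
rewrite product_measure1E; try exact: measurable_itv.
by rewrite /= !lebesgue_measure_itv /= !lte_fin ltr01 -EFinB subr0 mule1.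
Qed.

Lemma Dmat_gradient (phi : R * R -> R * R) z p0 q0 p1 q1 :
  gradient_at (fst \o phi) z p0 q0 -> gradient_at (snd \o phi) z p1 q1 ->
  [/\ Dmat phi z 0 0 = p0, Dmat phi z 0 1 = q0, Dmat phi z 1 0 = p1 & Dmat phi z 1 1 = q1].
Proof.
move=> /gradient_at_is_diff d0 /gradient_at_is_diff d1.
have E : phi = (fun z => ((fst \o phi) z, (snd \o phi) z)).
  by apply/funext => w /=; case: (phi w).
have D h : 'd phi z h = (lin2 p0 q0 h, lin2 p1 q1 h).
  rewrite {1}E; have := @diff_val _ _ _ _ _ _ _ (is_diff_pair d0 d1).
  by move=> ->.
by split; rewrite mxE /coord2 /= D /lin2 /= ?mul1r ?mul0r ?addr0 ?add0r.
Qed.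

Lemma W1inf0_lip0 (phi : R * R -> R * R) : W1inf0 phi ->
  exists K, lip0 K (fst \o phi) /\ lip0 K (snd \o phi).
Proof.
move=> [[K pK] p0]; exists K; split; split => [z w|z zs] /=; try by rewrite p0.
  have -> : (phi z).1 - (phi w).1 = (phi z - phi w).1 by [].
  by rewrite (le_trans (norm_fst_le _)).
have -> : (phi z).2 - (phi w).2 = (phi z - phi w).2 by [].
  by rewrite (le_trans (norm_snd_le _)).
Qed.

Lemma grad_spec_ex (N : set T2) (u : R * R -> R) :
  (forall z, ~ N z -> exists p q, gradient_at u z p q) ->
  exists g1 g2, grad_spec N u g1 g2.
Proof.
move=> H.
have G z : exists pq : R * R, (~ N z -> gradient_at u z pq.1 pq.2) /\ (N z -> pq = 0).
  have [Nz|Nz] := pselect (N z); first by exists 0; split.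
  by have [p [q Hpq]] := H z Nz; exists (p, q); split.
have [g Hg] := choice G.
exists (fst \o g), (snd \o g); split => z Nz /=; first exact: (Hg z).1.
by have -> := (Hg z).2 Nz.
Qed.

Lemma W1inf0_gradient (phi : R * R -> R * R) : W1inf0 phi ->
  exists N : set T2, exists a b c d : T2 -> R,
    [/\ measurable N, mu2 N = 0%E, grad_spec N (fst \o phi) a b,
        grad_spec N (snd \o phi) c d &
        forall z, ~ N z -> [/\ Dmat phi z 0 0 = a z, Dmat phi z 0 1 = b z,
           Dmat phi z 1 0 = c z & Dmat phi z 1 1 = d z]].
Proof.
move=> /W1inf0_lip0 [K [[h0 _] [h1 _]]].
pose N : set T2 := (~` diff_set (fst \o phi)) `|` (~` diff_set (snd \o phi)).
have m0 : measurable (~` diff_set (fst \o phi)).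
  by apply: measurableC; exact: measurable_diff_set h0.
have m1 : measurable (~` diff_set (snd \o phi)).
  by apply: measurableC; exact: measurable_diff_set h1.
have mN : measurable N by exact: measurableU.
have N0 : mu2 N = 0%E.
  apply: (measure_negligible mN); apply: negligibleU.
    by exists (~` diff_set (fst \o phi)); split => //; exact: diff_set_ae h0.
  by exists (~` diff_set (snd \o phi)); split => //; exact: diff_set_ae h1.
have G0 z : ~ N z -> exists p q, gradient_at (fst \o phi) z p q.
  move=> Nz; apply: diff_set_gradient; apply: contrapT => H; apply: Nz; by left.
have G1 z : ~ N z -> exists p q, gradient_at (snd \o phi) z p q.
  move=> Nz; apply: diff_set_gradient; apply: contrapT => H; apply: Nz; by right.
have [a [b ab]] := grad_spec_ex G0; have [c [d cd]] := grad_spec_ex G1.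
exists N, a, b, c, d; split => // z Nz.
by apply: Dmat_gradient; [exact: ab.1|exact: cd.1].
Qed.

(** A minorant that is affine in [G] and in the determinant integrates to its value [e] at [G = 0],
    because the entries of [Dmat phi] and its determinant have mean 0. *)
Lemma polyaffine_jensen (f : M2 -> \bar R) (F : M2) (e p00 p01 p10 p11 m : R)
    (phi : R * R -> R * R) : W1inf0 phi ->
  (forall G : M2, ((e + p00 * G 0 0 + p01 * G 0 1 + p10 * G 1 0 + p11 * G 1 1 +
     m * (\det (F + G) - \det F))%:E <= f (F + G)%R)%E) ->
  (e%:E <= \int[@leb2 R]_(x in @square R) f (F + Dmat phi x)%R)%E.
Proof.
move=> hphi H.
have [N [a [b [c [d [mN N0 ab cd D]]]]]] := W1inf0_gradient hphi.
have [K [h0 h1]] := W1inf0_lip0 hphi.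
pose i1 : R * R := (1, 0); pose i2 : R * R := (0, 1).
have u1 : unit_dir i1 by left.
have u2 : unit_dir i2 by right.
have aE : a = pd a b i1 by apply/funext => z; rewrite /pd /lin2 mul1r mul0r addr0.
have bE : b = pd a b i2 by apply/funext => z; rewrite /pd /lin2 mul1r mul0r add0r.
have cE : c = pd c d i1 by apply/funext => z; rewrite /pd /lin2 mul1r mul0r addr0.
have dE : d = pd c d i2 by apply/funext => z; rewrite /pd /lin2 mul1r mul0r add0r.
have on (g : T2 -> R) : mu2.-integrable setT (EFin \o g) -> (forall z, ~ square z -> g z = 0) ->
    (\int[mu2]_(z in @square R) g z)%R = (\int[mu2]_z g z)%R.
  move=> gi g0; rewrite Rintegral_mkcond; congr Rintegral; apply/funext => z.
  by rewrite /patch; case: ifPn => // /negP zs; rewrite g0// => ?; apply: zs; exact/mem_set.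
have iS (g : T2 -> R) : mu2.-integrable setT (EFin \o g) -> mu2.-integrable (@square R) (EFin \o g).
  by apply: integrableS => //; exact: measurable_square.
have ia : mu2.-integrable setT (EFin \o a) by rewrite aE; exact: pd_integrable h0 mN ab _ u1.
have ib : mu2.-integrable setT (EFin \o b) by rewrite bE; exact: pd_integrable h0 mN ab _ u2.
have ic : mu2.-integrable setT (EFin \o c) by rewrite cE; exact: pd_integrable h1 mN cd _ u1.
have id_ : mu2.-integrable setT (EFin \o d) by rewrite dE; exact: pd_integrable h1 mN cd _ u2.
have iad : mu2.-integrable setT (EFin \o (fun z => a z * d z)).
  by rewrite {1}aE {1}dE; exact: pd_prod_integrable h0 h1 mN ab cd _ _ u1 u2.
have ibc : mu2.-integrable setT (EFin \o (fun z => b z * c z)).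
  by rewrite {1}bE {1}cE; exact: pd_prod_integrable h0 h1 mN ab cd _ _ u2 u1.
have a0 z : ~ square z -> a z = 0 by move=> zs; rewrite aE (pd_square h0 ab u1 zs).
have b0 z : ~ square z -> b z = 0 by move=> zs; rewrite bE (pd_square h0 ab u2 zs).
have c0 z : ~ square z -> c z = 0 by move=> zs; rewrite cE (pd_square h1 cd u1 zs).
have d0 z : ~ square z -> d z = 0 by move=> zs; rewrite dE (pd_square h1 cd u2 zs).
have Ia : (\int[mu2]_(z in @square R) a z)%R = 0.
  by rewrite (on _ ia a0) aE (pd_int0 h0 mN N0 ab u1).
have Ib : (\int[mu2]_(z in @square R) b z)%R = 0.
  by rewrite (on _ ib b0) bE (pd_int0 h0 mN N0 ab u2).
have Ic : (\int[mu2]_(z in @square R) c z)%R = 0.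
  by rewrite (on _ ic c0) cE (pd_int0 h1 mN N0 cd u1).
have Id : (\int[mu2]_(z in @square R) d z)%R = 0.
  by rewrite (on _ id_ d0) dE (pd_int0 h1 mN N0 cd u2).
have Iadbc : (\int[mu2]_(z in @square R) (a z * d z))%R = (\int[mu2]_(z in @square R) (b z * c z))%R.
  rewrite (on _ iad) => [|z zs]; last by rewrite a0// mul0r.
  rewrite (on _ ibc) => [|z zs]; last by rewrite b0// mul0r.
  have := pd_null_lagrangian h0 h1 mN N0 ab cd u1 u2.
  by rewrite -aE -bE -cE -dE.
(* [\det (F + G) - \det F] is [\det G] plus a linear function of [G] with the cofactors of [F] as
   coefficients; these are absorbed into the slopes. *)
pose ca := p00 + m * F 1 1; pose cb := p01 - m * F 1 0.
pose cc := p10 - m * F 0 1; pose cd' := p11 + m * F 0 0.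
pose k (z : T2) : R := (((((e + ca * a z) + cb * b z) + cc * c z) + cd' * d z) + m * (a z * d z)) - m * (b z * c z).
have mS := measurable_square.
have Z (r : R) g gi := integrable_EFinZ r mS (iS g gi).
have iSe : mu2.-integrable (@square R) (EFin \o (fun=> e)).
  apply: measurable_bounded_integrable => //.
    by rewrite [X in (X < _)%E]square_measure ltry.
  exists `|e|; split; first exact: num_real.
  by move=> M eM z _; exact: ltW.
have ik1 := integrable_EFinD mS iSe (Z ca _ ia).
have ik2 := integrable_EFinD mS ik1 (Z cb _ ib).
have ik3 := integrable_EFinD mS ik2 (Z cc _ ic).
have ik4 := integrable_EFinD mS ik3 (Z cd' _ id_).
have ik5 := integrable_EFinD mS ik4 (Z m _ iad).
have ik : mu2.-integrable (@square R) (EFin \o k) := integrable_EFinB mS ik5 (Z m _ ibc).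
have Ik : (\int[mu2]_(z in @square R) k z)%R = e.
  rewrite /k (RintegralB mS ik5 (Z m _ ibc)) (RintegralD mS ik4 (Z m _ iad)).
  rewrite (RintegralD mS ik3 (Z cd' _ id_)) (RintegralD mS ik2 (Z cc _ ic)).
  rewrite (RintegralD mS ik1 (Z cb _ ib)) (RintegralD mS iSe (Z ca _ ia)).
  rewrite !RintegralZl//; try exact: iS.
  rewrite Ia Ib Ic Id Iadbc !mulr0 !addr0 addrK.
  by rewrite [LHS](Rintegral_cst mu2 mS e) [X in fine X]square_measure mulr1.
have -> : e%:E = (\int[mu2]_(z in @square R) (k z)%:E)%E.
  by rewrite -Ik /Rintegral fineK//; exact: integrable_fin_num.
apply: (ge_integral_nonmeas_ae mS mN N0); first exact: measurable_int ik.
move=> z zs Nz; apply: le_trans (H (Dmat phi z)).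
have [D00 D01 D10 D11] := D z Nz.
have E i j : (F + Dmat phi z) i j = F i j + Dmat phi z i j by rewrite mxE.
rewrite lee_fin !det2 !E D00 D01 D10 D11 /k /ca /cb /cc /cd'.
by rewrite le_eqVlt; apply/orP; left; apply/eqP; ring.
Qed.

End Jensen.

(** * The distance to the wells *)

Section DistanceFormula.
Context {R : realType}.
Local Notation M2 := 'M[R]_2.
Implicit Types (F G Q : M2).

Lemma sum2 (f : 'I_2 -> R) : \sum_i f i = f 0 + f 1.
Proof.
rewrite !big_ord_recl big_ord0 addr0; congr (_ + f _).
exact/val_inj.
Qed.

Lemma ord2P (k : 'I_2) : k = 0 \/ k = 1.
Proof. by case: k => -[|[|//]] ? ; [left|right]; exact/val_inj. Qed.

Lemma mul2E n F (G : 'M[R]_(2, n)) i j : (F *m G) i j = F i 0 * G 0 j + F i 1 * G 1 j.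
Proof. by rewrite mxE sum2. Qed.

Lemma frob2E F : frob2 F = F 0 0 ^+ 2 + F 0 1 ^+ 2 + (F 1 0 ^+ 2 + F 1 1 ^+ 2).
Proof. by rewrite /frob2 /mxtrace sum2 !mul2E !mxE -!expr2. Qed.

Lemma sqrt2V_sqr : ((Num.sqrt 2)^-1 : R) ^+ 2 = 2^-1.
Proof. by rewrite exprVn sqr_sqrtr. Qed.

Lemma xF_ge0 F : 0 <= xF F. Proof. exact: sqrtr_ge0. Qed.
Lemma yF_ge0 F : 0 <= yF F. Proof. exact: sqrtr_ge0. Qed.

Lemma xF_sqr F : xF F ^+ 2 = ((F 0 0 + F 0 1) ^+ 2 + (F 1 0 + F 1 1) ^+ 2) / 2.
Proof.
rewrite /xF /vnorm sqr_sqrtr; last by apply: sumr_ge0 => i _; exact: sqr_ge0.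
rewrite sum2 !mul2E !mxE !mulr1.
rewrite -!mulrDl !exprMn sqrt2V_sqr; ring.
Qed.

Lemma yF_sqr F : yF F ^+ 2 = ((F 0 0 - F 0 1) ^+ 2 + (F 1 0 - F 1 1) ^+ 2) / 2.
Proof.
rewrite /yF /vnorm sqr_sqrtr; last by apply: sumr_ge0 => i _; exact: sqr_ge0.
rewrite sum2 !mul2E !mxE /= mulr1 !mulrN1.
rewrite !mulrN -!mulrBl !exprMn sqrt2V_sqr; ring.
Qed.

(** Lagrange's identity for the vectors [F v] and [F w], whose inner product is half the difference
    of the squared column lengths of [F]. It turns the root in [Afun] into an absolute value. *)
Lemma xyF_det F : xF F ^+ 2 * yF F ^+ 2 - \det F ^+ 2 =
  ((F 0 0 ^+ 2 + F 1 0 ^+ 2 - F 0 1 ^+ 2 - F 1 1 ^+ 2) / 2) ^+ 2.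
Proof. by rewrite xF_sqr yF_sqr det2; field. Qed.

Lemma xyF_Obar F : Obar (xF F, yF F, \det F).
Proof.
split; [exact: xF_ge0|split; [exact: yF_ge0|]] => /=.
rewrite -(ger0_norm (mulr_ge0 (xF_ge0 F) (yF_ge0 F))) -ler_sqr ?nnegrE//.
rewrite -!normrX !ger0_norm ?sqr_ge0// exprMn -subr_ge0 xyF_det; exact: sqr_ge0.
Qed.

Lemma inf_eq (S : set R) v : S v -> lbound S v -> inf S = v.
Proof.
move=> Sv lS; apply/eqP; rewrite eq_le; apply/andP; split.
  by apply: ge_inf => //; exists v.
by apply: lb_le_inf => //; exists v.
Qed.

Lemma SO2P Q : SO2 Q <-> exists p q, [/\ p ^+ 2 + q ^+ 2 = 1, Q 0 0 = p, Q 0 1 = - q, Q 1 0 = q & Q 1 1 = p].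
Proof.
split.
  move=> [QQ dQ].
  have E i j : (Q *m Q^T) i j = (i == j)%:R by rewrite QQ mxE.
  have := E 0 0; have := E 1 1; rewrite !mul2E !mxE /= => e11 e00.
  rewrite det2 in dQ.
  (* This sum of squares is [frob2 Q - 2 * \det Q], which vanishes. *)
  have : (Q 0 0 - Q 1 1) ^+ 2 + (Q 0 1 + Q 1 0) ^+ 2 = 0.
    transitivity ((Q 0 0 * Q 0 0 + Q 0 1 * Q 0 1) + (Q 1 0 * Q 1 0 + Q 1 1 * Q 1 1)
      - 2 * (Q 0 0 * Q 1 1 - Q 0 1 * Q 1 0)); first by ring.
    rewrite e00 e11 dQ; ring.
  move/eqP; rewrite paddr_eq0 ?sqr_ge0// !sqrf_eq0 => /andP[/eqP A /eqP B].
  exists (Q 0 0), (Q 1 0); split => //; [|lra|lra].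
  have -> : Q 1 0 = - Q 0 1 by lra.
  by rewrite sqrrN !expr2 e00.
move=> [p [q [pq e00 e01 e10 e11]]]; split; last by rewrite det2 e00 e01 e10 e11 -pq; ring.
apply/matrixP => i j; rewrite mul2E !mxE.
by case: (ord2P i) => ->; case: (ord2P j) => ->; rewrite /= ?e00 ?e01 ?e10 ?e11 -?pq; ring.
Qed.

Definition rot (p q : R) : M2 := \matrix_(i, j)
  (if i == j then p else if i == 0 then - q else q).

Lemma rot_SO2 p q : p ^+ 2 + q ^+ 2 = 1 -> SO2 (rot p q).
Proof. by move=> pq; apply/SO2P; exists p, q; split; rewrite // mxE. Qed.

Variable lam : R.
Hypothesis lam1 : 1 < lam.
Local Notation c := (lam ^+ 2 + lam ^- 2).
Local Notation s := (lam ^+ 2 - lam ^- 2).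

Lemma lam_neq0 : lam != 0. Proof. by rewrite gt_eqF// (lt_trans ltr01). Qed.

Lemma frob2_U1 : frob2 (U1 lam) = c.
Proof. by rewrite frob2E !mxE /= expr0n /= !addr0 add0r exprVn. Qed.


Lemma lamV2 : 0 < lam ^- 2 < 1.
Proof.
have l2 : 1 < lam ^+ 2 by rewrite expr_gt1// ltW// (lt_trans ltr01).
by rewrite invr_gt0 invf_lt1 ?l2 ?(lt_trans ltr01 l2).
Qed.

Lemma lam2_gt1 : 1 < lam ^+ 2.
Proof. by rewrite expr_gt1// ltW// (lt_trans ltr01). Qed.

Lemma s_gt0 : 0 < s. Proof. have := lamV2; have := lam2_gt1; lra. Qed.

Lemma c2s2 : c ^+ 2 = s ^+ 2 + 4.
Proof.
have e : lam ^+ 2 * lam ^- 2 = 1 by rewrite divff// expf_neq0// lam_neq0.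
transitivity (s ^+ 2 + 4 * (lam ^+ 2 * lam ^- 2)); first by ring.
by rewrite e mulr1.
Qed.

Lemma c_gt2 : 2 < c.
Proof.
have := c2s2; have := s_gt0; have := lamV2; have := lam2_gt1; nra.
Qed.

(** Together with [QF], the squared lengths of the columns of [F]. The distance to each well depends
    only on these two and on [\det F]. *)
Definition PF F : R := F 0 0 ^+ 2 + F 1 0 ^+ 2.
Definition QF F : R := F 0 1 ^+ 2 + F 1 1 ^+ 2.

Lemma Afun_F F : Afun lam (xF F) (yF F) (\det F) =
  (PF F + QF F) * (c / 2) + s * (`|PF F - QF F| / 2) + 2 * \det F.
Proof.
rewrite /Afun frob2_U1 xyF_det sqrtr_sqr normrM.
rewrite (ger0_norm (_ : 0 <= 2^-1)) ?invr_ge0//.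
have -> : F 0 0 ^+ 2 + F 1 0 ^+ 2 - F 0 1 ^+ 2 - F 1 1 ^+ 2 = PF F - QF F.
  by rewrite /PF /QF; ring.
by congr (_ * _ + _ + _); rewrite xF_sqr yF_sqr /PF /QF; field.
Qed.

(* Over unit [(p, q)], [<F, Q U> = p (F00 l + F11 l') + q (F10 l - F01 l')] is maximal when
   [(p, q)] is parallel to its coefficient vector. *)
Lemma frob2_rot F (l l' p q : R) : p ^+ 2 + q ^+ 2 = 1 -> l * l' = 1 ->
  let m := F 0 0 * l + F 1 1 * l' in let n := F 1 0 * l - F 0 1 * l' in
  m ^+ 2 + n ^+ 2 = l ^+ 2 * PF F + l' ^+ 2 * QF F + 2 * \det F /\
  (F 0 0 - p * l) ^+ 2 + (F 0 1 + q * l') ^+ 2 + ((F 1 0 - q * l) ^+ 2 + (F 1 1 - p * l') ^+ 2)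
   = PF F + QF F + (l ^+ 2 + l' ^+ 2) - 2 * (p * m + q * n).
Proof.
move=> pq ll m n; split.
  rewrite /m /n /PF /QF det2.
  transitivity (l ^+ 2 * (F 0 0 ^+ 2 + F 1 0 ^+ 2) + l' ^+ 2 * (F 0 1 ^+ 2 + F 1 1 ^+ 2) +
    2 * (l * l') * (F 0 0 * F 1 1 - F 0 1 * F 1 0)); first by ring.
  by rewrite ll mulr1.
rewrite /m /n /PF /QF.
transitivity (F 0 0 ^+ 2 + F 1 0 ^+ 2 + (F 0 1 ^+ 2 + F 1 1 ^+ 2) + (l ^+ 2 + l' ^+ 2) * (p ^+ 2 + q ^+ 2)
  - 2 * (p * (F 0 0 * l + F 1 1 * l') + q * (F 1 0 * l - F 0 1 * l'))); first by ring.
by rewrite pq mulr1.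
Qed.

Lemma unit_dot_le (m n p q A : R) : p ^+ 2 + q ^+ 2 = 1 -> m ^+ 2 + n ^+ 2 <= A ->
  p * m + q * n <= Num.sqrt A.
Proof.
move=> pq mA; rewrite (le_trans (ler_norm _))// -sqrtr_sqr ler_wsqrtr//.
apply: le_trans mA.
have -> : m ^+ 2 + n ^+ 2 = (p ^+ 2 + q ^+ 2) * (m ^+ 2 + n ^+ 2) by rewrite pq mul1r.
have := sqr_ge0 (p * n - q * m); lra.
Qed.

Lemma unit_dot_ex (m n : R) : exists p q, p ^+ 2 + q ^+ 2 = 1 /\
  p * m + q * n = Num.sqrt (m ^+ 2 + n ^+ 2).
Proof.
set r := Num.sqrt _.
have r2 : r ^+ 2 = m ^+ 2 + n ^+ 2 by rewrite sqr_sqrtr// addr_ge0// sqr_ge0.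
have [r0|r0] := eqVneq r 0.
  move: r2; rewrite r0 expr0n /= => /esym/eqP; rewrite paddr_eq0 ?sqr_ge0// !sqrf_eq0.
  by move=> /andP[/eqP -> /eqP ->]; exists 1, 0; split; rewrite ?expr1n ?expr0n ?mulr0 ?addr0.
exists (m / r), (n / r); split.
  rewrite !exprMn -mulrDl -r2 exprVn divff// expf_neq0//.
transitivity ((m ^+ 2 + n ^+ 2) / r); first by field.
by rewrite -r2 expr2 mulfK.
Qed.

(** For each well the best rotation is known from [frob2_rot], and [Afun] is the larger of the two
    values of [m ^+ 2 + n ^+ 2]. The closer well is [U1] or [U2] according to which column of [F] is
    longer. *)
Lemma distK2E F : distK2 lam F = gfun lam (xF F) (yF F) (\det F).
Proof.
have ll : lam * lam^-1 = 1 by rewrite divff// lam_neq0.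
have ll' : lam^-1 * lam = 1 by rewrite mulrC.
have xy : xF F ^+ 2 + yF F ^+ 2 = PF F + QF F.
  by rewrite xF_sqr yF_sqr /PF /QF; field.
have fE (l l' p q : R) (U G : M2) : (forall i j, U i j = if i == j then (if i == 0 then l else l') else 0) ->
    SO2 G -> p = G 0 0 -> q = G 1 0 ->
    frob2 (F - G *m U) = (F 0 0 - p * l) ^+ 2 + (F 0 1 + q * l') ^+ 2 + ((F 1 0 - q * l) ^+ 2 + (F 1 1 - p * l') ^+ 2).
  move=> Ul /SO2P[p' [q' [_ e00 e01 e10 e11]]] -> ->.
  have E i j : (F - G *m U) i j = F i j - (G i 0 * U 0 j + G i 1 * U 1 j).
    by rewrite !mxE sum2.
  rewrite frob2E !E !Ul /= e00 e01 e10 e11; ring.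
have U1E i j : U1 lam i j = if i == j then (if i == 0 then lam else lam^-1) else 0 by rewrite mxE.
have U2E i j : U2 lam i j = if i == j then (if i == 0 then lam^-1 else lam) else 0 by rewrite mxE.
have A1 : lam ^+ 2 * PF F + lam^-1 ^+ 2 * QF F + 2 * \det F <= Afun lam (xF F) (yF F) (\det F).
  rewrite Afun_F exprVn.
  have : s * ((PF F - QF F) / 2) <= s * (`|PF F - QF F| / 2).
    by rewrite ler_wpM2l ?(ltW s_gt0)// ler_pM2r ?invr_gt0// ler_norm.
  lra.
have A2 : lam^-1 ^+ 2 * PF F + lam ^+ 2 * QF F + 2 * \det F <= Afun lam (xF F) (yF F) (\det F).
  rewrite Afun_F exprVn.
  have : s * ((QF F - PF F) / 2) <= s * (`|PF F - QF F| / 2).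
    by rewrite ler_wpM2l ?(ltW s_gt0)// ler_pM2r ?invr_gt0// distrC ler_norm.
  lra.
apply: inf_eq; last first.
  move=> _ [G [[Q SQ <-]|[Q SQ <-]] <-]; have /SO2P[p [q [pq e00 _ e10 _]]] := SQ.
    rewrite (fE _ _ _ _ _ _ U1E SQ (esym e00) (esym e10)).
    have [mn ->] := frob2_rot F pq ll; rewrite /gfun frob2_U1 xy exprVn.
    have := @unit_dot_le (F 0 0 * lam + F 1 1 * lam^-1) (F 1 0 * lam - F 0 1 * lam^-1) p q
      (Afun lam (xF F) (yF F) (\det F)) pq.
    rewrite mn => /(_ A1); lra.
  rewrite (fE _ _ _ _ _ _ U2E SQ (esym e00) (esym e10)).
  have [mn ->] := frob2_rot F pq ll'; rewrite /gfun frob2_U1 xy exprVn.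
  have := @unit_dot_le (F 0 0 * lam^-1 + F 1 1 * lam) (F 1 0 * lam^-1 - F 0 1 * lam) p q
    (Afun lam (xF F) (yF F) (\det F)) pq.
  rewrite mn => /(_ A2); lra.
have [PQ|PQ] := leP (QF F) (PF F).
  have [p [q [pq E]]] := unit_dot_ex (F 0 0 * lam + F 1 1 * lam^-1) (F 1 0 * lam - F 0 1 * lam^-1).
  have SQ := rot_SO2 pq.
  exists (rot p q *m U1 lam); first by left; exists (rot p q).
  rewrite (fE _ _ p q _ _ U1E SQ) ?mxE//.
  have [mn ->] := frob2_rot F pq ll; rewrite /gfun frob2_U1 xy exprVn E mn.
  congr (_ - 2 * Num.sqrt _); rewrite Afun_F ger0_norm ?subr_ge0// exprVn; field.
  exact: lam_neq0.
have [p [q [pq E]]] := unit_dot_ex (F 0 0 * lam^-1 + F 1 1 * lam) (F 1 0 * lam^-1 - F 0 1 * lam).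
have SQ := rot_SO2 pq.
exists (rot p q *m U2 lam); first by right; exists (rot p q).
rewrite (fE _ _ p q _ _ U2E SQ) ?mxE//.
have [mn ->] := frob2_rot F pq ll'; rewrite /gfun frob2_U1 xy exprVn E mn.
have -> : Afun lam (xF F) (yF F) (\det F) = lam^-1 ^+ 2 * PF F + lam ^+ 2 * QF F + 2 * \det F.
  rewrite Afun_F ltr0_norm ?subr_lt0// exprVn; field; exact: lam_neq0.
by rewrite exprVn; ring.
Qed.

End DistanceFormula.

(** * The envelope and its minorants *)

Section EnvelopeFunction.
Context {R : realType}.
Variable lam : R.
Hypothesis lam1 : 1 < lam.
Local Notation c := (lam ^+ 2 + lam ^- 2).
Local Notation s := (lam ^+ 2 - lam ^- 2).

Lemma sqrt_concave (a b t : R) : 0 <= a -> 0 <= b -> 0 <= t <= 1 ->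
  t * Num.sqrt a + (1 - t) * Num.sqrt b <= Num.sqrt (t * a + (1 - t) * b).
Proof.
move=> a0 b0 /andP[t0 t1].
have u0 : 0 <= 1 - t by lra.
have A := sqrtr_ge0 a; have B := sqrtr_ge0 b.
rewrite -[leLHS]ger0_norm; last by rewrite addr_ge0 ?mulr_ge0.
rewrite -sqrtr_sqr ler_wsqrtr//.
rewrite -{2}(sqr_sqrtr a0) -{2}(sqr_sqrtr b0).
have : 0 <= t * (1 - t) * (Num.sqrt a - Num.sqrt b) ^+ 2.
  by rewrite mulr_ge0 ?sqr_ge0// mulr_ge0.
lra.
Qed.

(** The closure of [O] in the variables [(x^2, y^2, d)], where it becomes a convex cone. *)
Definition cone (X Y d : R) := [/\ 0 <= X, 0 <= Y & d ^+ 2 <= X * Y].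

(** Polarised form of [X Y = a^2 + d^2]: Cauchy-Schwarz bounds the left side by
    [2 sqrt (X1 Y1 X2 Y2)], and AM-GM bounds this by the right side. *)
Lemma cone_key X1 Y1 d1 X2 Y2 d2 : cone X1 Y1 d1 -> cone X2 Y2 d2 ->
  2 * (Num.sqrt (X1 * Y1 - d1 ^+ 2) * Num.sqrt (X2 * Y2 - d2 ^+ 2) + d1 * d2)
    <= X1 * Y2 + X2 * Y1.
Proof.
move=> [X10 Y10 D1] [X20 Y20 D2].
have a2 : Num.sqrt (X1 * Y1 - d1 ^+ 2) ^+ 2 = X1 * Y1 - d1 ^+ 2 by rewrite sqr_sqrtr// subr_ge0.
have b2 : Num.sqrt (X2 * Y2 - d2 ^+ 2) ^+ 2 = X2 * Y2 - d2 ^+ 2 by rewrite sqr_sqrtr// subr_ge0.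
move: (Num.sqrt _) a2 => a a2; move: (Num.sqrt _) b2 => b b2.
have P : 0 <= X1 * Y2 + X2 * Y1 by rewrite addr_ge0 ?mulr_ge0.
rewrite (le_trans (ler_norm _))// -[leRHS]ger0_norm// -ler_sqr ?nnegrE//.
rewrite -!normrX !ger0_norm ?sqr_ge0//.
apply: (@le_trans _ _ (4 * ((a ^+ 2 + d1 ^+ 2) * (b ^+ 2 + d2 ^+ 2)))).
  have := sqr_ge0 (a * d2 - b * d1); lra.
rewrite a2 b2 !subrK.
have := sqr_ge0 (X1 * Y2 - X2 * Y1); lra.
Qed.

(** Squaring the concavity inequality for [sqrt (X Y - d^2)] leaves only the cross terms, which
    [cone_key] compares; convexity of the cone comes out of the same estimate. *)
Lemma cone_convex X1 Y1 d1 X2 Y2 d2 t : cone X1 Y1 d1 -> cone X2 Y2 d2 -> 0 <= t <= 1 ->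
  cone (t * X1 + (1 - t) * X2) (t * Y1 + (1 - t) * Y2) (t * d1 + (1 - t) * d2) /\
  t * Num.sqrt (X1 * Y1 - d1 ^+ 2) + (1 - t) * Num.sqrt (X2 * Y2 - d2 ^+ 2) <=
  Num.sqrt ((t * X1 + (1 - t) * X2) * (t * Y1 + (1 - t) * Y2) - (t * d1 + (1 - t) * d2) ^+ 2).
Proof.
move=> C1 C2 /andP[t0 t1]; have u0 : 0 <= 1 - t by lra.
have key := cone_key C1 C2.
case: (C1) => X10 Y10 D1; case: (C2) => X20 Y20 D2.
have a2 : Num.sqrt (X1 * Y1 - d1 ^+ 2) ^+ 2 = X1 * Y1 - d1 ^+ 2 by rewrite sqr_sqrtr// subr_ge0.
have b2 : Num.sqrt (X2 * Y2 - d2 ^+ 2) ^+ 2 = X2 * Y2 - d2 ^+ 2 by rewrite sqr_sqrtr// subr_ge0.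
have a0 := sqrtr_ge0 (X1 * Y1 - d1 ^+ 2); have b0 := sqrtr_ge0 (X2 * Y2 - d2 ^+ 2).
move: (Num.sqrt (X1 * Y1 - d1 ^+ 2)) a2 a0 key => a a2 a0.
move: (Num.sqrt (X2 * Y2 - d2 ^+ 2)) b2 b0 => b b2 b0 key.
have tu : 0 <= t * (1 - t) by rewrite mulr_ge0.
have M : t * (1 - t) * (2 * (a * b + d1 * d2)) <= t * (1 - t) * (X1 * Y2 + X2 * Y1) by rewrite ler_wpM2l.
have E : (t * a + (1 - t) * b) ^+ 2 <=
    (t * X1 + (1 - t) * X2) * (t * Y1 + (1 - t) * Y2) - (t * d1 + (1 - t) * d2) ^+ 2.
  have : t ^+ 2 * a ^+ 2 = t ^+ 2 * (X1 * Y1 - d1 ^+ 2) by rewrite a2.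
  have : (1 - t) ^+ 2 * b ^+ 2 = (1 - t) ^+ 2 * (X2 * Y2 - d2 ^+ 2) by rewrite b2.
  lra.
split.
  split; [by rewrite addr_ge0 ?mulr_ge0|by rewrite addr_ge0 ?mulr_ge0|].
  by rewrite -subr_ge0 (le_trans _ E)// sqr_ge0.
rewrite -[leLHS]ger0_norm; last by rewrite addr_ge0 ?mulr_ge0.
by rewrite -sqrtr_sqr ler_wsqrtr.
Qed.

Definition Ah (X Y d : R) : R := (X + Y) * (c / 2) + s * Num.sqrt (X * Y - d ^+ 2) + 2 * d.
(* [gfun] in the variables [X = x^2], [Y = y^2], in which it is convex. *)
Definition gh (X Y d : R) : R := X + Y + c - 2 * Num.sqrt (Ah X Y d).

Lemma gfunE x y d : gfun lam x y d = gh (x ^+ 2) (y ^+ 2) d.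
Proof. by rewrite /gfun /Afun frob2_U1. Qed.

Lemma cone_mean X Y d : cone X Y d -> `|d| <= (X + Y) / 2.
Proof.
move=> [X0 Y0 D]; rewrite -[leRHS]ger0_norm; last by rewrite divr_ge0// addr_ge0.
rewrite -ler_sqr ?nnegrE// -!normrX !ger0_norm ?sqr_ge0// (le_trans D)//.
have := sqr_ge0 (X - Y); lra.
Qed.

Lemma Ah_ge0 X Y d : cone X Y d -> 0 <= Ah X Y d.
Proof.
move=> C; have := cone_mean C; rewrite ler_norml => /andP[dm _].
have r0 : 0 <= s * Num.sqrt (X * Y - d ^+ 2) by rewrite mulr_ge0 ?sqrtr_ge0 ?(ltW (s_gt0 lam1)).
have [X0 Y0 _] := C.
have : 0 <= (X + Y) * (c / 2 - 1).
  by apply: mulr_ge0; [exact: addr_ge0|have := c_gt2 lam1; lra].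
rewrite /Ah; lra.
Qed.

(** Cauchy-Schwarz for [s * r + 2 * d], using [s^2 + 4 = c^2] and [r^2 + d^2 = X Y]. *)
Lemma Ah_le X Y d : cone X Y d -> Ah X Y d <= (X + Y) * (c / 2) + c * ((X + Y) / 2).
Proof.
move=> [X0 Y0 D]; rewrite /Ah -addrA lerD2l.
have r2 : Num.sqrt (X * Y - d ^+ 2) ^+ 2 = X * Y - d ^+ 2 by rewrite sqr_sqrtr// subr_ge0.
move: (Num.sqrt _) r2 => r r2.
have c0 : 0 <= c by have := c_gt2 lam1; lra.
rewrite (le_trans (ler_norm _))// -[leRHS]ger0_norm; last by rewrite mulr_ge0// divr_ge0// addr_ge0.
rewrite -ler_sqr ?nnegrE// -!normrX !ger0_norm ?sqr_ge0//.
rewrite exprMn (c2s2 lam1).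
apply: (@le_trans _ _ ((s ^+ 2 + 4) * (r ^+ 2 + d ^+ 2))).
  have := sqr_ge0 (2 * r - s * d); lra.
rewrite r2 subrK ler_wpM2l//; first by rewrite addr_ge0// sqr_ge0.
have := sqr_ge0 (X - Y); lra.
Qed.

(** [Ah] is at most [c * (X + Y)], so AM-GM applies. This bounds the infimum in [hh] from below. *)
Lemma gh_ge0 X Y d : cone X Y d -> 0 <= gh X Y d.
Proof.
move=> C; rewrite /gh subr_ge0.
have [X0 Y0 _] := C; have c0 : 0 <= c by have := c_gt2 lam1; lra.
have : Num.sqrt (Ah X Y d) <= (X + Y + c) / 2; last by lra.
rewrite -[leRHS]ger0_norm; last by rewrite divr_ge0// addr_ge0// addr_ge0.
rewrite -sqrtr_sqr ler_wsqrtr// (le_trans (Ah_le C))//.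
have := sqr_ge0 ((X + Y - c) / 2); lra.
Qed.

Lemma gh_convex X1 Y1 d1 X2 Y2 d2 t : cone X1 Y1 d1 -> cone X2 Y2 d2 -> 0 <= t <= 1 ->
  gh (t * X1 + (1 - t) * X2) (t * Y1 + (1 - t) * Y2) (t * d1 + (1 - t) * d2) <=
  t * gh X1 Y1 d1 + (1 - t) * gh X2 Y2 d2.
Proof.
move=> C1 C2 t01; have [_ S] := cone_convex C1 C2 t01.
have Q := sqrt_concave (Ah_ge0 C1) (Ah_ge0 C2) t01.
have : Num.sqrt (t * Ah X1 Y1 d1 + (1 - t) * Ah X2 Y2 d2) <=
   Num.sqrt (Ah (t * X1 + (1 - t) * X2) (t * Y1 + (1 - t) * Y2) (t * d1 + (1 - t) * d2)).
  apply: ler_wsqrtr; rewrite /Ah.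
  move: S => /(ler_wpM2l (ltW (s_gt0 lam1))); lra.
rewrite /gh; lra.
Qed.

(** Only the competitor [(X', Y')] has to lie in the cone, not [(X, Y)]. Thus [hh] is finite and
    convex on all of [R^3], and subgradients exist at every point, including the boundary of the
    cone. *)
Definition hset (X Y d : R) : set R := [set v | exists X' Y',
  [/\ X <= X', Y <= Y', cone X' Y' d & v = gh X' Y' d]].
Definition hh (X Y d : R) : R := inf (hset X Y d).

Lemma hset_lb X Y d : lbound (hset X Y d) 0.
Proof. by move=> _ [X' [Y' [_ _ C ->]]]; exact: gh_ge0. Qed.

Lemma cone_diag d M : `|d| <= M -> cone M M d.
Proof.
move=> dM; have M0 : 0 <= M by rewrite (le_trans _ dM).
by split=> //; rewrite -expr2 -(ger0_norm (sqr_ge0 d)) normrX ler_sqr ?nnegrE.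
Qed.

Lemma hset_neq0 X Y d : hset X Y d !=set0.
Proof.
set M := `|X| + `|Y| + `|d|.
have XM : X <= M by rewrite (le_trans (ler_norm _))// /M -addrA lerDl addr_ge0.
have YM : Y <= M by rewrite (le_trans (ler_norm _))// /M addrAC lerDr addr_ge0.
by exists (gh M M d), M, M; split => //; apply: cone_diag; rewrite lerDr addr_ge0.
Qed.

Lemma hh_le X Y d X' Y' : X <= X' -> Y <= Y' -> cone X' Y' d -> hh X Y d <= gh X' Y' d.
Proof.
move=> XX YY C; apply: ge_inf; first by exists 0; exact: hset_lb.
by exists X', Y'.
Qed.

Lemma hh_approx X Y d e : 0 < e -> exists X' Y',
  [/\ X <= X', Y <= Y', cone X' Y' d & gh X' Y' d < hh X Y d + e].
Proof.
move=> e0; have := @inf_adherent _ _ _ e0 (conj (hset_neq0 X Y d) (ex_intro _ 0 (@hset_lb X Y d))).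
by case=> _ [X' [Y' [XX YY C ->]]] H; exists X', Y'.
Qed.

(** Partial minimisation of a convex function over a convex constraint preserves convexity; almost
    optimal competitors are averaged. *)
Lemma hh_convex X1 Y1 d1 X2 Y2 d2 t : 0 <= t <= 1 ->
  hh (t * X1 + (1 - t) * X2) (t * Y1 + (1 - t) * Y2) (t * d1 + (1 - t) * d2) <=
  t * hh X1 Y1 d1 + (1 - t) * hh X2 Y2 d2.
Proof.
move=> t01; apply/ler_addgt0Pr => e e0.
have [X1' [Y1' [XX1 YY1 C1 H1]]] := hh_approx X1 Y1 d1 e0.
have [X2' [Y2' [XX2 YY2 C2 H2]]] := hh_approx X2 Y2 d2 e0.
have [C _] := cone_convex C1 C2 t01.
have /andP[t0 t1] := t01; have u0 : 0 <= 1 - t by lra.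
apply: le_trans (hh_le (lerD (ler_wpM2l t0 XX1) (ler_wpM2l u0 XX2))
  (lerD (ler_wpM2l t0 YY1) (ler_wpM2l u0 YY2)) C) _.
apply: le_trans (gh_convex C1 C2 t01) _.
have := ler_wpM2l t0 (ltW H1); have := ler_wpM2l u0 (ltW H2); lra.
Qed.

Lemma hh_mono X Y d X' Y' : X <= X' -> Y <= Y' -> hh X Y d <= hh X' Y' d.
Proof.
move=> XX YY; apply/ler_addgt0Pr => e e0.
have [X1 [Y1 [XX1 YY1 C1 H1]]] := hh_approx X' Y' d e0.
by apply: le_trans (ltW H1); apply: hh_le => //; [exact: le_trans XX1|exact: le_trans YY1].
Qed.

Lemma Obar_cone x y d xi eta : Obar (x, y, d) -> x <= xi -> y <= eta ->
  [/\ 0 <= xi, 0 <= eta & cone (xi ^+ 2) (eta ^+ 2) d].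
Proof.
move=> [/= x0 [y0 dxy]] xx yy.
have xi0 := le_trans x0 xx; have eta0 := le_trans y0 yy.
split => //; split; rewrite ?sqr_ge0// -exprMn -(ger0_norm (sqr_ge0 d)) normrX.
by rewrite ler_sqr ?nnegrE ?mulr_ge0// (le_trans dxy)// ler_pM.
Qed.

(** Above a point of [Obar] all pairs [(xi, eta)] stay in the cone, so squaring identifies the two
    sets of values. *)
Lemma hfunE x y d : Obar (x, y, d) -> hfun lam x y d = hh (x ^+ 2) (y ^+ 2) d.
Proof.
move=> O; congr inf; apply/seteqP; split => v /=.
  move=> [xi /= xx [eta /= yy <-]].
  have [xi0 eta0 C] := Obar_cone O xx yy.
  have [/= x0 [y0 _]] := O.
  by exists (xi ^+ 2), (eta ^+ 2); split; rewrite ?gfunE// ler_sqr ?nnegrE.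
move=> [X [Y [xX yY [X0 Y0 C] ->]]].
have [/= x0 [y0 _]] := O.
exists (Num.sqrt X) => /=; first by rewrite -(ger0_norm x0) -sqrtr_sqr ler_wsqrtr.
exists (Num.sqrt Y) => /=; first by rewrite -(ger0_norm y0) -sqrtr_sqr ler_wsqrtr.
by rewrite gfunE !sqr_sqrtr.
Qed.

Lemma gh_coercive X Y d : cone X Y d -> (X + Y) / 2 - `|d| - 2 * lam ^+ 2 <= gh X Y d.
Proof.
move=> C; have [X0 Y0 D] := C.
have l2 := lam2_gt1 lam1; have lv := lamV2 lam1.
have A0 := Ah_ge0 C.
have A1 : Ah X Y d <= lam ^+ 2 * (X + Y) + 2 * `|d|.
  have : Num.sqrt (X * Y - d ^+ 2) <= (X + Y) / 2.
    rewrite -[leRHS]ger0_norm; last by rewrite divr_ge0// addr_ge0.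
    rewrite -sqrtr_sqr ler_wsqrtr//; have := sqr_ge0 (X - Y); have := sqr_ge0 d; lra.
  move=> /(ler_wpM2l (ltW (s_gt0 lam1))); have := ler_norm d; rewrite /Ah; lra.
have r0 := sqrtr_ge0 (Ah X Y d).
have r2 : Num.sqrt (Ah X Y d) ^+ 2 = Ah X Y d by rewrite sqr_sqrtr.
rewrite /gh; move: (Num.sqrt _) r0 r2 => r r0 r2.
(* AM-GM: [2 r <= r^2 / (2 lam^2) + 2 lam^2]. *)
have : 2 * r * (2 * lam ^+ 2) <= r ^+ 2 + (2 * lam ^+ 2) ^+ 2.
  have := sqr_ge0 (r - 2 * lam ^+ 2); lra.
rewrite r2 => B.
have d1 : `|d| <= `|d| * lam ^+ 2 by rewrite ler_peMr// ltW.
have : 2 * r * (2 * lam ^+ 2) <= ((X + Y) / 2 + `|d| + 2 * lam ^+ 2) * (2 * lam ^+ 2) by lra.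
rewrite ler_pM2r; last by lra.
lra.
Qed.

Lemma gfun_continuous d : continuous (fun z : R * R => gfun lam z.1 z.2 d).
Proof.
move=> z.
have c1 : continuous (fun z : R * R => z.1 ^+ 2).
  have c0 : continuous (fun z : R * R => z.1 * z.1) by move=> w; apply: cvgM; exact: cvg_fst.
  exact: c0.
have c2 : continuous (fun z : R * R => z.2 ^+ 2).
  have c0 : continuous (fun z : R * R => z.2 * z.2) by move=> w; apply: cvgM; exact: cvg_snd.
  exact: c0.
have c12 : continuous (fun z : R * R => z.1 ^+ 2 + z.2 ^+ 2).
  by move=> w; apply: cvgD; [exact: c1|exact: c2].
have cs : continuous (fun z : R * R => Num.sqrt (z.1 ^+ 2 * z.2 ^+ 2 - d ^+ 2)).
  move=> w; apply: (@continuous_comp _ _ _ (fun z : R * R => z.1 ^+ 2 * z.2 ^+ 2 - d ^+ 2) Num.sqrt).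
    by apply: cvgB; [apply: cvgM; [exact: c1|exact: c2]|exact: cvg_cst].
  exact: sqrt_continuous.
have cA : continuous (fun z : R * R => Afun lam z.1 z.2 d).
  move=> w; apply: cvgD; last exact: cvg_cst.
  apply: cvgD; apply: cvgM; [exact: c12|exact: cvg_cst|exact: cvg_cst|exact: cs].
apply: cvgB; first by apply: cvgD; [exact: c12|exact: cvg_cst].
apply: cvgM; first exact: cvg_cst.
apply: (@continuous_comp _ _ _ (fun z : R * R => Afun lam z.1 z.2 d) Num.sqrt); first exact: cA.
exact: sqrt_continuous.
Qed.

Lemma gfun_min x y d : Obar (x, y, d) -> exists xi eta, [/\ x <= xi, y <= eta &
  forall xi' eta', x <= xi' -> y <= eta' -> gfun lam xi eta d <= gfun lam xi' eta' d].
Proof.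
move=> O; have [/= x0 [y0 _]] := O.
(* By [gh_coercive], values at points with [xi' ^+ 2 + eta' ^+ 2 >= M] are at least the value at the
   corner [(x, y)]. Since [M' ^+ 2 >= M' >= M], leaving the rectangle of side [M'] forces this. *)
pose M := 2 * (gfun lam x y d + `|d| + 2 * lam ^+ 2).
pose M' := 1 + `|M|.
have M'1 : 1 <= M' by rewrite lerDl.
pose A : set (R * R) := `[x, x + M'] `*` `[y, y + M'].
have Axy : A (x, y) by rewrite /A /= !in_itv /= !lexx !lerDl; split; lra.
have cA : compact A by apply: compact_setX; exact: segment_compact.
have cont := @gfun_continuous d.
have [[xi eta]] := compact_EVT_min (ex_intro _ _ Axy) cA (continuous_subspaceT cont).
rewrite inE => -[/=]; rewrite !in_itv /= => /andP[xxi _] /andP[yeta _] H.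
exists xi, eta; split => // xi' eta' xx yy.
have Hxy := H (x, y) (mem_set Axy).
have [inA|] := boolP ((xi' <= x + M') && (eta' <= y + M')).
  apply: (H (xi', eta')); rewrite inE /A /= !in_itv /= xx yy; exact/andP.
rewrite negb_and -!ltNge => out.
apply: (le_trans Hxy) => /=.
have [xi0 eta0 C] := Obar_cone O xx yy.
have big (z w : R) : 0 <= z -> z + M' < w -> M <= w ^+ 2.
  move=> z0 zw; rewrite (le_trans (ler_norm _))//.
  have : M' * M' <= w * w by apply: ler_pM; lra.
  have : M' <= M' * M' by rewrite ler_peMl//; lra.
  rewrite /M' expr2; lra.
have : M <= xi' ^+ 2 + eta' ^+ 2.
  by case/orP: out => /big H'; [rewrite (le_trans (H' x0))// lerDl sqr_ge0|rewrite (le_trans (H' y0))// lerDr sqr_ge0].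
have := gh_coercive C; rewrite [gfun lam xi' _ _]gfunE /M; lra.
Qed.

End EnvelopeFunction.

(** * Subgradients and affine minorants of convex functions *)

Section Subgradient.
Context {R : realType}.

(* One step of the Hahn-Banach extension. *)
Lemma subgradient_step (E : lmodType R) (f : E -> R -> R) (l : E -> R) :
  (forall u s v r t, 0 <= t <= 1 ->
     f (t *: u + (1 - t) *: v) (t * s + (1 - t) * r) <= t * f u s + (1 - t) * f v r) ->
  (forall a u b v, l (a *: u + b *: v) = a * l u + b * l v) ->
  (forall u, f 0 0 + l u <= f u 0) ->
  exists m, forall u s, f 0 0 + l u + m * s <= f u s.
Proof.
move=> fc ll f0.
(* Every slope bound from negative increments lies below every one from positive increments: the
   weight [t] averages [s] and [- r] to 0, where the functional [l] is already a minorant. *)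
have key u s v r : 0 < s -> 0 < r ->
    (f 0 0 + l v - f v (- r)) / r <= (f u s - f 0 0 - l u) / s.
  move=> s0 r0; rewrite ler_pdivrMr// mulrAC ler_pdivlMr//.
  have sr0 : 0 < s + r by rewrite addr_gt0.
  pose t := r / (s + r).
  have t01 : 0 <= t <= 1.
    by rewrite divr_ge0 ?(ltW r0) ?(ltW sr0)//= ler_pdivrMr// mul1r lerDr ltW.
  have te : (s + r) * t = r by rewrite /t mulrCA divff ?mulr1// gt_eqF.
  have ue : (s + r) * (1 - t) = s by rewrite mulrBr te mulr1; ring.
  have := fc u s v (- r) t t01.
  have -> : t * s + (1 - t) * - r = 0.
    apply: (mulfI (lt0r_neq0 sr0)); rewrite mulr0.
    transitivity ((s + r) * t * s - (s + r) * (1 - t) * r); first by ring.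
    by rewrite te ue; ring.
  have := f0 (t *: u + (1 - t) *: v); rewrite ll => A B.
  have : (s + r) * (f 0 0 + (t * l u + (1 - t) * l v)) <= (s + r) * (t * f u s + (1 - t) * f v (- r)).
    by rewrite ler_pM2l// (le_trans A).
  have -> : (s + r) * (f 0 0 + (t * l u + (1 - t) * l v)) =
    (s + r) * f 0 0 + (s + r) * t * l u + (s + r) * (1 - t) * l v by ring.
  have -> : (s + r) * (t * f u s + (1 - t) * f v (- r)) =
    (s + r) * t * f u s + (s + r) * (1 - t) * f v (- r) by ring.
  rewrite te ue; lra.
pose A : set R := [set q | exists v r, 0 < r /\ q = (f 0 0 + l v - f v (- r)) / r].
have A0 : A !=set0 by exists ((f 0 0 + l 0 - f 0 (- 1)) / 1), 0, 1; split.
have Aub u s : 0 < s -> ubound A ((f u s - f 0 0 - l u) / s).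
  by move=> s0 _ [v [r [r0 ->]]]; exact: key.
exists (sup A) => u s.
have [s0|s0|<-] := ltgtP 0 s; last by rewrite mulr0 addr0; exact: f0.
  have : sup A <= (f u s - f 0 0 - l u) / s by apply: ge_sup => //; exact: Aub.
  by rewrite ler_pdivlMr//; lra.
have ns0 : 0 < - s by rewrite oppr_gt0.
have : (f 0 0 + l u - f u (- - s)) / (- s) <= sup A.
  by apply: ub_le_sup; [exists ((f 0 1 - f 0 0 - l 0) / 1); exact: Aub|exists u, (- s)].
by rewrite ler_pdivrMr// opprK; lra.
Qed.

(** Three extension steps, one variable at a time. In the first one the function ignores its vector
    argument, which plays the part of the trivial subspace. *)
Lemma convex3_subgradient (f : R -> R -> R -> R) (x y z : R) :
  (forall x1 y1 z1 x2 y2 z2 t, 0 <= t <= 1 ->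
    f (t * x1 + (1 - t) * x2) (t * y1 + (1 - t) * y2) (t * z1 + (1 - t) * z2) <=
    t * f x1 y1 z1 + (1 - t) * f x2 y2 z2) ->
  exists p q m, forall x' y' z',
    f x y z + p * (x' - x) + q * (y' - y) + m * (z' - z) <= f x' y' z'.
Proof.
move=> fc.
have eqc (w a b t : R) : w + (t * a + (1 - t) * b) = t * (w + a) + (1 - t) * (w + b) by ring.
have eq0 (w t : R) : w = t * w + (1 - t) * w by ring.
have [|||p Hp] := @subgradient_step R^o (fun _ s => f (x + s) y z) (fun=> 0).
- by move=> u s v r t t01; have := fc (x + s) y z (x + r) y z t t01; rewrite -(eq0 y) -(eq0 z) -eqc.
- by move=> *; rewrite !mulr0 addr0.
- by move=> u; rewrite addr0.
have [|||q Hq] := @subgradient_step R^o (fun u s => f (x + u) (y + s) z) (fun u => p * u).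
- by move=> u s v r t t01; have := fc (x + u) (y + s) z (x + v) (y + r) z t t01; rewrite -(eq0 z) -!eqc.
- by move=> a u b v; rewrite /GRing.scale /=; ring.
- by move=> u; rewrite !addr0; have := Hp 0 u; rewrite !addr0.
have [|||m Hm] := @subgradient_step (R^o * R^o)%type
    (fun u s => f (x + u.1) (y + u.2) (z + s)) (fun u => p * u.1 + q * u.2).
- by move=> u s v r t t01; rewrite /= /GRing.scale /= !eqc; exact: fc.
- by move=> a u b v; rewrite /= /GRing.scale /=; ring.
- by move=> u; rewrite /= !addr0 addrA; have := Hq u.1 u.2; rewrite !addr0.
exists p, q, m => x' y' z'.
have := Hm (x' - x, y' - y) (z' - z); rewrite /= !addr0 !addrA.
have e w w' : w + w' - w = w' :> R by ring.
by rewrite !e.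
Qed.

(** [th d] may be infinite, so the line passes through a point [(d, c)] strictly below the graph.
    Convexity orders the slopes from the left and from the right; semicontinuity keeps [th] above
    [c] within [del] of [d], which together with [th >= 0] bounds the slopes by [c / del]. *)
Lemma convex_lsc_affine_minorant (th : R -> \bar R) (d c : R) :
  convex_ext th -> lower_semicontinuous th -> (forall t, (0 <= th t)%E) ->
  (c%:E < th d)%E -> exists k, forall t, ((c + k * (t - d))%:E <= th t)%E.
Proof.
move=> cv lsc th0 cd.
have [c0|c0] := leP c 0.
  by exists 0 => t; rewrite mul0r addr0 (le_trans _ (th0 t))// lee_fin.
have [V Vd HV] := lsc d c cd.
have [del /= del0 Hdel] := (nbhs_ballP _ _).1 Vd.
have near t : `|d - t| < del -> (c%:E < th t)%E by move=> H; apply: HV; apply: Hdel.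
have key t1 t2 y1 y2 : t1 < d -> d < t2 -> th t1 = y1%:E -> th t2 = y2%:E ->
    (c - y1) / (d - t1) <= (y2 - c) / (t2 - d).
  move=> t1d dt2 e1 e2.
  have p1 : 0 < d - t1 by rewrite subr_gt0.
  have p2 : 0 < t2 - d by rewrite subr_gt0.
  rewrite ler_pdivrMr// mulrAC ler_pdivlMr//.
  have p12 : 0 < t2 - t1 by lra.
  pose t := (t2 - d) / (t2 - t1).
  have t01 : 0 < t < 1 by rewrite divr_gt0//= ltr_pdivrMr//; lra.
  have te : (t2 - t1) * t = t2 - d by rewrite /t mulrCA divff ?mulr1// gt_eqF.
  have := cv t1 t2 t t01.
  have -> : t * t1 + (1 - t) * t2 = d.
    transitivity (t2 - (t2 - t1) * t); first by ring.
    by rewrite te; ring.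
  rewrite e1 e2 => /(lt_le_trans cd); rewrite -!EFinM -EFinD lte_fin => A.
  have : (t2 - t1) * c < (t2 - t1) * (t * y1 + (1 - t) * y2) by rewrite ltr_pM2l.
  have -> : (t2 - t1) * (t * y1 + (1 - t) * y2) =
    ((t2 - t1) * t) * y1 + ((t2 - t1) - (t2 - t1) * t) * y2 by ring.
  rewrite te; lra.
(* The extra element [- (c / del)] covers the case where [th] is infinite everywhere to the left of
   [d]. *)
pose A : set R := [set q | q = - (c / del) \/ exists t1 y1, [/\ t1 < d, th t1 = y1%:E & q = (c - y1) / (d - t1)]].
have cdel : 0 < c / del by rewrite divr_gt0.
have finy t y : th t = y%:E -> 0 <= y by move=> e; have := th0 t; rewrite e lee_fin.
have Aub1 : ubound A (c / del).
  move=> _ [->|[t1 [y1 [t1d e1 ->]]]]; first by lra.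
  have p1 : 0 < d - t1 by rewrite subr_gt0.
  have y10 := finy _ _ e1.
  rewrite ler_pdivrMr//.
  have [lt|ge] := ltP (d - t1) del.
    have : c < y1 by have := near t1; rewrite e1 lte_fin gtr0_norm// => /(_ lt).
    have : 0 < c / del * (d - t1) by rewrite mulr_gt0.
    lra.
  have : c / del * del <= c / del * (d - t1) by rewrite ler_pM2l.
  by rewrite divfK ?gt_eqF//; lra.
have hA : has_ubound A by exists (c / del).
exists (sup A) => t.
case e : (th t) => [y||]; [|by rewrite leey|by have := th0 t; rewrite e].
rewrite lee_fin; have y0 := finy _ _ e.
have [td|dt|td] := ltgtP t d.
- have : (c - y) / (d - t) <= sup A by apply: ub_le_sup => //; right; exists t, y.
  rewrite ler_pdivrMr ?subr_gt0//; lra.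
- have p2 : 0 < t - d by rewrite subr_gt0.
  have : sup A <= (y - c) / (t - d).
    apply: ge_sup; first by exists (- (c / del)); left.
    move=> _ [->|[t1 [y1 [t1d e1 ->]]]]; last exact: (key _ _ _ _ t1d dt e1 e).
    rewrite ler_pdivlMr//.
    have [lt|ge] := ltP (t - d) del.
      have : c < y by have := near t; rewrite e lte_fin distrC gtr0_norm// => /(_ lt).
      have : 0 < c / del * (t - d) by rewrite mulr_gt0.
      lra.
    have : c / del * del <= c / del * (t - d) by rewrite ler_pM2l.
    by rewrite divfK ?gt_eqF//; lra.
  rewrite ler_pdivlMr//; lra.
- by move: cd; rewrite -td e lte_fin subrr mulr0 addr0 => /ltW.
Qed.

End Subgradient.

(** * Polyconvexity and quasiconvexity of the envelope *)

Section Minorants.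
Context {R : realType}.
Local Notation M2 := 'M[R]_2.

Lemma rank1_det0 (Rm : M2) : \rank Rm = 1%N -> \det Rm = 0.
Proof.
move=> r1; apply/eqP; apply: contraT; rewrite -unitfE -unitmxE => /mxrank_unit.
by rewrite r1.
Qed.

(** The determinant is affine along rank-one lines, since its quadratic coefficient is
    [\det Rm = 0]. *)
Lemma polyconvex_rank_one_convex (f : M2 -> \bar R) : polyconvex f -> rank_one_convex f.
Proof.
move=> [G [_ Gc _ fG]] F Rm /rank1_det0 d0 a b t t01.
have := Gc (F + a *: Rm, \det (F + a *: Rm)) (F + b *: Rm, \det (F + b *: Rm)) t t01.
rewrite -!fG /=.
have -> : t *: (F + a *: Rm) + (1 - t) *: (F + b *: Rm) = F + (t * a + (1 - t) * b) *: Rm.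
  by apply/matrixP => i j; rewrite !mxE; ring.
have -> : t * \det (F + a *: Rm) + (1 - t) * \det (F + b *: Rm) =
    \det (F + (t * a + (1 - t) * b) *: Rm); last by rewrite -fG.
have D s : \det (F + s *: Rm) = \det F + s * (F 0 0 * Rm 1 1 + Rm 0 0 * F 1 1
    - F 0 1 * Rm 1 0 - Rm 0 1 * F 1 0) + s ^+ 2 * \det Rm.
  by rewrite !det2 !mxE; ring.
by rewrite !D d0; ring.
Qed.

(** Replaces [theta] by real numbers below it, which treats finite and infinite values alike. *)
Lemma lee_sup_fin (h : R) (th I : \bar R) : (0 <= th)%E ->
  (forall c : R, (c%:E < th)%E -> ((h + c)%:E <= I)%E) -> (h%:E + th <= I)%E.
Proof.
case: th => [r||]// _ H.
  apply/lee_addgt0Pr => e e0; rewrite -leeBlDr//.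
  have := H (r - e); rewrite lte_fin gtrBl e0 => /(_ isT).
  by rewrite -!EFinD addrA.
rewrite addey// leye_eq; apply/eqP/eqyP => A A0.
by have := H (A - h) (ltry _); rewrite addrC subrK.
Qed.

(* [Xm F = xF F ^+ 2] and [Ym F = yF F ^+ 2]. *)
Definition Xm (F : M2) : R := ((F 0 0 + F 0 1) ^+ 2 + (F 1 0 + F 1 1) ^+ 2) / 2.
Definition Ym (F : M2) : R := ((F 0 0 - F 0 1) ^+ 2 + (F 1 0 - F 1 1) ^+ 2) / 2.

Lemma Xm_convex (A B : M2) t : 0 <= t <= 1 ->
  Xm (t *: A + (1 - t) *: B) <= t * Xm A + (1 - t) * Xm B.
Proof.
move=> /andP[t0 t1]; rewrite /Xm !mxE.
have u0 : 0 <= t * (1 - t) by rewrite mulr_ge0//; lra.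
have := mulr_ge0 u0 (sqr_ge0 ((A 0 0 + A 0 1) - (B 0 0 + B 0 1))).
have := mulr_ge0 u0 (sqr_ge0 ((A 1 0 + A 1 1) - (B 1 0 + B 1 1))).
lra.
Qed.

Lemma Ym_convex (A B : M2) t : 0 <= t <= 1 ->
  Ym (t *: A + (1 - t) *: B) <= t * Ym A + (1 - t) * Ym B.
Proof.
move=> /andP[t0 t1]; rewrite /Ym !mxE.
have u0 : 0 <= t * (1 - t) by rewrite mulr_ge0//; lra.
have := mulr_ge0 u0 (sqr_ge0 ((A 0 0 - A 0 1) - (B 0 0 - B 0 1))).
have := mulr_ge0 u0 (sqr_ge0 ((A 1 0 - A 1 1) - (B 1 0 - B 1 1))).
lra.
Qed.

Variables (lam : R) (theta : R -> \bar R).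
Hypotheses (lam1 : 1 < lam) (theta_convex : convex_ext theta)
  (theta_lsc : lower_semicontinuous theta) (theta_ge0 : forall t, (0 <= theta t)%E).

Lemma HfunE F : Hfun lam theta F = ((hh lam (Xm F) (Ym F) (\det F))%:E + theta (\det F))%E.
Proof. by rewrite /Hfun (hfunE lam (xyF_Obar F)) xF_sqr yF_sqr. Qed.

Lemma WE F : W lam theta F = ((gfun lam (xF F) (yF F) (\det F))%:E + theta (\det F))%E.
Proof. by rewrite /W distK2E. Qed.

Lemma Hfun_le_W F : (Hfun lam theta F <= W lam theta F)%E.
Proof.
rewrite HfunE WE leeD2r// lee_fin gfunE.
have [_ _ C] := Obar_cone (xyF_Obar F) (lexx _) (lexx _).
by rewrite -[Xm F]xF_sqr -[Ym F]yF_sqr; exact: hh_le.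
Qed.

(** Monotonicity of [hh] in [X] and [Y] makes the slopes [p], [q] nonnegative; this is what allows
    the convex functions [Xm] and [Ym] to be substituted and bounded below by their
    linearisations. *)
Lemma hh_minorant (x y z : R) : exists p q m, [/\ 0 <= p, 0 <= q & forall x' y' z',
  hh lam x y z + p * (x' - x) + q * (y' - y) + m * (z' - z) <= hh lam x' y' z'].
Proof.
have [p [q [m H]]] := convex3_subgradient x y z (fun x1 y1 z1 x2 y2 z2 t => @hh_convex _ _ lam1 x1 y1 z1 x2 y2 z2 t).
exists p, q, m; split => //.
  have := H (x - 1) y z; have : hh lam (x - 1) y z <= hh lam x y z by apply: hh_mono => //; lra.
  lra.
have := H x (y - 1) z; have : hh lam x (y - 1) z <= hh lam x y z by apply: hh_mono => //; lra.
lra.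
Qed.

Definition Gfun (z : M2 * R) : \bar R := ((hh lam (Xm z.1) (Ym z.1) z.2)%:E + theta z.2)%E.

Lemma Gfun_convex : convex_ext5 Gfun.
Proof.
move=> [A a] [B b] t t01; rewrite /Gfun /=.
have /andP[t0 t1] := t01.
have t01' : 0 <= t <= 1 by rewrite !ltW.
have th := theta_convex a b t01.
have : hh lam (Xm (t *: A + (1 - t) *: B)) (Ym (t *: A + (1 - t) *: B)) (t * a + (1 - t) * b) <=
    t * hh lam (Xm A) (Ym A) a + (1 - t) * hh lam (Xm B) (Ym B) b.
  apply: le_trans (hh_convex lam1 _ _ _ _ _ _ t01').
  by apply: (hh_mono lam1); [exact: Xm_convex|exact: Ym_convex].
move: (hh lam _ _ _) => h; move: (hh lam _ _ _) => ha; move: (hh lam _ _ _) => hb hab.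
have u0 : 0 < 1 - t by lra.
have := theta_ge0 a; have := theta_ge0 b; move: th.
case: (theta a) => [ra||]//; case: (theta b) => [rb||]// th _ _.
- apply: (le_trans (leeD2l _ th)).
  change ((h + (t * ra + (1 - t) * rb))%:E <= (t * (ha + ra) + (1 - t) * (hb + rb))%:E)%E.
  by rewrite lee_fin; lra.
- by rewrite [X in (_ <= _ + _ * X)%E]addey// (gt0_muley (_ : 0 < (1 - t)%:E)%E) ?lte_fin// addey ?leey.
- by rewrite [X in (_ <= _ * X + _)%E]addey// (gt0_muley (_ : 0 < t%:E)%E) ?lte_fin// addye ?leey.
- by rewrite !addey// (gt0_muley (_ : 0 < t%:E)%E) ?lte_fin// (gt0_muley (_ : 0 < (1 - t)%:E)%E) ?lte_fin// leey.
Qed.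

(** Through a value above [a] passes a continuous minorant [Psi], made of a subgradient of [hh] and
    an affine minorant of [theta]; it exceeds [a] on a neighbourhood. *)
Lemma Gfun_lsc : lower_semicontinuous Gfun.
Proof.
move=> [A d] a; rewrite /Gfun /= => aG.
have [c [cth ac]] : exists c, (c%:E < theta d)%E /\ a < hh lam (Xm A) (Ym A) d + c.
  move: aG; have := theta_ge0 d; case: (theta d) => [r||]// _ aG.
    move: aG; rewrite -EFinD lte_fin => ar.
    exists ((a - hh lam (Xm A) (Ym A) d + r) / 2); rewrite lte_fin; lra.
  exists (a - hh lam (Xm A) (Ym A) d + 1); rewrite ltry; split => //; lra.
have [k Hk] := convex_lsc_affine_minorant theta_convex theta_lsc theta_ge0 cth.
have [p [q [m [_ _ H]]]] := hh_minorant (Xm A) (Ym A) d.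
pose Psi (z : M2 * R) : R := hh lam (Xm A) (Ym A) d + p * (Xm z.1 - Xm A) +
  q * (Ym z.1 - Ym A) + m * (z.2 - d) + (c + k * (z.2 - d)).
have cont : continuous Psi.
  have ce i j : continuous (fun z : M2 * R => z.1 i j).
    move=> z; apply: (@continuous_comp _ _ _ fst (fun B : M2 => B i j)); first exact: cvg_fst.
    exact: coord_continuous.
  have c2 : continuous (fun z : M2 * R => z.2) by move=> z; exact: cvg_snd.
  have csq (g : M2 * R -> R) : continuous g -> continuous (fun z => g z ^+ 2).
    move=> cg; have cgg : continuous (fun z => g z * g z) by move=> z; apply: cvgM; exact: cg.
    exact: cgg.
  have cX : continuous (fun z : M2 * R => Xm z.1).
    move=> z; apply: cvgM; last exact: cvg_cst.
    by apply: cvgD; apply: csq => w; apply: cvgD; exact: ce.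
  have cY : continuous (fun z : M2 * R => Ym z.1).
    move=> z; apply: cvgM; last exact: cvg_cst.
    by apply: cvgD; apply: csq => w; apply: cvgB; exact: ce.
  have lin (r r' : R) (g : M2 * R -> R) : continuous g -> continuous (fun z => r * (g z - r')).
    by move=> cg z; apply: cvgM; [exact: cvg_cst|apply: cvgB; [exact: cg|exact: cvg_cst]].
  move=> z; apply: cvgD; last by apply: cvgD; [exact: cvg_cst|exact: lin].
  apply: cvgD; last exact: lin.
  apply: cvgD; last exact: lin.
  by apply: cvgD; [exact: cvg_cst|exact: lin].
exists [set z | a < Psi z].
  apply: open_nbhs_nbhs; split.
    exact: (open_comp (fun z _ => cont z) (@open_gt R a)).
  by rewrite /= /Psi !subrr !mulr0 !addr0.
move=> [B b] /= aP; apply: (@lt_le_trans _ _ (Psi (B, b))%:E); first by rewrite lte_fin.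
by rewrite /Psi EFinD leeD//= lee_fin; exact: H.
Qed.

Lemma Hfun_polyconvex : polyconvex (Hfun lam theta).
Proof.
exists Gfun; split; [|exact: Gfun_convex|exact: Gfun_lsc|exact: HfunE].
by move=> z; rewrite /Gfun; have := theta_ge0 z.2; case: (theta z.2).
Qed.

Lemma Hfun_rank_one_convex : rank_one_convex (Hfun lam theta).
Proof. exact: polyconvex_rank_one_convex Hfun_polyconvex. Qed.

Lemma Hfun_quasiconvex : quasiconvex (Hfun lam theta).
Proof.
move=> F phi hphi; rewrite {1}HfunE; apply: lee_sup_fin => // c cth.
have [k Hk] := convex_lsc_affine_minorant theta_convex theta_lsc theta_ge0 cth.
have [p [q [m [p0 q0 H]]]] := hh_minorant (Xm F) (Ym F) (\det F).
(* The linear slopes are the gradient of [p * Xm + q * Ym] at [F]. *)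
apply: (@polyaffine_jensen _ _ _ _
  (p * (F 0 0 + F 0 1) + q * (F 0 0 - F 0 1)) (p * (F 0 0 + F 0 1) - q * (F 0 0 - F 0 1))
  (p * (F 1 0 + F 1 1) + q * (F 1 0 - F 1 1)) (p * (F 1 0 + F 1 1) - q * (F 1 0 - F 1 1))
  (m + k)) => // G.
rewrite HfunE.
have := H (Xm (F + G)) (Ym (F + G)) (\det (F + G)); have := Hk (\det (F + G)).
move: (theta _) (hh lam (Xm (F + G)) _ _) => th h A B.
apply: (@le_trans _ _ (h%:E + (c + k * (\det (F + G) - \det F))%:E)%E); last by rewrite leeD2l.
rewrite -EFinD lee_fin.
have PX : p * ((F 0 0 + F 0 1) * (G 0 0 + G 0 1) + (F 1 0 + F 1 1) * (G 1 0 + G 1 1)) <=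
    p * (Xm (F + G) - Xm F).
  rewrite ler_wpM2l// /Xm !mxE.
  have := sqr_ge0 (G 0 0 + G 0 1); have := sqr_ge0 (G 1 0 + G 1 1); lra.
have PY : q * ((F 0 0 - F 0 1) * (G 0 0 - G 0 1) + (F 1 0 - F 1 1) * (G 1 0 - G 1 1)) <=
    q * (Ym (F + G) - Ym F).
  rewrite ler_wpM2l// /Ym !mxE.
  have := sqr_ge0 (G 0 0 - G 0 1); have := sqr_ge0 (G 1 0 - G 1 1); lra.
lra.
Qed.

End Minorants.

(** * The upper bound *)

Section UpperBound.
Context {R : realType}.
Local Notation M2 := 'M[R]_2.

(* The shears [I + 2 t (w v^T)] for [sg = 1] and [I + 2 t (v w^T)] for [sg = -1], with [v, w] the
   diagonal directions: [F *m shm sg t] has the determinant of [F], and its [Ym] if [sg = 1], its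
   [Xm] if [sg = -1]. *)
Definition shm (sg t : R) : M2 := \matrix_(i, j)
  (if i == 0 then (if j == 0 then 1 + t else sg * t)
   else (if j == 0 then - (sg * t) else 1 - t)).

Lemma mul_shm (F : M2) sg t i :
  (F *m shm sg t) i 0 = F i 0 * (1 + t) - sg * t * F i 1 /\
  (F *m shm sg t) i 1 = sg * t * F i 0 + F i 1 * (1 - t).
Proof. by rewrite !mul2E !mxE /=; split; ring. Qed.

Lemma det_shm sg t : sg ^+ 2 = 1 -> \det (shm sg t) = 1.
Proof.
move=> s2; rewrite det2 !mxE /=.
transitivity (1 - t ^+ 2 + sg ^+ 2 * t ^+ 2); first by ring.
by rewrite s2; ring.
Qed.

Lemma shm0 sg : shm sg 0 = 1%:M.
Proof.
apply/matrixP => i j; rewrite !mxE.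
by case: i => -[|[|//]] ?; case: j => -[|[|//]] ? /=; rewrite ?mulr0 ?addr0 ?subr0 ?oppr0.
Qed.

Lemma shmM sg t u : sg ^+ 2 = 1 -> shm sg t *m shm sg u = shm sg (t + u).
Proof.
move=> s2; apply/matrixP => i j; rewrite mul2E !mxE /=.
have e : sg * t * (sg * u) = t * u.
  by transitivity (sg ^+ 2 * (t * u)); [ring|rewrite s2 mul1r].
case: i => -[|[|//]] ?; case: j => -[|[|//]] ? /=.
- by transitivity ((1 + t) * (1 + u) - sg * t * (sg * u)); [ring|rewrite e; ring].
- ring.
- ring.
- by transitivity ((1 - t) * (1 - u) - sg * t * (sg * u)); [ring|rewrite e; ring].
Qed.

(** The inner product of [F v] and [F w]. *)
Definition XY (F : M2) : R := ((F 0 0 + F 0 1) * (F 0 0 - F 0 1) + (F 1 0 + F 1 1) * (F 1 0 - F 1 1)) / 2.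

(** The shear fixes [w] and sends [v] to [v + 2 t w]. *)
Lemma XYm_shm1 F t :
  Xm (F *m shm 1 t) = Xm F + 4 * XY F * t + 4 * Ym F * t ^+ 2 /\ Ym (F *m shm 1 t) = Ym F.
Proof.
have [a b] := mul_shm F 1 t 0; have [a' b'] := mul_shm F 1 t 1.
by rewrite /Xm /Ym /XY a b a' b'; split; field.
Qed.

Lemma XYm_shmN1 F t :
  Ym (F *m shm (-1) t) = Ym F + 4 * XY F * t + 4 * Xm F * t ^+ 2 /\ Xm (F *m shm (-1) t) = Xm F.
Proof.
have [a b] := mul_shm F (-1) t 0; have [a' b'] := mul_shm F (-1) t 1.
by rewrite /Xm /Ym /XY a b a' b'; split; field.
Qed.

Lemma quad_roots (a b c : R) : 0 < a -> c < 0 ->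
  exists t1 t2, [/\ t1 < 0, 0 < t2, c + b * t1 + a * t1 ^+ 2 = 0 & c + b * t2 + a * t2 ^+ 2 = 0].
Proof.
move=> a0 c0; pose D := b ^+ 2 - 4 * a * c.
have ac : 0 < a * - c by rewrite mulr_gt0// oppr_gt0.
have Dp : 0 < D by have := sqr_ge0 b; rewrite /D; lra.
have D0 : `|b| < Num.sqrt D by rewrite -sqrtr_sqr ltr_sqrt// /D; lra.
have r2 : Num.sqrt D ^+ 2 = D by rewrite sqr_sqrtr// ltW.
move: D0 r2; rewrite ltr_norml => /andP[b1 b2]; move: (Num.sqrt D) b1 b2 => r b1 b2 r2.
have root s : s ^+ 2 = D -> c + b * ((- b + s) / (2 * a)) + a * ((- b + s) / (2 * a)) ^+ 2 = 0.
  move=> s2; transitivity ((s ^+ 2 - (b ^+ 2 - 4 * a * c)) / (4 * a)); first by field; rewrite gt_eqF.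
  by rewrite s2 /D subrr mul0r.
exists ((- b - r) / (2 * a)), ((- b + r) / (2 * a)); split.
- by rewrite ltr_pdivrMr ?mul0r ?mulr_gt0//; lra.
- by rewrite divr_gt0 ?mulr_gt0//; lra.
- by apply: root; rewrite sqrrN.
- exact: root.
Qed.

(* This and the next property hold for rank-one convex functions and for quasiconvex functions
   below [W], and they suffice for the upper bound: shears move [F] to the level set where
   [Xm] and [Ym] take prescribed larger values, except for [F = 0]. *)
Definition shear_laminable (theta : R -> \bar R) (f : M2 -> \bar R) := forall F sg t1 t2 (M : R),
  sg ^+ 2 = 1 -> t1 < 0 < t2 -> (theta (\det F) < +oo)%E ->
  (f (F *m shm sg t1) <= M%:E)%E -> (f (F *m shm sg t2) <= M%:E)%E -> (f F <= M%:E)%E.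

Definition zero_laminable (f : M2 -> \bar R) := forall (e M : R), 0 < e ->
  (forall G : M2, \det G = 0 -> G != 0 -> Xm G <= e -> Ym G <= e -> (f G <= M%:E)%E) ->
  (f 0%R <= M%:E)%E.

Lemma rank_one_shear_laminable theta f : rank_one_convex f -> shear_laminable theta f.
Proof.
move=> fc F sg t1 t2 M s2 /andP[t10 t20] _ f1 f2.
pose r : 'rV[R]_2 := \row_j (if j == 0 then 1 else sg).
pose w : 'cV[R]_2 := \col_i (if i == 0 then 1 else - sg).
have E t : F *m shm sg t = F + t *: (F *m w *m r).
  apply/matrixP => i j; rewrite mul2E !mxE big_ord1 mul2E !mxE /=.
  case: (ord2P j) => -> /=; first by ring.
  transitivity (F i 1 + t * sg * F i 0 - t * sg ^+ 2 * F i 1); last by ring.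
  by rewrite s2; ring.
have [R0|R0] := eqVneq (F *m w *m r) 0.
  by rewrite E R0 scaler0 addr0 in f1.
have rk : \rank (F *m w *m r) = 1%N.
  apply/eqP; rewrite eqn_leq lt0n mxrank_eq0 R0 andbT.
  by rewrite (leq_trans (mxrankM_maxl _ _))// rank_leq_col.
have p : 0 < t2 - t1 by lra.
pose t := t2 / (t2 - t1).
have te : (t2 - t1) * t = t2 by rewrite /t mulrCA divff ?mulr1// gt_eqF.
have t01 : 0 < t < 1 by rewrite divr_gt0//= ltr_pdivrMr//; lra.
have := fc F _ rk t1 t2 t t01.
have -> : t * t1 + (1 - t) * t2 = 0.
  transitivity (t2 - (t2 - t1) * t); first by ring.
  by rewrite te subrr.
rewrite scale0r addr0 -!E => /le_trans; apply.
have /andP[t0 t1'] := t01.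
have u0 : 0 < 1 - t by lra.
have -> : M%:E = (t%:E * M%:E + (1 - t)%:E * M%:E)%E by rewrite -!EFinM -EFinD; congr EFin; ring.
by apply: leeD; rewrite lee_pmul2l// lte_fin.
Qed.

(** 0 is the midpoint of [d *: E] and [- d *: E]; [d = min 1 e] gives [d ^+ 2 <= e]. *)
Lemma rank_one_zero_laminable f : rank_one_convex f -> zero_laminable f.
Proof.
move=> fc e M e0 H.
pose E : M2 := delta_mx 0 0.
have rk : \rank E = 1%N by rewrite mxrank_delta.
pose d := Num.min 1 e.
have d0 : 0 < d by rewrite lt_min ltr01.
have d1 : d <= 1 by rewrite ge_min lexx.
have de : d <= e by rewrite ge_min lexx orbT.
have dd : d ^+ 2 <= e by apply: le_trans de; rewrite expr2 ler_piMr// ltW.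
have ent t : [/\ (t *: E) 0 0 = t, (t *: E) 0 1 = 0, (t *: E) 1 0 = 0 & (t *: E) 1 1 = 0].
  by rewrite !mxE /= !mulr0 mulr1.
have small t : t ^+ 2 = d ^+ 2 -> (f (t *: E) <= M%:E)%E.
  move=> td; have [e00 e01 e10 e11] := ent t.
  apply: H; rewrite ?det2 /Xm /Ym ?e00 ?e01 ?e10 ?e11 ?addr0 ?subr0 ?td ?expr0n /=; [ring| |lra|lra].
  apply/eqP => t0; move: e00; rewrite t0 mxE => t0'.
  by move: td; rewrite -t0' expr0n /= => /esym/eqP; rewrite sqrf_eq0 gt_eqF.
have h01 : 0 < (2^-1 : R) < 1 by rewrite invr_gt0 invf_lt1 ?ltr1n ?ltr0n.
have := fc 0 E rk d (- d) 2^-1 h01.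
have -> : 2^-1 * d + (1 - 2^-1) * - d = 0 by field.
rewrite scale0r !add0r => /le_trans; apply.
have -> : M%:E = ((2^-1 : R)%:E * M%:E + (1 - 2^-1 : R)%:E * M%:E)%E.
  by rewrite -!EFinM -EFinD; congr EFin; field.
have u0 : 0 < (1 - 2^-1 : R) by lra.
by apply: leeD; rewrite lee_pmul2l ?lte_fin ?invr_gt0//; apply: small; rewrite ?sqrrN.
Qed.

Variables (lam : R) (theta : R -> \bar R).
Hypotheses (lam1 : 1 < lam) (theta_ge0 : forall t, (0 <= theta t)%E).
Variable f : M2 -> \bar R.
Hypotheses (fW : forall F, (f F <= W lam theta F)%E)
  (fL : shear_laminable theta f) (f0 : zero_laminable f).

Lemma Xm_ge0 (F : M2) : 0 <= Xm F.
Proof. by rewrite divr_ge0// addr_ge0// sqr_ge0. Qed.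
Lemma Ym_ge0 (F : M2) : 0 <= Ym F.
Proof. by rewrite divr_ge0// addr_ge0// sqr_ge0. Qed.

Lemma XYm_eq0 (F : M2) : Xm F = 0 -> Ym F = 0 -> F = 0.
Proof.
rewrite /Xm /Ym => X0 Y0.
have e2 : (2^-1 : R) != 0 by rewrite invr_eq0.
move/eqP: X0; rewrite mulf_eq0 (negbTE e2) orbF paddr_eq0 ?sqr_ge0// !sqrf_eq0 => /andP[/eqP a /eqP b].
move/eqP: Y0; rewrite mulf_eq0 (negbTE e2) orbF paddr_eq0 ?sqr_ge0// !sqrf_eq0 => /andP[/eqP c /eqP d].
apply/matrixP => i j; rewrite mxE.
by case: (ord2P i) => ->; case: (ord2P j) => ->; lra.
Qed.

Section fixed_det.
Variables (X Y d r : R).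
Hypotheses (X0 : 0 < X) (Y0 : 0 < Y) (rE : theta d = r%:E).
Let M := gh lam X Y d + r.

(** Along the shear [Xm] is a quadratic polynomial with leading coefficient [4 * Ym G > 0] and a
    value below [X] at [t = 0], so it takes the value [X] on both sides of 0. *)
Let raise_x G : \det G = d -> 0 < Ym G -> Xm G < X ->
  (forall t, Xm (G *m shm 1 t) = X -> (f (G *m shm 1 t) <= M%:E)%E) -> (f G <= M%:E)%E.
Proof.
move=> dG yG xG H.
have [t1 [t2 [t10 t20 e1 e2]]] := @quad_roots (4 * Ym G) (4 * XY G) (Xm G - X)
  (ltac:(by rewrite mulr_gt0)) (ltac:(by rewrite subr_lt0)).
apply: (fL (t1 := t1) (t2 := t2) (sg := 1)); rewrite ?expr1n ?t10 ?dG ?rE ?ltry//.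
  by apply: H; have [-> _] := XYm_shm1 G t1; lra.
by apply: H; have [-> _] := XYm_shm1 G t2; lra.
Qed.

Let raise_y G : \det G = d -> 0 < Xm G -> Ym G < Y ->
  (forall t, Ym (G *m shm (-1) t) = Y -> (f (G *m shm (-1) t) <= M%:E)%E) -> (f G <= M%:E)%E.
Proof.
move=> dG xG yG H.
have [t1 [t2 [t10 t20 e1 e2]]] := @quad_roots (4 * Xm G) (4 * XY G) (Ym G - Y)
  (ltac:(by rewrite mulr_gt0)) (ltac:(by rewrite subr_lt0)).
apply: (fL (t1 := t1) (t2 := t2) (sg := -1)); rewrite ?sqrrN ?expr1n ?t10 ?dG ?rE ?ltry//.
  by apply: H; have [-> _] := XYm_shmN1 G t1; lra.
by apply: H; have [-> _] := XYm_shmN1 G t2; lra.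
Qed.

Let det_shmM G sg t : sg ^+ 2 = 1 -> \det (G *m shm sg t) = \det G.
Proof. by move=> s2; rewrite det_mulmx det_shm// mulr1. Qed.

Let level_le G : \det G = d -> Xm G = X -> Ym G = Y -> (f G <= M%:E)%E.
Proof.
move=> dG xG yG; apply: le_trans (fW G) _.
by rewrite (WE theta lam1) gfunE xF_sqr yF_sqr -/(Xm G) -/(Ym G) dG xG yG rE.
Qed.

Let edge_le G : \det G = d -> Xm G <= X -> Ym G = Y -> (f G <= M%:E)%E.
Proof.
move=> dG; rewrite le_eqVlt => /orP[/eqP xG|xG] yG; first exact: level_le.
apply: raise_x => //; first by rewrite yG.
by move=> t xt; apply: level_le => //; [rewrite det_shmM// expr1n|have [_ ->] := XYm_shm1 G t].
Qed.

Let Xm_gt0_le G : \det G = d -> Xm G <= X -> Ym G <= Y -> 0 < Xm G -> (f G <= M%:E)%E.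
Proof.
move=> dG xG; rewrite le_eqVlt => /orP[/eqP yG|yG] x0; first exact: edge_le.
apply: raise_y => // t yt; apply: edge_le => //; first by rewrite det_shmM// sqrrN expr1n.
by have [_ ->] := XYm_shmN1 G t.
Qed.

(** If [Xm G = 0], then [Ym] cannot be raised directly; but [Ym G > 0], so [Xm] is raised to [X > 0]
    beforehand. *)
Let nonzero_le G : \det G = d -> Xm G <= X -> Ym G <= Y -> G != 0 -> (f G <= M%:E)%E.
Proof.
move=> dG xG yG G0; have := Xm_ge0 G; rewrite le_eqVlt => /orP[/eqP x0|]; last exact: Xm_gt0_le.
have := Ym_ge0 G; rewrite le_eqVlt => /orP[/eqP y0|y0].
  by move: G0; rewrite (XYm_eq0 (esym x0) (esym y0)) eqxx.
apply: raise_x => //; first by rewrite -x0.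
move=> t xt; apply: Xm_gt0_le; rewrite ?xt//; first by rewrite det_shmM// expr1n.
by have [_ ->] := XYm_shm1 G t.
Qed.

(** Shears leave [F = 0] where it is. There [f 0] is compared with small nonzero matrices of
    determinant 0, which satisfy the bound already. *)
Lemma laminable_le_gh F : \det F = d -> Xm F <= X -> Ym F <= Y -> (f F <= M%:E)%E.
Proof.
move=> dF xF yF; have [F0|F0] := eqVneq F 0; last exact: nonzero_le.
have d0 : d = 0 by rewrite -dF F0 det2 !mxE mulr0 subr0.
rewrite F0; apply: (f0 (e := Num.min X Y)); first by rewrite lt_min X0.
move=> G dG G0; rewrite !le_min => /andP[xG _] /andP[_ yG].
by apply: nonzero_le; rewrite // dG d0.
Qed.

End fixed_det.

(** Target levels taken from [hh] may be 0, while lamination needs them positive; raising both by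
    [e] costs at most [2 * e]. *)
Lemma gh_shift X Y d e : cone X Y d -> 0 < e -> gh lam (X + e) (Y + e) d <= gh lam X Y d + 2 * e.
Proof.
move=> [x0 y0 C] e0.
have : Num.sqrt (Ah lam X Y d) <= Num.sqrt (Ah lam (X + e) (Y + e) d); last by rewrite /gh; lra.
apply: ler_wsqrtr; rewrite /Ah.
have c0 := c_gt2 lam1; have s0 := s_gt0 lam1.
have : Num.sqrt (X * Y - d ^+ 2) <= Num.sqrt ((X + e) * (Y + e) - d ^+ 2).
  apply: ler_wsqrtr; have : 0 <= e * (X + Y + e) by rewrite mulr_ge0 ?(ltW e0)// !addr_ge0// ltW.
  lra.
move=> /(ler_wpM2l (ltW s0)).
have : (X + Y) * ((lam ^+ 2 + lam ^- 2) / 2) <= (X + e + (Y + e)) * ((lam ^+ 2 + lam ^- 2) / 2).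
  by apply: ler_wpM2r; lra.
lra.
Qed.

Lemma laminable_le_Hfun F : (f F <= Hfun lam theta F)%E.
Proof.
rewrite HfunE; have := theta_ge0 (\det F).
case rE : (theta (\det F)) => [r||]// _; last by rewrite addey// leey.
rewrite -EFinD; apply/lee_addgt0Pr => e e0.
(* One third for the almost optimal pair, two thirds for [gh_shift]. *)
have e3 : 0 < e / 3 by rewrite divr_gt0.
have [X [Y [xX yY C H]]] := hh_approx lam1 (Xm F) (Ym F) (\det F) e3.
have [X0 Y0 _] := C.
have G := gh_shift C e3.
have X3 : 0 < X + e / 3 by lra.
have Y3 : 0 < Y + e / 3 by lra.
apply: le_trans (laminable_le_gh X3 Y3 rE erefl _ _) _; [lra|lra|].
by rewrite -EFinD lee_fin; lra.
Qed.

End UpperBound.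

(** * Area-preserving piecewise affine maps *)

Section AreaPreserving.
Context {R : realType}.
Local Notation T2 := (measurableTypeR R * measurableTypeR R)%type.
Local Notation mu := (@lebesgue_measure R).
Local Notation mu2 := ((@lebesgue_measure R \x @lebesgue_measure R)%E).
Local Notation M2 := 'M[R]_2.

Definition mact (M : M2) (h : R * R) : R * R :=
  (M 0 0 * h.1 + M 0 1 * h.2, M 1 0 * h.1 + M 1 1 * h.2).

Lemma mact_mul (M N : M2) h : mact (M *m N) h = mact M (mact N h).
Proof. by rewrite /mact !mul2E /=; congr pair; ring. Qed.

Lemma mact_le (M : M2) h :
  `|mact M h| <= (`|M 0 0| + `|M 0 1| + (`|M 1 0| + `|M 1 1|)) * `|h|.
Proof.
have e (a b : R) : `|a * h.1 + b * h.2| <= (`|a| + `|b|) * `|h|.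
  by have := lin2_le a b h; rewrite /lin2 [a * _]mulrC [b * _]mulrC.
rewrite prod_normE ge_max; apply/andP; split; apply: le_trans (e _ _) _; apply: ler_wpM2r => //.
  by rewrite lerDl addr_ge0.
by rewrite lerDr addr_ge0.
Qed.

(** Exact equality near [z], stronger than differentiability: it makes the chain rule a
    substitution. *)
Definition loc_affine (psi : R * R -> R * R) z (M : M2) :=
  exists2 d, 0 < d & forall h, `|h| < d -> psi (z + h) = psi z + mact M h.

Lemma loc_affine_comp (psi phi : R * R -> R * R) z (M N : M2) :
  loc_affine phi z N -> loc_affine psi (phi z) M -> loc_affine (psi \o phi) z (M *m N).
Proof.
move=> [d d0 H] [e e0 K].
set c := `|N 0 0| + `|N 0 1| + (`|N 1 0| + `|N 1 1|).
have c1 : 0 < c + 1 by rewrite ltr_wpDl// !addr_ge0.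
exists (Num.min d (e / (c + 1))); first by rewrite lt_min d0 divr_gt0.
move=> h; rewrite lt_min => /andP[hd he] /=; rewrite H// K ?mact_mul//.
rewrite (le_lt_trans (mact_le N h))// -/c; move: he; rewrite ltr_pdivlMr//.
by have := normr_ge0 h; lra.
Qed.

Lemma loc_affine_near (psi phi : R * R -> R * R) z (M : M2) (d : R) : 0 < d ->
  (forall h, `|h| < d -> psi (z + h) = phi (z + h)) -> loc_affine phi z M -> loc_affine psi z M.
Proof.
move=> d0 E [e e0 H]; exists (Num.min d e); first by rewrite lt_min d0.
move=> h; rewrite lt_min => /andP[hd he]; rewrite E// H//.
by have := E 0; rewrite normr0 addr0 => ->.
Qed.

Lemma loc_affine_Dmat (phi : R * R -> R * R) z (M : M2) : loc_affine phi z M -> Dmat phi z = M.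
Proof.
move=> [d d0 H].
have G (u : R * R -> R) (p q : R) : (forall h, `|h| < d -> u (z + h) = u z + (p * h.1 + q * h.2)) ->
    gradient_at u z p q.
  move=> Hu e e0; exists d => // h hd; rewrite Hu// /lin2.
  rewrite (_ : _ - _ - _ = 0) ?normr0 ?mulr_ge0 ?(ltW e0)//; ring.
have [D00 D01 D10 D11] := Dmat_gradient
  (G (fst \o phi) (M 0 0) (M 0 1) (fun h hd => congr1 fst (H h hd)))
  (G (snd \o phi) (M 1 0) (M 1 1) (fun h hd => congr1 snd (H h hd))).
by apply/matrixP => i j; case: (ord2P i) => ->; case: (ord2P j) => ->.
Qed.

Definition loc_affine1 (s : R -> R) t (a : R) :=
  exists2 d, 0 < d & forall k, `|k| < d -> s (t + k) = s t + a * k.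

Definition pw_affine (C : R) (s : R -> R) :=
  (forall x y, `|s x - s y| <= C * `|x - y|) /\
  exists K : set R, [/\ measurable K, mu K = 0%E &
    forall t, ~ K t -> exists2 a, `|a| <= C & loc_affine1 s t a].

(** [C] bounds the entries of the gradient, whereas the Lipschitz constant is only required to
    exist. Preservation of measure also keeps exceptional sets null under preimages, so the class is
    closed under composition. *)
Definition area_map (C : R) (psi : R * R -> R * R) :=
  [/\ measurable_fun (setT : set T2) (psi : T2 -> T2),
      forall A : set T2, measurable A -> mu2 (psi @^-1` A) = mu2 A,
      exists L, forall x y, `|psi x - psi y| <= L * `|x - y| &
      exists N : set T2, [/\ measurable N, mu2 N = 0%E & forall z, ~ N z ->
        exists M : M2, [/\ loc_affine psi z M, \det M = 1 & forall i j, `|M i j| <= C]]].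

Lemma area_map_comp C D psi phi : area_map C psi -> area_map D phi ->
  area_map (2 * (C * D)) (psi \o phi).
Proof.
move=> [m1 p1 [L1 l1] [N1 [mN1 N10 a1]]] [m2 p2 [L2 l2] [N2 [mN2 N20 a2]]].
have pre (A : set T2) : measurable A -> measurable (phi @^-1` A : set T2).
  by move=> mA; rewrite -[X in measurable X]setTI; exact: m2.
split.
- exact: (measurableT_comp m1 m2).
- move=> A mA; have mB : measurable (psi @^-1` A : set T2).
    by rewrite -[X in measurable X]setTI; exact: m1.
  by transitivity (mu2 (psi @^-1` A)); [exact: p2 mB|exact: p1].
- exists (`|L1| * L2) => x y; apply: le_trans (l1 _ _) _; rewrite -mulrA.
  apply: (@le_trans _ _ (`|L1| * `|phi x - phi y|)); first by rewrite ler_wpM2r// ler_norm.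
  by rewrite ler_wpM2l.
- exists (N2 `|` phi @^-1` N1); split.
  + by apply: measurableU => //; exact: pre.
  + apply: (@measure_negligible _ T2 R mu2); first by apply: measurableU => //; exact: pre.
    apply: negligibleU; first by exists N2; split.
    exists (phi @^-1` N1); split => //; first exact: pre.
    by rewrite -N10; exact: p2.
  + move=> z /not_orP[z2 z1].
    have [M [aM dM bM]] := a1 _ z1; have [N [aN dN bN]] := a2 _ z2.
    exists (M *m N); split; first exact: loc_affine_comp aN aM.
      by rewrite det_mulmx dM dN mulr1.
    (* An entry of the product is a sum of two products, whence the factor 2. *)
    move=> i j; rewrite mul2E (le_trans (ler_normD _ _))// !normrM mulr_natl mulr2n.
    by apply: lerD; apply: ler_pM.
Qed.

Definition tri_mx (a b : R) : M2 := \matrix_(i, j) (if i == 0 then (if j == 0 then 1 else a)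
  else (if j == 0 then b else 1)).

Lemma xshear_loc_affine s z (a : R) : loc_affine1 s z.2 a -> loc_affine (xshear s) z (tri_mx a 0).
Proof.
move=> [d d0 H]; exists d => // h hd; rewrite /xshear /mact !mxE /= H.
  by congr pair => /=; ring.
exact: le_lt_trans (norm_snd_le h) hd.
Qed.

Lemma yshear_loc_affine s z (a : R) : loc_affine1 s z.1 a -> loc_affine (yshear s) z (tri_mx 0 a).
Proof.
move=> [d d0 H]; exists d => // h hd; rewrite /yshear /mact !mxE /= H.
  by congr pair => /=; ring.
exact: le_lt_trans (norm_fst_le h) hd.
Qed.

Lemma tri_mx_bound a b C : `|a| <= C -> `|b| <= C -> forall i j, `|tri_mx a b i j| <= 1 + C.
Proof.
move=> aC bC i j; have C0 : 0 <= C by exact: le_trans aC.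
by rewrite mxE; case: ifP => _; case: ifP => _; rewrite ?normr1; lra.
Qed.

Lemma xshear_area_map C s : pw_affine C s -> area_map (1 + C) (xshear s).
Proof.
move=> [sl [K [mK K0 aK]]]; have cs := lipschitz_continuous sl; split.
- exact: measurable_xshear.
- by move=> A mA; exact: leb2_xshear.
- exists (1 + C) => x y; rewrite prod_normE ge_max /xshear /= mulrDl mul1r.
  have := norm_fst_le (x - y); have := norm_snd_le (x - y) => /= n2 n1.
  have C0 : 0 <= C by have := sl 0 1; rewrite sub0r normrN normr1 mulr1; exact: le_trans.
  have l2 : C * `|x.2 - y.2| <= C * `|x - y| by rewrite ler_wpM2l.
  apply/andP; split; last by rewrite (le_trans n2)// lerDl mulr_ge0.
  rewrite opprD addrACA (le_trans (ler_normD _ _))// lerD//.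
  exact: le_trans (sl _ _) l2.
- exists (setT `*` K); split.
  + exact: measurableX.
  + by rewrite product_measure1E// [X in (_ * X)%E]K0 mule0.
  + move=> z zK; have [a aC la] : exists2 a, `|a| <= C & loc_affine1 s z.2 a.
      by apply: aK => Kz; apply: zK.
    exists (tri_mx a 0); split; first exact: xshear_loc_affine.
      by rewrite det2 !mxE /= mulr0 subr0 mulr1.
    by apply: tri_mx_bound; rewrite // normr0 (le_trans _ aC).
Qed.

Lemma yshear_area_map C s : pw_affine C s -> area_map (1 + C) (yshear s).
Proof.
move=> [sl [K [mK K0 aK]]]; have cs := lipschitz_continuous sl; split.
- exact: measurable_yshear.
- by move=> A mA; exact: leb2_yshear.
- exists (1 + C) => x y; rewrite prod_normE ge_max /yshear /= mulrDl mul1r.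
  have := norm_fst_le (x - y); have := norm_snd_le (x - y) => /= n2 n1.
  have C0 : 0 <= C by have := sl 0 1; rewrite sub0r normrN normr1 mulr1; exact: le_trans.
  have l2 : C * `|x.1 - y.1| <= C * `|x - y| by rewrite ler_wpM2l.
  apply/andP; split; first by rewrite (le_trans n1)// lerDl mulr_ge0.
  rewrite opprD addrACA (le_trans (ler_normD _ _))// lerD//.
  exact: le_trans (sl _ _) l2.
- exists (K `*` setT); split.
  + exact: measurableX.
  + by rewrite product_measure1E// [X in (X * _)%E]K0 mul0e.
  + move=> z zK; have [a aC la] : exists2 a, `|a| <= C & loc_affine1 s z.1 a.
      by apply: aK => Kz; apply: zK.
    exists (tri_mx 0 a); split; first exact: yshear_loc_affine.
      by rewrite det2 !mxE /= mul0r subr0 mulr1.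
    by apply: tri_mx_bound; rewrite // normr0 (le_trans _ aC).
Qed.

End AreaPreserving.

(** * Piecewise affine profiles and diagonal shears *)

Section Commutator.
Context {R : realType}.
Local Notation T2 := (measurableTypeR R * measurableTypeR R)%type.
Local Notation mu := (@lebesgue_measure R).
Local Notation mu2 := ((@lebesgue_measure R \x @lebesgue_measure R)%E).
Local Notation M2 := 'M[R]_2.

Lemma loc_affine1_itv (s : R -> R) t a l r b : l < t < r ->
  (forall x, l < x < r -> s x = b + a * x) -> loc_affine1 s t a.
Proof.
move=> /andP[lt tr] H; exists (Num.min (t - l) (r - t)); first by rewrite lt_min !subr_gt0 lt.
move=> k; rewrite lt_min => /andP[]; rewrite !ltr_norml => /andP[? ?] /andP[? ?].
by rewrite !H; [ring|lra|lra].
Qed.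

Lemma lebesgue_seq0 (l : seq R) : mu [set` l] = 0%E.
Proof. exact: countable_lebesgue_measure0 (finite_set_countable (finite_seq l)). Qed.

Lemma measurable_seq (l : seq R) : measurable ([set` l] : set R).
Proof.
apply: countable_measurable; first exact: measurable_set1.
exact: (finite_set_countable (finite_seq l)).
Qed.

Lemma pw_affine_seq C (s : R -> R) (l : seq R) :
  (forall x y, `|s x - s y| <= C * `|x - y|) ->
  (forall t, t \notin l -> exists2 a, `|a| <= C & loc_affine1 s t a) -> pw_affine C s.
Proof.
move=> sl H; split => //; exists [set` l]; split.
- exact: measurable_seq.
- exact: lebesgue_seq0.
- by move=> t tl; apply: H; exact/negP.
Qed.

Lemma pw_affineZ C (s : R -> R) c : `|c| <= 1 -> pw_affine C s -> pw_affine C (fun t => c * s t).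
Proof.
move=> c1 [sl [K [mK K0 aK]]]; split.
  by move=> x y; rewrite -mulrBr normrM (le_trans _ (sl x y))// ler_piMl.
exists K; split => // t /aK [a aC [d d0 H]]; exists (c * a).
  by rewrite normrM (le_trans _ aC)// ler_piMl.
by exists d => // k kd; rewrite H//; ring.
Qed.

Lemma pw_affine_id : pw_affine 1 (@idfun R).
Proof.
apply: (@pw_affine_seq _ _ [::]) => [x y|t _]; first by rewrite mul1r.
by exists 1; rewrite ?normr1//; exists 1 => // k _; rewrite mul1r.
Qed.

Definition tent (s dl p0 t : R) : R := s * Num.max 0 (dl - `|t - p0|).

Lemma max0_lip (x y : R) : `|Num.max 0 x - Num.max 0 y| <= `|x - y|.
Proof.
by case: (leP 0 x) => ?; case: (leP 0 y) => ?; rewrite ler_norml; case: (ger0P (x - y)) => ?; lra.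
Qed.

Lemma tent_pw_affine s dl p0 : 0 < s -> 0 < dl -> pw_affine s (tent s dl p0).
Proof.
move=> s0 dl0; apply: (@pw_affine_seq _ _ [:: p0 - dl; p0; p0 + dl]).
  move=> x y; rewrite -mulrBr normrM gtr0_norm// ler_wpM2l ?(ltW s0)//.
  apply: le_trans (max0_lip _ _) _.
  rewrite (_ : _ - _ = `|y - p0| - `|x - p0|); last by ring.
  apply: le_trans (ler_dist_dist _ _) _.
  by rewrite opprB addrA subrK distrC.
move=> t; rewrite !inE !negb_or => /and3P[t1 t2 t3].
have [a|b|/eqP] := ltgtP t (p0 - dl); last by rewrite (negbTE t1).
  exists 0; first by rewrite normr0 ltW.
  apply: (@loc_affine1_itv _ _ _ (t - 1) (p0 - dl) 0); first by apply/andP; split; lra.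
  by move=> x /andP[_ xl]; rewrite /tent ltr0_norm ?max_l; lra.
have [c|c|/eqP] := ltgtP t p0; last by rewrite (negbTE t2).
  exists s; first by rewrite gtr0_norm.
  apply: (@loc_affine1_itv _ _ _ (p0 - dl) p0 (s * (dl - p0))); first by rewrite b c.
  by move=> x /andP[? xl]; rewrite /tent ltr0_norm ?max_r; try lra; ring.
have [e|e|/eqP] := ltgtP t (p0 + dl); last by rewrite (negbTE t3).
  exists (- s); first by rewrite normrN gtr0_norm.
  apply: (@loc_affine1_itv _ _ _ p0 (p0 + dl) (s * (dl + p0))); first by rewrite c e.
  by move=> x /andP[? xl]; rewrite /tent gtr0_norm ?max_r; try lra; ring.
exists 0; first by rewrite normr0 ltW.
apply: (@loc_affine1_itv _ _ _ (p0 + dl) (t + 1) 0); first by apply/andP; split; lra.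
by move=> x /andP[xl _]; rewrite /tent gtr0_norm ?max_l; lra.
Qed.

Lemma tent_ge0 s dl p0 t : 0 < s -> 0 <= tent s dl p0 t.
Proof. by move=> s0; rewrite mulr_ge0 ?(ltW s0)// le_max lexx. Qed.

Lemma tent_le s dl p0 t : 0 < s -> 0 < dl -> tent s dl p0 t <= s * dl.
Proof.
move=> s0 dl0; rewrite ler_wpM2l ?(ltW s0)// ge_max (ltW dl0) /=.
by have := normr_ge0 (t - p0); lra.
Qed.

Lemma tent_eq0 s dl p0 t : dl <= `|t - p0| -> tent s dl p0 t = 0.
Proof. by move=> H; rewrite /tent max_l ?mulr0//; lra. Qed.

(** A trapezoid with slopes 1 and -1 and a plateau around [1/2]. Its height [3 * dl] exceeds the
    width [2 * dl] of a tent, so translation by it separates a tent from its copy. *)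
Definition trap (dl t : R) : R := Num.min (3 * dl) (Num.max 0 (8^-1 + 3 * dl - `|t - 2^-1|)).

Lemma trap_top dl t : 0 < dl -> `|t - 2^-1| <= 8^-1 -> trap dl t = 3 * dl.
Proof. by move=> d0 H; rewrite /trap min_l// le_max; apply/orP; right; lra. Qed.

Lemma trap_eq0 dl t : 0 < dl -> 8^-1 + 3 * dl <= `|t - 2^-1| -> trap dl t = 0.
Proof. by move=> d0 H; rewrite /trap (@max_l _ _ 0) ?min_r//; lra. Qed.

Lemma trap_side dl t : 0 < dl -> 8^-1 <= `|t - 2^-1| <= 8^-1 + 3 * dl ->
  trap dl t = 8^-1 + 3 * dl - `|t - 2^-1|.
Proof. by move=> d0 /andP[? ?]; rewrite /trap (@max_r _ _ 0) ?min_r//; lra. Qed.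

Lemma trap_range dl t : 0 < dl -> 0 <= trap dl t <= 3 * dl.
Proof.
move=> d0; rewrite /trap ge_min lexx /= andbT le_min le_max lexx andbT; lra.
Qed.

Lemma min_lip (c x y : R) : `|Num.min c x - Num.min c y| <= `|x - y|.
Proof.
by case: (leP c x) => ?; case: (leP c y) => ?; rewrite ler_norml; case: (ger0P (x - y)) => ?; lra.
Qed.

Lemma trap_pw_affine dl : 0 < dl -> pw_affine 1 (trap dl).
Proof.
move=> dl0; pose a : R := 2^-1 - 8^-1 - 3 * dl; pose b : R := 2^-1 - 8^-1.
pose c : R := 2^-1 + 8^-1; pose e : R := 2^-1 + 8^-1 + 3 * dl.
apply: (@pw_affine_seq _ _ [:: a; b; c; e]).
  move=> x y; rewrite mul1r; apply: le_trans (min_lip _ _ _) _.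
  apply: le_trans (max0_lip _ _) _.
  rewrite (_ : _ - _ = `|y - 2^-1| - `|x - 2^-1|); last by ring.
  apply: le_trans (ler_dist_dist _ _) _.
  by rewrite opprB addrA subrK distrC.
move=> t; rewrite !inE !negb_or => /and4P[t1 t2 t3 t4].
have [h|h1|/eqP] := ltgtP t a; last by rewrite (negbTE t1).
  exists 0; first by rewrite normr0.
  apply: (@loc_affine1_itv _ _ _ (t - 1) a 0); first by apply/andP; split; lra.
  by move=> x /andP[_ xl]; rewrite mul0r addr0 trap_eq0// ltr0_norm; rewrite /a in xl *; lra.
have [h|h2|/eqP] := ltgtP t b; last by rewrite (negbTE t2).
  exists 1; first by rewrite normr1.
  apply: (@loc_affine1_itv _ _ _ a b (- a)); first by rewrite h1 h.
  by move=> x /andP[xl xr]; rewrite trap_side// ltr0_norm; rewrite /a /b in xl xr *; lra.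
have [h|h3|/eqP] := ltgtP t c; last by rewrite (negbTE t3).
  exists 0; first by rewrite normr0.
  apply: (@loc_affine1_itv _ _ _ b c (3 * dl)); first by rewrite h2 h.
  by move=> x /andP[xl xr]; rewrite mul0r addr0 trap_top// ler_norml; rewrite /b /c in xl xr *; lra.
have [h|h4|/eqP] := ltgtP t e; last by rewrite (negbTE t4).
  exists (- 1); first by rewrite normrN normr1.
  apply: (@loc_affine1_itv _ _ _ c e e); first by rewrite h3 h.
  by move=> x /andP[xl xr]; rewrite trap_side// gtr0_norm; rewrite /c /e in xl xr *; lra.
exists 0; first by rewrite normr0.
apply: (@loc_affine1_itv _ _ _ e (t + 1) 0); first by apply/andP; split; lra.
by move=> x /andP[xl _]; rewrite mul0r addr0 trap_eq0// gtr0_norm; rewrite /e in xl *; lra.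
Qed.

(** The shear along [(1, -sg)] by [S (z.1 + sg * z.2)], written as a vertical shear conjugated by
    linear horizontal ones, so that it preserves area. Where [S] has slope [a] its gradient is
    [shm sg a]. *)
Definition pshear (sg : R) (S : R -> R) : R * R -> R * R :=
  xshear (fun t => - sg * t) \o (yshear (fun t => - sg * S t) \o xshear (fun t => sg * t)).

Lemma pshearE sg S z : sg ^+ 2 = 1 ->
  pshear sg S z = (z.1 + S (z.1 + sg * z.2), z.2 - sg * S (z.1 + sg * z.2)).
Proof.
move=> s2; rewrite /pshear /xshear /yshear /=; congr pair; last by rewrite mulNr.
transitivity (z.1 + sg ^+ 2 * S (z.1 + sg * z.2)); first by ring.
by rewrite s2 mul1r.
Qed.

Lemma pshear_area_map sg S C : sg ^+ 2 = 1 -> pw_affine C S ->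
  area_map (2 * ((1 + 1) * (2 * ((1 + C) * (1 + 1))))) (pshear sg S).
Proof.
move=> s2 hS.
have n1 : `|sg| <= 1.
  have : `|sg| ^+ 2 = 1 by rewrite -normrX s2 normr1.
  by move/eqP; rewrite sqrp_eq1// => /eqP ->.
have nN : `|- sg| <= 1 by rewrite normrN.
apply: area_map_comp; first exact: xshear_area_map (pw_affineZ nN pw_affine_id).
apply: area_map_comp; first exact: yshear_area_map (pw_affineZ nN hS).
exact: xshear_area_map (pw_affineZ n1 pw_affine_id).
Qed.

Lemma sign_norm (sg : R) : sg ^+ 2 = 1 -> `|sg| = 1.
Proof.
move=> s2; have : `|sg| ^+ 2 = 1 by rewrite -normrX s2 normr1.
by move/eqP; rewrite sqrp_eq1// => /eqP.
Qed.

Lemma pcoord_le (sg : R) h : sg ^+ 2 = 1 -> `|h.1 + sg * h.2| <= 2 * `|h|.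
Proof.
move=> /sign_norm s1; rewrite (le_trans (ler_normD _ _))// normrM s1 mul1r mulr_natl mulr2n.
by apply: lerD; [exact: norm_fst_le|exact: norm_snd_le].
Qed.

Lemma pshear_loc_affine sg S z a : sg ^+ 2 = 1 -> loc_affine1 S (z.1 + sg * z.2) a ->
  loc_affine (pshear sg S) z (shm sg a).
Proof.
move=> s2 [d d0 H]; exists (d / 2); first by rewrite divr_gt0.
move=> h hd; rewrite !pshearE// /mact !mxE /=.
have -> : z.1 + h.1 + sg * (z.2 + h.2) = z.1 + sg * z.2 + (h.1 + sg * h.2) by ring.
rewrite H; last by have := pcoord_le h s2; lra.
congr pair => /=; first by ring.
transitivity (z.2 - sg * S (z.1 + sg * z.2) + (- (sg * a) * h.1 + (1 - sg ^+ 2 * a) * h.2)).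
  by ring.
by rewrite s2 mul1r.
Qed.

End Commutator.

(** * An area-preserving commutator supported in the square *)

Section Lamination.
Context {R : realType}.
Local Notation T2 := (measurableTypeR R * measurableTypeR R)%type.
Local Notation mu := (@lebesgue_measure R).
Local Notation mu2 := ((@lebesgue_measure R \x @lebesgue_measure R)%E).
Local Notation M2 := 'M[R]_2.

Section commutator.
Variables (sg s dl : R).
Hypotheses (s2 : sg ^+ 2 = 1) (s0 : 0 < s) (dl0 : 0 < dl) (dls : (8 + s) * dl <= 16^-1).

(** The value of [pc] at the centre [(1/2, 1/2)] of the square, so that the strip runs through
    it. *)
Let p0 : R := 2^-1 + sg / 2.
Let S := tent s dl p0.
Let T := trap dl.

(* The commutator of a shear [pshear sg S] along the direction [(1, -sg)], depending on [pc], and of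
   a horizontal shear. It is the identity away from the strip where [S] and its translate by the
   plateau value [3 dl] of [T] live. On the plateau it is a shear along [(1, -sg)] with slopes [s],
   [- s] in equal proportion; the rest of the strip has an area of order [dl ^+ 2] only. *)
Definition commutator_map : R * R -> R * R :=
  pshear sg S \o (xshear (fun t => -1 * T t) \o (pshear sg (fun t => -1 * S t) \o xshear T)).

(* A bound of the entries of the gradient that does not depend on [dl]. *)
Definition map_bound : R :=
  2 * (2 * ((1 + 1) * (2 * ((1 + s) * (1 + 1)))) *
    (2 * ((1 + 1) * (2 * (2 * ((1 + 1) * (2 * ((1 + s) * (1 + 1)))) * (1 + 1)))))).

Lemma commutator_area_map : area_map map_bound commutator_map.
Proof.
have hS := tent_pw_affine p0 s0 dl0; have hT := trap_pw_affine dl0.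
have n1 : `|-1 : R| <= 1 by rewrite normrN normr1.
apply: area_map_comp; first exact: pshear_area_map.
apply: area_map_comp; first exact: xshear_area_map (pw_affineZ n1 hT).
apply: area_map_comp; last exact: xshear_area_map.
exact: pshear_area_map s2 (pw_affineZ n1 hS).
Qed.

Definition pc (z : R * R) : R := z.1 + sg * z.2.

(** In the coordinates [(pc z, z.2)] each factor changes one coordinate only: horizontal shears
    change [pc], diagonal shears change [z.2]. *)
Lemma commutatorE z : let q := pc z + T z.2 in let r1 := z.2 + sg * S q in
  let p2 := q - T r1 in let r2 := r1 - sg * S p2 in
  commutator_map z = (p2 - sg * r2, r2).
Proof.
rewrite -[commutator_map z]/(pshear sg S (xshear (fun t => -1 * T t)
  (pshear sg (fun t => -1 * S t) (xshear T z)))).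
rewrite (pshearE (fun t => -1 * S t) _ s2) (pshearE S _ s2) /xshear /pc /=.
set q := z.1 + T z.2 + sg * z.2.
have -> : z.1 + sg * z.2 + T z.2 = q by rewrite /q; ring.
have e1 : z.2 - sg * (-1 * S q) = z.2 + sg * S q by ring.
rewrite !e1; set r1 := z.2 + sg * S q.
have e2 : z.1 + T z.2 + -1 * S q + -1 * T r1 + sg * r1 = q - T r1.
  transitivity (z.1 + T z.2 - S q - T r1 + sg * z.2 + sg ^+ 2 * S q); first by rewrite /r1; ring.
  by rewrite s2 /q; ring.
rewrite e2; congr pair.
transitivity (z.1 + T z.2 + -1 * S q + -1 * T r1 + sg * r1 + S (q - T r1) - sg * r1); first by ring.
rewrite e2; transitivity (q - T r1 - sg * r1 + sg ^+ 2 * S (q - T r1)); last by ring.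
by rewrite s2; ring.
Qed.

(** [T] takes values between 0 and [3 * dl], so [S] vanishes both at [pc z] and at [pc z + T z.2];
    the diagonal shears act trivially and the horizontal ones cancel. *)
Lemma commutator_id_strip z : pc z + 4 * dl <= p0 \/ p0 + dl <= pc z -> commutator_map z = z.
Proof.
move=> H.
have Tr := trap_range z.2 dl0; rewrite -/T in Tr; move/andP: Tr => [T0 T1].
have Sq : S (pc z + T z.2) = 0.
  by apply: tent_eq0; case: H => H; [rewrite ler0_norm|rewrite ger0_norm]; lra.
have Sp : S (pc z) = 0.
  by apply: tent_eq0; case: H => H; [rewrite ler0_norm|rewrite ger0_norm]; lra.
rewrite commutatorE /= Sq !mulr0 !addr0 addrK Sp mulr0 subr0 /pc addrK.
by case: z {H T0 T1 Sq Sp}.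
Qed.

Lemma sgS_norm t : `|sg * S t| <= s * dl.
Proof.
rewrite normrM sign_norm// mul1r ger0_norm; [exact: tent_le|exact: tent_ge0].
Qed.

(** The diagonal shear moves [z.2] by at most [s * dl], so [T] vanishes before and after it; the
    horizontal shears act trivially and the diagonal ones cancel. *)
Lemma commutator_id_end z : 8^-1 + 3 * dl + s * dl <= `|z.2 - 2^-1| -> commutator_map z = z.
Proof.
move=> H.
have sd0 : 0 < s * dl by rewrite mulr_gt0.
have Tz : T z.2 = 0 by apply: trap_eq0 => //; lra.
have Tr t : T (z.2 + sg * S t) = 0.
  apply: trap_eq0 => //; have := sgS_norm t.
  have : `|z.2 - 2^-1| <= `|z.2 + sg * S t - 2^-1| + `|sg * S t|.
    rewrite (_ : z.2 - 2^-1 = (z.2 + sg * S t - 2^-1) - sg * S t); last by ring.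
    exact: ler_normB.
  lra.
rewrite commutatorE /= Tz addr0 Tr subr0 addrK /pc addrK.
by case: z {H Tz Tr}.
Qed.

Definition profile t := S t - S (t + 3 * dl).

(** On the plateau the horizontal shears are translations by [3 * dl], and conjugation by them
    translates the profile of the diagonal shear. *)
Lemma commutator_middle z : `|z.2 - 2^-1| <= 8^-1 - s * dl ->
  commutator_map z = pshear sg profile z.
Proof.
move=> H; have sd0 : 0 < s * dl by rewrite mulr_gt0.
have Tz : T z.2 = 3 * dl by apply: trap_top => //; lra.
have Tr t : T (z.2 + sg * S t) = 3 * dl.
  apply: trap_top => //; have := sgS_norm t.
  have : `|z.2 + sg * S t - 2^-1| <= `|z.2 - 2^-1| + `|sg * S t|.
    rewrite (_ : z.2 + sg * S t - 2^-1 = (z.2 - 2^-1) + sg * S t); last by ring.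
    exact: ler_normD.
  lra.
rewrite commutatorE /= Tz Tr addrK pshearE// -/(pc z) /profile; congr pair; last by ring.
transitivity (pc z - sg * z.2 + sg ^+ 2 * (S (pc z) - S (pc z + 3 * dl))); first by ring.
by rewrite s2 /pc; ring.
Qed.

(** The first coordinate differs from [1/2] by at most [1/8 + 7 dl + s dl], and the smallness of
    [dl] bounds this by [3/16]. *)
Lemma core_square z : p0 - 4 * dl <= pc z <= p0 + dl ->
  `|z.2 - 2^-1| <= 8^-1 + 3 * dl + s * dl -> square z.
Proof.
move=> /andP[p1 p2]; rewrite ler_norml => /andP[r1 r2].
have sd0 : 0 < s * dl by rewrite mulr_gt0.
have /orP sg1 : (sg == 1) || (sg == -1) by rewrite -sqrf_eq1 s2.
have dls' : 8 * dl + s * dl <= 16^-1 by rewrite -mulrDl.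
move: p1 p2 r1 r2 dls'; rewrite /pc /p0 /square /=; move: (s * dl) sd0 => u.
case: z => x y /=; by case: sg1 => /eqP -> u0 p1 p2 r1 r2 dls'; split; apply/andP; split; lra.
Qed.

Lemma commutator_outside z : ~ square z -> commutator_map z = z.
Proof.
move=> nz; have [H|H] := leP (8^-1 + 3 * dl + s * dl) `|z.2 - 2^-1|.
  exact: commutator_id_end.
apply: commutator_id_strip; apply: contrapT => /not_orP[/negP]; rewrite -ltNge => p1 /negP.
by rewrite -ltNge => p2; apply: nz; apply: core_square; [apply/andP; split|]; lra.
Qed.

Lemma nbhd_pc z l r : l < pc z < r -> exists2 d, 0 < d & forall h : R * R, `|h| < d -> l < pc (z + h) < r.
Proof.
move=> /andP[lz zr]; exists (Num.min (pc z - l) (r - pc z) / 2).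
  by rewrite divr_gt0// lt_min !subr_gt0 lz.
move=> h; rewrite ltr_pdivlMr// lt_min => /andP[h1 h2].
have := pcoord_le h s2; rewrite ler_norml => /andP[a b].
have -> : pc (z + h) = pc z + (h.1 + sg * h.2) by rewrite /pc /=; ring.
by apply/andP; split; lra.
Qed.

Lemma nbhd_snd z (c : R) : `|z.2 - 2^-1| < c ->
  exists2 d, 0 < d & forall h : R * R, `|h| < d -> `|(z + h).2 - 2^-1| <= c.
Proof.
move=> H; exists (c - `|z.2 - 2^-1|); first by rewrite subr_gt0.
move=> h hd; have := norm_snd_le h; have := ler_normD (z.2 - 2^-1) h.2.
by rewrite (_ : (z + h).2 - 2^-1 = z.2 - 2^-1 + h.2) /=; [lra|ring].
Qed.

Lemma nbhd_snd_out z (c : R) : c < `|z.2 - 2^-1| ->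
  exists2 d, 0 < d & forall h : R * R, `|h| < d -> c <= `|(z + h).2 - 2^-1|.
Proof.
move=> H; exists (`|z.2 - 2^-1| - c); first by rewrite subr_gt0.
move=> h hd; have := norm_snd_le h; have := ler_normB (z.2 - 2^-1 + h.2) h.2.
rewrite addrK (_ : (z + h).2 - 2^-1 = z.2 - 2^-1 + h.2) /=; last by ring.
lra.
Qed.

Lemma loc_affine_id z : loc_affine id z (shm sg 0).
Proof.
exists 1 => // h _; rewrite shm0 /mact !mxE /= !mul1r !mul0r addr0 add0r.
by case: z; case: h.
Qed.

Lemma commutator_shear z a : `|z.2 - 2^-1| < 8^-1 - s * dl ->
  loc_affine1 profile (pc z) a -> loc_affine commutator_map z (shm sg a).
Proof.
move=> /nbhd_snd [d d0 H] la; apply: (loc_affine_near d0); last exact: pshear_loc_affine s2 la.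
by move=> h hd; rewrite commutator_middle//; exact: H.
Qed.

Lemma commutator_fixed z : pc z < p0 - 4 * dl \/ p0 + dl < pc z \/ 8^-1 + 3 * dl + s * dl < `|z.2 - 2^-1| ->
  loc_affine commutator_map z (shm sg 0).
Proof.
case=> [H|[H|/nbhd_snd_out [d d0 H]]].
- have /nbhd_pc [d d0 Hd] : pc z - 1 < pc z < p0 - 4 * dl by rewrite H andbT; lra.
  apply: (loc_affine_near d0); last exact: loc_affine_id.
  by move=> h /Hd /andP[_ hd]; rewrite commutator_id_strip//; left; lra.
- have /nbhd_pc [d d0 Hd] : p0 + dl < pc z < pc z + 1 by rewrite H /=; lra.
  apply: (loc_affine_near d0); last exact: loc_affine_id.
  by move=> h /Hd /andP[hd _]; rewrite commutator_id_strip//; right; lra.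
- apply: (loc_affine_near d0); last exact: loc_affine_id.
  by move=> h hd; rewrite commutator_id_end//; exact: H.
Qed.

Let tent_val t : S t = if `|t - p0| <= dl then s * (dl - `|t - p0|) else 0.
Proof.
case: ifPn => [H|]; first by rewrite /S /tent max_r// subr_ge0.
by rewrite -ltNge => H; rewrite /S tent_eq0// ltW.
Qed.

Lemma profile_affine t :
  [/\ p0 - dl < t < p0 \/ p0 - 3 * dl < t < p0 - 2 * dl -> loc_affine1 profile t s,
      p0 < t < p0 + dl \/ p0 - 4 * dl < t < p0 - 3 * dl -> loc_affine1 profile t (- s) &
      p0 - 2 * dl < t < p0 - dl -> loc_affine1 profile t 0].
Proof.
have Z x : dl <= `|x - p0| -> S x = 0 := @tent_eq0 _ s dl p0 x.
have L x : p0 - dl <= x <= p0 -> S x = s * (x - p0 + dl).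
  by move=> /andP[a b]; rewrite tent_val ler0_norm ?ifT; [ring|lra|lra].
have Rr x : p0 <= x <= p0 + dl -> S x = s * (p0 + dl - x).
  by move=> /andP[a b]; rewrite tent_val ger0_norm ?ifT; [ring|lra|lra].
split.
- case=> H.
  + apply: (@loc_affine1_itv _ _ _ _ _ _ (s * (dl - p0)) H) => x /andP[a b].
    by rewrite /profile L ?Z ?ger0_norm; [ring|lra|lra|lra].
  + apply: (@loc_affine1_itv _ _ _ _ _ _ (s * (2 * dl - p0)) H) => x /andP[a b].
    by rewrite /profile Z ?Rr ?ler0_norm; [ring|lra|lra|lra].
- case=> H.
  + apply: (@loc_affine1_itv _ _ _ _ _ _ (s * (dl + p0)) H) => x /andP[a b].
    by rewrite /profile Rr ?Z ?ger0_norm; [ring|lra|lra|lra].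
  + apply: (@loc_affine1_itv _ _ _ _ _ _ (s * (p0 - 4 * dl)) H) => x /andP[a b].
    by rewrite /profile Z ?L ?ler0_norm; [ring|lra|lra|lra].
- move=> H; apply: (@loc_affine1_itv _ _ _ _ _ _ 0 H) => x /andP[a b].
  have z1 : S x = 0 by apply: Z; rewrite ler0_norm; lra.
  have z2 : S (x + 3 * dl) = 0 by apply: Z; rewrite ger0_norm; lra.
  by rewrite /profile z1 z2; ring.
Qed.

End commutator.

Lemma pc_measure sg (P J : set R) : measurable P -> measurable J ->
  measurable ([set z | P (pc sg z) /\ J z.2] : set T2) /\
  mu2 [set z | P (pc sg z) /\ J z.2] = (mu P * mu J)%E.
Proof.
move=> mP mJ.
have cs : continuous (fun t : R => sg * t).
  by move=> t; apply: cvgM; [exact: cvg_cst|exact: cvg_id].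
have mPJ : measurable (P `*` J : set T2) by exact: measurableX.
have E : [set z | P (pc sg z) /\ J z.2] = xshear (fun t : R => sg * t) @^-1` (P `*` J) by [].
rewrite E; split.
  by rewrite -[X in measurable X]setTI; exact: (measurable_xshear cs).
by rewrite (leb2_xshear cs mPJ) -product_measure1E.
Qed.

End Lamination.

(** * A step function dominating the test integrand *)

Section StepFunctions.
Context {R : realType}.
Local Notation T2 := (measurableTypeR R * measurableTypeR R)%type.
Local Notation mu := (@lebesgue_measure R).
Local Notation mu2 := ((@lebesgue_measure R \x @lebesgue_measure R)%E).
Local Notation M2 := 'M[R]_2.

Definition has_mean (k : T2 -> R) (I : R) :=
  mu2.-integrable (@square R) (EFin \o k) /\ (\int[mu2]_(z in @square R) (k z)%:E)%E = I%:E.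

Lemma has_mean_cst (e : R) : has_mean (fun=> e) e.
Proof.
have mS := @measurable_square R; split.
  apply: measurable_bounded_integrable => //.
    by rewrite [X in (X < _)%E]square_measure ltry.
  exists `|e|; split; first exact: num_real.
  by move=> M eM z _; exact: ltW.
by rewrite integral_cst// [X in (_ * X)%E]square_measure mule1.
Qed.

Lemma has_meanD_indic (k : T2 -> R) (I c m : R) (A : set T2) : has_mean k I ->
  measurable A -> A `<=` @square R -> mu2 A = m%:E ->
  has_mean (fun z => k z + c * \1_A z) (I + c * m).
Proof.
move=> [ik Ik] mA As Am; have mS := @measurable_square R.
have iA : mu2.-integrable (@square R) (EFin \o \1_A).
  apply: measurable_bounded_integrable => //.
    by rewrite [X in (X < _)%E]square_measure ltry.
  exists 1; split; first exact: num_real.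
  by move=> M M1 z _; rewrite /= indicE ger0_norm// (le_trans _ (ltW M1))// lern1 leq_b1.
have iZ := integrable_EFinZ c mS iA; split; first exact: integrable_EFinD.
rewrite (integralD_EFin mS ik iZ) Ik EFinD; congr (_ + _)%E.
transitivity (\int[mu2]_(z in @square R) (c%:E * (\1_A z)%:E))%E; first exact: eq_integral.
rewrite integralZl// integral_indic//.
by rewrite (_ : A `&` _ = A) ?[X in (_ * X)%E]Am//; exact/setIidl.
Qed.

Definition slab sg (l r a b : R) : set T2 := [set z | `[l, r]%classic (pc sg z) /\ `[a, b]%classic z.2].

Lemma slab_measure sg l r a b : l <= r -> a <= b ->
  measurable (slab sg l r a b) /\ mu2 (slab sg l r a b) = ((r - l) * (b - a))%:E.
Proof.
move=> lr ab.
have len (u v : R) : u <= v -> mu `[u, v]%classic = (v - u)%:E.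
  move=> uv; rewrite lebesgue_measure_itv /= lte_fin.
  by case: ltgtP uv => // -> _; rewrite subrr.
have [mA ->] := pc_measure sg (measurable_itv `[l, r]) (measurable_itv `[a, b]).
by split => //; rewrite !len.
Qed.

Lemma slab_in sg l r a b (z : R * R) : [/\ l <= pc sg z, pc sg z <= r, a <= z.2 & z.2 <= b] ->
  \1_(slab sg l r a b) z = 1 :> R.
Proof.
by move=> [? ? ? ?]; rewrite indicE mem_set//; split; rewrite /= in_itv /=; apply/andP.
Qed.

Lemma slab_out sg l r a b (z : R * R) : ~ [/\ l <= pc sg z, pc sg z <= r, a <= z.2 & z.2 <= b] ->
  \1_(slab sg l r a b) z = 0 :> R.
Proof.
by move=> H; rewrite indicE memNset// => -[] /=; rewrite !in_itv /= => /andP[? ?] /andP[? ?]; apply: H.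
Qed.

Section step_function.
Variables (sg p0 dl y1 y2 y3 y4 G A B E : R).
Hypotheses (dl0 : 0 < dl) (y12 : y1 < y2) (y23 : y2 < y3) (y34 : y3 < y4).

(** [A] and [B] are the values where the commutator has slope [s] and [- s], [G] the value where it
    is the identity, and [E] the excess allowed on the two end pieces of the strip. The closed slabs
    overlap only in edges, which are null. *)
Definition step_fun (z : T2) : R := G
  + (A - G) * \1_(slab sg (p0 - dl) p0 y2 y3) z
  + (A - G) * \1_(slab sg (p0 - 3 * dl) (p0 - 2 * dl) y2 y3) z
  + (B - G) * \1_(slab sg p0 (p0 + dl) y2 y3) z
  + (B - G) * \1_(slab sg (p0 - 4 * dl) (p0 - 3 * dl) y2 y3) z
  + E * \1_(slab sg (p0 - 4 * dl) (p0 + dl) y1 y2) z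
  + E * \1_(slab sg (p0 - 4 * dl) (p0 + dl) y3 y4) z.

Lemma step_fun_mean :
  (forall z, p0 - 4 * dl <= pc sg z <= p0 + dl -> y1 <= z.2 <= y4 -> square z) ->
  has_mean step_fun (G + 2 * dl * (y3 - y2) * (A + B - 2 * G)
    + 5 * dl * (y2 - y1 + (y4 - y3)) * E).
Proof.
move: dl0 y12 y23 y34 => d0 l12 l23 l34 sub.
have step k' I c l r a b : p0 - 4 * dl <= l -> l <= r -> r <= p0 + dl -> y1 <= a -> a <= b ->
    b <= y4 -> has_mean k' I ->
    has_mean (fun z => k' z + c * \1_(slab sg l r a b) z) (I + c * ((r - l) * (b - a))).
  move=> h1 h2 h3 h4 h5 h6 hk; have [mA Am] := slab_measure sg h2 h5.
  apply: has_meanD_indic => // z [] /=; rewrite !in_itv /= => /andP[a1 a2] /andP[a3 a4].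
  by apply: sub; apply/andP; split; lra.
rewrite [X in has_mean _ X](_ : _ = G
  + (A - G) * ((p0 - (p0 - dl)) * (y3 - y2))
  + (A - G) * ((p0 - 2 * dl - (p0 - 3 * dl)) * (y3 - y2))
  + (B - G) * ((p0 + dl - p0) * (y3 - y2))
  + (B - G) * ((p0 - 3 * dl - (p0 - 4 * dl)) * (y3 - y2))
  + E * ((p0 + dl - (p0 - 4 * dl)) * (y2 - y1))
  + E * ((p0 + dl - (p0 - 4 * dl)) * (y4 - y3))); last by ring.
by do 6! (apply: (step); [lra|lra|lra|lra|lra|lra|]); exact: has_mean_cst.
Qed.

(** The indicators are abstracted to [chi], so that the case analysis concerns only the positions of
    two real numbers among break points. *)
Let cases_aux (P : R -> Prop) (chi : R -> R -> R -> R -> R) (q y : R) :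
  (forall l r a b, [/\ l < q < r -> a < y < b -> chi l r a b = 1, y < a -> chi l r a b = 0,
    b < y -> chi l r a b = 0, q < l -> chi l r a b = 0 & r < q -> chi l r a b = 0]) ->
  q \notin [:: p0 - 4 * dl; p0 - 3 * dl; p0 - 2 * dl; p0 - dl; p0; p0 + dl] ->
  y \notin [:: y1; y2; y3; y4] ->
  ([\/ y < y1, y4 < y, q < p0 - 4 * dl | p0 + dl < q] -> P G) ->
  P (G + E) ->
  (y2 < y -> y < y3 ->
    [/\ p0 - dl < q < p0 \/ p0 - 3 * dl < q < p0 - 2 * dl -> P A,
        p0 < q < p0 + dl \/ p0 - 4 * dl < q < p0 - 3 * dl -> P B &
        p0 - 2 * dl < q < p0 - dl -> P G]) ->
  P (G + (A - G) * chi (p0 - dl) p0 y2 y3 + (A - G) * chi (p0 - 3 * dl) (p0 - 2 * dl) y2 y3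
    + (B - G) * chi p0 (p0 + dl) y2 y3 + (B - G) * chi (p0 - 4 * dl) (p0 - 3 * dl) y2 y3
    + E * chi (p0 - 4 * dl) (p0 + dl) y1 y2 + E * chi (p0 - 4 * dl) (p0 + dl) y3 y4).
Proof.
move=> chiP; move: dl0 y12 y23 y34 => d0 l12 l23 l34.
have on l r a b (lr : l < q < r) (ab : a < y < b) : chi l r a b = 1.
  by have [-> //] := chiP l r a b.
have offd l r a b (H : y < a) : chi l r a b = 0 by have [_ ->] := chiP l r a b.
have offu l r a b (H : b < y) : chi l r a b = 0 by have [_ _ ->] := chiP l r a b.
have offl l r a b (H : q < l) : chi l r a b = 0 by have [_ _ _ ->] := chiP l r a b.
have offr l r a b (H : r < q) : chi l r a b = 0 by have [_ _ _ _ ->] := chiP l r a b.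
rewrite !inE !negb_or !neq_lt.
move=> /and5P[q4 q3 q2 q1 /andP[q0 qm1]] /and4P[n1 n2 n3 n4] HG HE Hm; clear chiP.
case/orP: n1 => h1.
  by rewrite !offd ?mulr0 ?addr0; [apply: HG; exact: Or41|lra..].
case/orP: n4 => h4; last first.
  by rewrite !offu ?mulr0 ?addr0; [apply: HG; exact: Or42|lra..].
case/orP: q4 => h5.
  by rewrite !offl ?mulr0 ?addr0; [apply: HG; exact: Or43|lra..].
case/orP: qm1 => h6; last first.
  by rewrite !offr ?mulr0 ?addr0; [apply: HG; exact: Or44|lra..].
case/orP: n2 => h2.
  rewrite (on _ _ y1 y2) ?h1 ?h5// !offd ?mulr0 ?mulr1 ?addr0//; lra.
case/orP: n3 => h3; last first.
  rewrite (on _ _ y3 y4) ?h3 ?h5// !offu ?mulr0 ?mulr1 ?addr0//; lra.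
have [HA HB H0] := Hm h2 h3.
rewrite (offu _ _ y1 y2)// (offd _ _ y3 y4)// !(mulr0, addr0).
have y23' : y2 < y < y3 by rewrite h2.
case/orP: q3 => h7.
  rewrite (on (p0 - 4 * dl) (p0 - 3 * dl)) ?h5// !offl; [|lra..].
  by rewrite !(mulr0, mulr1, addr0) subrKC; apply: HB; right; rewrite h5.
rewrite (offr (p0 - 4 * dl))// mulr0 addr0.
case/orP: q2 => h8.
  rewrite (on (p0 - 3 * dl) (p0 - 2 * dl)) ?h7// !offl; [|lra..].
  by rewrite !(mulr0, mulr1, addr0) subrKC; apply: HA; right; rewrite h7.
rewrite (offr (p0 - 3 * dl))// mulr0 addr0.
case/orP: q1 => h9.
  rewrite !offl; [|lra..].
  by rewrite !(mulr0, addr0); apply: H0; rewrite h8.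
case/orP: q0 => h10.
  rewrite (on (p0 - dl) p0) ?h9// offl//.
  by rewrite !(mulr0, mulr1, addr0) subrKC; apply: HA; left; rewrite h9.
rewrite (on p0) ?h10// offr//.
by rewrite !(mulr0, mulr1, addr0) subrKC; apply: HB; left; rewrite h10.
Qed.

Lemma step_fun_cases (P : R -> Prop) (z : R * R) :
  pc sg z \notin [:: p0 - 4 * dl; p0 - 3 * dl; p0 - 2 * dl; p0 - dl; p0; p0 + dl] ->
  z.2 \notin [:: y1; y2; y3; y4] ->
  ([\/ z.2 < y1, y4 < z.2, pc sg z < p0 - 4 * dl | p0 + dl < pc sg z] -> P G) ->
  P (G + E) ->
  (y2 < z.2 -> z.2 < y3 ->
    [/\ p0 - dl < pc sg z < p0 \/ p0 - 3 * dl < pc sg z < p0 - 2 * dl -> P A,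
        p0 < pc sg z < p0 + dl \/ p0 - 4 * dl < pc sg z < p0 - 3 * dl -> P B &
        p0 - 2 * dl < pc sg z < p0 - dl -> P G]) ->
  P (step_fun z).
Proof.
apply: (cases_aux (chi := fun l r a b => \1_(slab sg l r a b) z)) => l r a b.
split.
- by move=> /andP[? ?] /andP[? ?]; apply: slab_in; split; exact: ltW.
- by move=> H; apply: slab_out => -[_ _ + _]; rewrite leNgt H.
- by move=> H; apply: slab_out => -[_ _ _]; rewrite leNgt H.
- by move=> H; apply: slab_out => -[+ _ _ _]; rewrite leNgt H.
- by move=> H; apply: slab_out => -[_ + _ _]; rewrite leNgt H.
Qed.

End step_function.

End StepFunctions.

(** * Quasiconvex functions below W are laminable *)

Section QuasiconvexLaminable.
Context {R : realType}.
Local Notation T2 := (measurableTypeR R * measurableTypeR R)%type.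
Local Notation mu := (@lebesgue_measure R).
Local Notation mu2 := ((@lebesgue_measure R \x @lebesgue_measure R)%E).
Local Notation M2 := 'M[R]_2.

Lemma loc_affine_fun psi z (M F : M2) : loc_affine psi z M ->
  loc_affine (fun z => mact F (psi z - z)) z (F *m M - F).
Proof.
move=> [d d0 H]; exists d => // h hd; rewrite H// {H} /mact !mxE !sum2 /=.
by case: (psi z) => a b; case: z => x y; case: h {hd} => u v; congr pair => /=; ring.
Qed.

Variables (lam : R) (theta : R -> \bar R) (f : M2 -> \bar R).
Hypotheses (lam1 : 1 < lam) (theta_ge0 : forall t, (0 <= theta t)%E).
Hypotheses (f_noo : forall F, f F != -oo%E) (fq : quasiconvex f)
  (fW : forall F, (f F <= W lam theta F)%E).

(** Dropping the root in [gh] leaves a quadratic bound. It makes [f] finite wherever [theta] is, and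
    controls it on the transition regions. *)
Lemma le_energy F r : theta (\det F) = r%:E ->
  (f F <= (frob2 F + (lam ^+ 2 + lam ^- 2) + r)%:E)%E.
Proof.
move=> rE; apply: le_trans (fW F) _; rewrite (WE theta lam1) gfunE rE -EFinD lee_fin.
have : 0 <= Num.sqrt (Ah lam (xF F ^+ 2) (yF F ^+ 2) (\det F)) by exact: sqrtr_ge0.
rewrite /gh xF_sqr yF_sqr frob2E.
move: (Num.sqrt _) => w; lra.
Qed.

Lemma energy_fin F r : theta (\det F) = r%:E -> f F = (fine (f F))%:E.
Proof.
move=> rE; rewrite fineK// fin_numE f_noo /=; apply/eqP => foo.
by have := le_energy rE; rewrite foo leye_eq.
Qed.

Lemma frob2_mul_le (F M : M2) C : (forall i j, `|M i j| <= C) ->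
  frob2 (F *m M) <= 4 * C ^+ 2 * frob2 F.
Proof.
move=> MC; have C0 : 0 <= C by exact: le_trans (MC 0 0).
have e i j : (F *m M) i j ^+ 2 <= 2 * C ^+ 2 * (F i 0 ^+ 2 + F i 1 ^+ 2).
  rewrite mul2E.
  have m k : (M k j) ^+ 2 <= C ^+ 2 by rewrite -[_ ^+ 2]ger0_norm ?sqr_ge0// normrX ler_sqr// nnegrE.
  have a k : (F i k * M k j) ^+ 2 <= C ^+ 2 * F i k ^+ 2.
    by rewrite exprMn mulrC ler_wpM2r// sqr_ge0.
  have := a 0; have := a 1; have := sqr_ge0 (F i 0 * M 0 j - F i 1 * M 1 j).
  lra.
have := e 0 0; have := e 0 1; have := e 1 0; have := e 1 1.
rewrite !frob2E; lra.
Qed.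

Lemma commutator_test F psi C : area_map C psi -> (forall z, ~ square z -> psi z = z) ->
  W1inf0 (fun z : R * R => mact F (psi z - z)).
Proof.
move=> [_ _ [L HL] _] out; split; last first.
  by move=> z /out ->; rewrite subrr /mact /= !mulr0 addr0.
set c := `|F 0 0| + `|F 0 1| + (`|F 1 0| + `|F 1 1|).
have c0 : 0 <= c by rewrite !addr_ge0.
exists (c * (L + 1)) => x y.
have -> : mact F (psi x - x) - mact F (psi y - y) = mact F (psi x - psi y - (x - y)).
  case: (psi x) => a b; case: (psi y) => a' b'; case: x => x1 x2; case: y => y1 y2.
  by rewrite /mact /=; congr pair => /=; ring.
apply: le_trans (mact_le _ _) _; rewrite -/c -mulrA ler_wpM2l// mulrDl mul1r.
by apply: le_trans (ler_normB _ _) _; rewrite lerD2r.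
Qed.

Let g G := fine (f G).

(** Quasiconvexity tested with the commutator. On the plateau each slope [s], [- s] occupies the
    area [2 * dl * (4^-1 - 2 * (s * dl))]; the two end pieces together have area
    [10 * dl * (3 * dl + 2 * (s * dl))], and there only [le_energy] is available. *)
Lemma midpoint_estimate F sg s dl r : sg ^+ 2 = 1 -> 0 < s -> 0 < dl ->
  (8 + s) * dl <= 16^-1 -> theta (\det F) = r%:E ->
  0 <= 2 * dl * (4^-1 - 2 * (s * dl)) * (g (F *m shm sg s) + g (F *m shm sg (- s)) - 2 * g F)
     + 10 * dl * (3 * dl + 2 * (s * dl)) *
       (4 * map_bound s ^+ 2 * frob2 F + (lam ^+ 2 + lam ^- 2) + r - g F).
Proof.
move=> s2 s0 dl0 dls rE; set E := _ + r - g F.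
have dls' : 8 * dl + s * dl <= 16^-1 by rewrite -mulrDl.
have u0 : 0 < s * dl by rewrite mulr_gt0.
pose y1 : R := 2^-1 - (8^-1 + 3 * dl + s * dl); pose y2 : R := 2^-1 - (8^-1 - s * dl).
pose y3 : R := 2^-1 + (8^-1 - s * dl); pose y4 : R := 2^-1 + (8^-1 + 3 * dl + s * dl).
have [y12 y23 y34] : [/\ y1 < y2, y2 < y3 & y3 < y4] by rewrite /y1 /y2 /y3 /y4; split; lra.
have outer t : t < y1 \/ y4 < t -> 8^-1 + 3 * dl + s * dl < `|t - 2^-1|.
  by rewrite /y1 /y4 ltr_normr => -[H|H]; apply/orP; [right|left]; lra.
have inner t : y2 < t -> t < y3 -> `|t - 2^-1| < 8^-1 - s * dl.
  by rewrite /y2 /y3 ltr_norml => ? ?; apply/andP; split; lra.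
have core t : y1 <= t <= y4 -> `|t - 2^-1| <= 8^-1 + 3 * dl + s * dl.
  by rewrite /y1 /y4 ler_norml => /andP[? ?]; apply/andP; split; lra.
pose p0 : R := 2^-1 + sg / 2.
have [ik Ik] := step_fun_mean (g F) (g (F *m shm sg s)) (g (F *m shm sg (- s))) E dl0 y12 y23 y34
  (fun z zp zy => core_square s2 s0 dl0 dls zp (core _ zy)).
set k := step_fun _ _ _ _ _ _ _ _ _ _ _ in ik Ik.
have am := commutator_area_map s2 s0 dl0; have out := commutator_outside s2 s0 dl0 dls.
have test := commutator_test F am out.
have [_ _ _ [N [mN N0 HN]]] := am.
have detM G : \det G = 1 -> theta (\det (F *m G)) = r%:E by move=> G1; rewrite det_mulmx G1 mulr1.
have gS t : f (F *m shm sg t) = (g (F *m shm sg t))%:E.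
  by apply: energy_fin; apply: detM; exact: det_shm.
set psi := commutator_map sg s dl in am out test HN *.
(* The lines where the profile has corners or the step function jumps; they are discarded with the
   exceptional set of the map. *)
pose lq := [:: p0 - 4 * dl; p0 - 3 * dl; p0 - 2 * dl; p0 - dl; p0; p0 + dl].
pose ly := [:: y1; y2; y3; y4].
have [mQ Q0] := pc_measure sg (measurable_seq lq) (@measurableT _ (measurableTypeR R)).
have [mY Y0] := pc_measure sg (@measurableT _ (measurableTypeR R)) (measurable_seq ly).
set Q := [set z | _ /\ _] in mQ Q0; set Y := [set z | _ /\ _] in mY Y0.
have mN' : measurable (N `|` (Q `|` Y) : set T2) by apply: measurableU => //; exact: measurableU.
have N'0 : mu2 (N `|` (Q `|` Y)) = 0%E.
  apply: (measure_negligible mN'); apply: negligibleU; first by exists N; split.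
  apply: negligibleU; [exists Q|exists Y]; split => //.
    by apply: etrans Q0 _; rewrite [X in (X * _)%E]lebesgue_seq0 mul0e.
  by apply: etrans Y0 _; rewrite [X in (_ * X)%E]lebesgue_seq0 mule0.
pose phi (z : R * R) := mact F (psi z - z).
have val z M : loc_affine psi z M -> F + Dmat phi z = F *m M.
  by move=> /(loc_affine_fun F)/loc_affine_Dmat ->; rewrite addrC subrK.
have idc z : loc_affine psi z (shm sg 0) -> f (F + Dmat phi z) = (g F)%:E.
  by move=> /val ->; rewrite gS shm0 mulmx1.
have key z : ~ (N `|` (Q `|` Y)) z -> (f (F + Dmat phi z) <= (k z)%:E)%E.
  move=> /not_orP[Nz /not_orP[Qz Yz]].
  have nq : pc sg z \notin lq by apply/negP => h; apply: Qz; split.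
  have ny : z.2 \notin ly by apply/negP => h; apply: Yz; split.
  apply: (step_fun_cases dl0 y12 y23 y34 (P := fun v => (f (F + Dmat phi z) <= v%:E)%E) nq ny).
  - move=> H; rewrite idc//; apply: (commutator_fixed s2 s0 dl0).
    by case: H => H; [right; right|right; right|left|right; left] => //; apply: outer; [left|right].
  - have [M [aM dM bM]] := HN z Nz.
    rewrite (val _ _ aM); apply: le_trans (le_energy (detM _ dM)) _.
    by rewrite lee_fin subrKC !lerD2r; exact: frob2_mul_le.
  move=> h2 h3; have sh a : loc_affine1 (profile sg s dl) (pc sg z) a ->
      f (F + Dmat phi z) = (g (F *m shm sg a))%:E.
    by move=> la; rewrite (val _ _ (commutator_shear s2 s0 dl0 (inner _ h2 h3) la)).
  have [pu pd pf] := profile_affine sg s dl (pc sg z).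
  split => H; first by rewrite (sh s)//; exact: pu.
    by rewrite (sh (- s))//; exact: pd.
  by rewrite (sh 0) ?shm0 ?mulmx1//; exact: pf.
have : (f F <= (\int[mu2]_(z in @square R) (k z)%:E))%E.
  apply: le_trans (fq F test) _.
  apply: (le_integral_nonmeas_ae (@measurable_square R) mN' N'0); first exact: measurable_int ik.
  by move=> z _; exact: key.
rewrite Ik (energy_fin rE) lee_fin -/(g F) -subr_ge0 => H; apply: le_trans H _.
rewrite le_eqVlt; apply/orP; left; apply/eqP.
by rewrite /y1 /y2 /y3 /y4; field.
Qed.

(** In [midpoint_estimate] the first term is of order [dl] and the error of order [dl ^+ 2], so a
    negative second difference is impossible for small [dl]. *)
Lemma midpoint_le F sg s r : sg ^+ 2 = 1 -> 0 < s -> theta (\det F) = r%:E ->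
  2 * g F <= g (F *m shm sg s) + g (F *m shm sg (- s)).
Proof.
move=> s2 s0 rE; rewrite leNgt; apply/negP => lt.
pose E := 4 * map_bound s ^+ 2 * frob2 F + (lam ^+ 2 + lam ^- 2) + r - g F.
set D := 2 * g F - (g (F *m shm sg s) + g (F *m shm sg (- s))).
have D0 : 0 < D by rewrite subr_gt0.
have s8 : 0 < 8 + s by lra.
(* With [b * dl <= D] the error divided by [dl] is less than [D / 4], while [s * dl <= 16^-1] keeps
   the gain at least [D / 4]. *)
pose b := 40 * ((3 + 2 * s) * (`|E| + 1)).
have b0 : 0 < b by have := normr_ge0 E => E0; apply: mulr_gt0; [lra|apply: mulr_gt0; lra].
pose dl := Num.min (16^-1 / (8 + s)) (D / b).
have dl0 : 0 < dl by rewrite lt_min !divr_gt0// invr_gt0.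
have d1 : (8 + s) * dl <= 16^-1 by rewrite mulrC -ler_pdivlMr// ge_min lexx.
have d2 : b * dl <= D by rewrite mulrC -ler_pdivlMr// ge_min lexx orbT.
have := midpoint_estimate s2 s0 dl0 d1 rE; rewrite -/E.
have -> : 2 * dl * (4^-1 - 2 * (s * dl)) * (g (F *m shm sg s) + g (F *m shm sg (- s)) - 2 * g F)
     + 10 * dl * (3 * dl + 2 * (s * dl)) * E =
   dl * (10 * (3 + 2 * s) * E * dl - 2 * (4^-1 - 2 * (s * dl)) * D) by rewrite /D; ring.
rewrite pmulr_rge0// subr_ge0.
have e1 : 10 * (3 + 2 * s) * E * dl < b * dl / 4.
  rewrite /b (_ : 40 * _ * dl / 4 = 10 * (3 + 2 * s) * (`|E| + 1) * dl); last by field.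
  rewrite ltr_pM2r// ltr_pM2l; first by have := ler_norm E; lra.
  by rewrite mulr_gt0//; lra.
have sd : s * dl <= 16^-1 by apply: le_trans d1; rewrite ler_wpM2r ?(ltW dl0)//; lra.
have e2 : D / 4 <= 2 * (4^-1 - 2 * (s * dl)) * D.
  by rewrite mulrC ler_wpM2r ?(ltW D0)//; lra.
lra.
Qed.

(* If [S] bounds the values at the interior points of the segment, so does the average of [S]
   and [M]: each point is the midpoint of a segment having an end of the whole one as an end. *)
Lemma quasiconvex_shear_laminable : shear_laminable theta f.
Proof.
move=> F sg t1 t2 M s2 /andP[t10 t20] thF f1 f2.
have [r rE] : exists r, theta (\det F) = r%:E.
  have := theta_ge0 (\det F); move: thF; case: (theta _) => [r||]// _ _; first by exists r.
have rS t : theta (\det (F *m shm sg t)) = r%:E by rewrite det_mulmx det_shm// mulr1.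
pose ph t := g (F *m shm sg t).
have phE t : f (F *m shm sg t) = (ph t)%:E by exact: energy_fin (rS t).
have p1 : ph t1 <= M by rewrite -lee_fin -phE.
have p2 : ph t2 <= M by rewrite -lee_fin -phE.
have mid t u : 0 < u -> 2 * ph t <= ph (t + u) + ph (t - u).
  by move=> u0; have := midpoint_le s2 u0 (rS t); rewrite -!mulmxA !shmM.
have ph0 : f F = (ph 0)%:E by rewrite -phE shm0 mulmx1.
rewrite ph0 lee_fin.
pose A := [set ph t | t in [set t | t1 <= t <= t2]].
have A0 : A (ph 0) by exists 0 => //=; rewrite (ltW t10) ltW.
(* Shears preserve the determinant, so [theta] has the same finite value along the segment and
   [le_energy] bounds [f] there. *)
have hA : has_sup A.
  split; first by exists (ph 0).
  pose T := Num.max 1 (Num.max (- t1) t2).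
  have T1 : 1 <= T by rewrite le_max lexx.
  exists (4 * (2 * T) ^+ 2 * frob2 F + (lam ^+ 2 + lam ^- 2) + r) => _ [t /= /andP[a b] <-].
  rewrite -lee_fin -phE; apply: le_trans (le_energy (rS t)) _; rewrite lee_fin !lerD2r.
  apply: frob2_mul_le => i j.
  have Ta : - t1 <= T by rewrite !le_max lexx !orbT.
  have Tb : t2 <= T by rewrite !le_max lexx !orbT.
  have tT : `|t| <= T by rewrite ler_norml; apply/andP; split; lra.
  have sT : `|sg * t| <= 2 * T by rewrite normrM sign_norm// mul1r; lra.
  have n1 : `|1 : R| = 1 := normr1 _.
  have n2 := ler_normD 1 t; have n3 := ler_normB 1 t.
  by rewrite mxE; case: (i == 0); case: (j == 0); rewrite ?normrN//; lra.
have sup_le : sup A <= (M + sup A) / 2.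
  apply: ge_sup; first by exists (ph 0).
  move=> _ [t /= /andP[a b] <-].
  have inA u : t1 <= u <= t2 -> ph u <= sup A.
    by move=> hu; apply: ub_le_sup => //; [exact: hA.2|exists u].
  have [h|h] := leP (t - t1) (t2 - t).
    have [e|u0] := eqVneq t t1; first by have := inA t1; rewrite e lexx; lra.
    have u1 : 0 < t - t1 by rewrite subr_gt0 lt_def u0.
    have := mid t _ u1; rewrite subKr.
    have := inA (t + (t - t1)); rewrite (_ : _ && _); [lra|apply/andP; split; lra].
  have [e|u0] := eqVneq t t2; first by have := inA t2; rewrite e lexx; lra.
  have u1 : 0 < t2 - t by rewrite subr_gt0 lt_def eq_sym u0.
  have := mid t _ u1; rewrite subrKC.
  have := inA (t - (t2 - t)); rewrite (_ : _ && _); [lra|apply/andP; split; lra].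
have := ub_le_sup hA.2 A0; lra.
Qed.

Let hat (t : R) := Num.max 0 (Num.min t (1 - t)).

Let hat_cases t : [\/ hat t = t /\ 0 <= t <= 2^-1, hat t = 1 - t /\ 2^-1 <= t <= 1,
  hat t = 0 /\ t <= 0 | hat t = 0 /\ 1 <= t].
Proof.
rewrite /hat; have /orP[h1|h1] := le_total t 2^-1.
  rewrite [Num.min _ _]min_l; last by lra.
  have /orP[h2|h2] := le_total 0 t; last by apply: Or43; rewrite max_l.
  by apply: Or41; rewrite max_r// h2.
rewrite [Num.min _ _]min_r; last by lra.
have /orP[h2|h2] := le_total 1 t; first by apply: Or44; rewrite max_l//; lra.
by apply: Or42; rewrite max_r ?h1//; lra.
Qed.

Let hat_range t : 0 <= hat t <= 2^-1.
Proof. by case: (hat_cases t) => -[-> ?]; lra. Qed.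

Let hat_eq0 t : ~ (0 < t < 1) -> hat t = 0.
Proof.
by move=> /negP; rewrite negb_and -!leNgt => /orP[] H; case: (hat_cases t) => -[-> ?]; lra.
Qed.

Let hat_lip x y : `|hat x - hat y| <= `|x - y|.
Proof.
have H a b : hat a - hat b <= `|a - b|.
  have := ler_norm (a - b); have := ler_norm (b - a); rewrite distrC.
  by case: (hat_cases a) => -[-> ?]; case: (hat_cases b) => -[-> ?]; lra.
by rewrite ler_norml H andbT lerNl opprB distrC H.
Qed.

Let hat_affine t : 0 < t < 1 -> t != 2^-1 -> 0 < hat t /\ exists2 a, `|a| = 1 & loc_affine1 hat t a.
Proof.
move=> /andP[t0 t1]; rewrite neq_lt => /orP[] h; split.
- by case: (hat_cases t) => -[-> ?]; lra.
- exists 1; first exact: normr1.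
  apply: (@loc_affine1_itv _ _ _ _ 0 2^-1 0) => [|x /andP[a b]]; first by rewrite t0.
  by case: (hat_cases x) => -[-> ?]; lra.
- by case: (hat_cases t) => -[-> ?]; lra.
- exists (-1); first by rewrite normrN normr1.
  apply: (@loc_affine1_itv _ _ _ _ 2^-1 1 1) => [|x /andP[a b]]; first by rewrite h.
  by case: (hat_cases x) => -[-> ?]; lra.
Qed.

(** The test map has a single nonzero component, a product of two hats, so its gradient has
    determinant 0. Off the lines where a coordinate is [1/2], both hats are positive with slopes 1
    or -1 inside the square, so the gradient is nonzero; its entries are bounded by [ep], and
    [ep ^+ 2 <= e]. *)
Lemma quasiconvex_zero_laminable : zero_laminable f.
Proof.
move=> e M e0 H.
pose ep := Num.min 1 e.
have ep0 : 0 < ep by rewrite lt_min ltr01.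
have ep1 : ep <= 1 by rewrite ge_min lexx.
have epe : ep <= e by rewrite ge_min lexx orbT.
pose u (z : R * R) := ep * (hat z.1 * hat z.2).
pose phi (z : R * R) : R * R := (u z, 0).
have test : W1inf0 phi.
  split; last first.
    move=> z nz; rewrite /phi /u; congr pair.
    have [h1|h1] := pselect (0 < z.1 < 1); last by rewrite hat_eq0// mul0r mulr0.
    by rewrite (@hat_eq0 z.2) ?mulr0// => h2; apply: nz.
  exists ep => x y; rewrite prod_normE ge_max /= subrr normr0 mulr_ge0 ?(ltW ep0)// andbT.
  rewrite /u -mulrBr normrM gtr0_norm// ler_wpM2l ?(ltW ep0)//.
  rewrite (_ : _ - _ = (hat x.1 - hat y.1) * hat x.2 + hat y.1 * (hat x.2 - hat y.2)); last by ring.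
  apply: le_trans (ler_normD _ _) _; rewrite !normrM.
  have /andP[a0 a1] := hat_range x.2; have /andP[b0 b1] := hat_range y.1.
  rewrite (ger0_norm a0) (ger0_norm b0).
  have l1 : `|hat x.1 - hat y.1| <= `|x - y| := le_trans (hat_lip _ _) (norm_fst_le (x - y)).
  have l2 : `|hat x.2 - hat y.2| <= `|x - y| := le_trans (hat_lip _ _) (norm_snd_le (x - y)).
  have := ler_pM (normr_ge0 _) a0 l1 a1; have := ler_pM b0 (normr_ge0 _) b1 l2.
  lra.
(* For [sg = 0] the function [pc] is the first coordinate. *)
have [mP P0] := pc_measure 0 (measurable_seq [:: 2^-1]) (@measurableT _ (measurableTypeR R)).
have [mQ Q0] := pc_measure 0 (@measurableT _ (measurableTypeR R)) (measurable_seq [:: 2^-1]).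
set P := [set z | _ /\ _] in mP P0; set Q := [set z | _ /\ _] in mQ Q0.
have mN : measurable (P `|` Q : set T2) by exact: measurableU.
have N0 : mu2 (P `|` Q) = 0%E.
  apply: (measure_negligible mN).
  apply: negligibleU; [exists P|exists Q]; split => //.
    by apply: etrans P0 _; rewrite [X in (X * _)%E]lebesgue_seq0 mul0e.
  by apply: etrans Q0 _; rewrite [X in (_ * X)%E]lebesgue_seq0 mule0.
have key z : square z -> ~ (P `|` Q) z -> (f (0 + Dmat phi z)%R <= M%:E)%E.
  move=> [z1 z2] /not_orP[Pz Qz].
  have n1 : z.1 != 2^-1.
    by apply/eqP => h; apply: Pz; split; rewrite //= inE /pc mul0r addr0 h.
  have n2 : z.2 != 2^-1 by apply/eqP => h; apply: Qz; split; rewrite //= inE h.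
  have [h1 [a a1 [d d0 la]]] := hat_affine z1 n1; have [h2 [b b1 [d' d'0 lb]]] := hat_affine z2 n2.
  have G : gradient_at (fst \o phi) z (ep * (a * hat z.2)) (ep * (b * hat z.1)).
    move=> q q0; exists (Num.min q (Num.min d d')); first by rewrite !lt_min q0 d0.
    move=> h; rewrite !lt_min => /and3P[hq hd hd'].
    have k1 := norm_fst_le h; have k2 := norm_snd_le h.
    rewrite /= /u /lin2 /= (la _ (le_lt_trans k1 hd)) (lb _ (le_lt_trans k2 hd')).
    rewrite (_ : _ - _ - _ = ep * (a * h.1 * (b * h.2))); last by ring.
    rewrite !normrM a1 b1 !mul1r gtr0_norm//.
    have := ler_pM (ltW ep0) (mulr_ge0 (normr_ge0 h.1) (normr_ge0 h.2)) ep1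
      (ler_pM (normr_ge0 _) (normr_ge0 _) k1 k2).
    rewrite mul1r => /le_trans; apply.
    by rewrite ler_wpM2r// ltW.
  have G0 : gradient_at (snd \o phi) z 0 0.
    move=> q q0; exists 1 => // h _.
    by rewrite /= /lin2 !subrr !mulr0 addr0 subr0 normr0 mulr_ge0// ltW.
  have [D00 D01 D10 D11] := Dmat_gradient G G0.
  rewrite add0r; have /andP[_ c1] := hat_range z.1; have /andP[_ c2] := hat_range z.2.
  have en : `|ep * (a * hat z.2)| + `|ep * (b * hat z.1)| <= ep.
    rewrite !normrM a1 b1 !mul1r !gtr0_norm// -mulrDr ler_piMr ?(ltW ep0)//; lra.
  have sq x : `|x| <= ep -> x ^+ 2 <= e.
    move=> xe; apply: le_trans epe; apply: (@le_trans _ _ (ep ^+ 2)).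
      by rewrite -[x ^+ 2]ger0_norm ?sqr_ge0// normrX ler_sqr ?nnegrE// ltW.
    by rewrite expr2 ler_piMr// ltW.
  apply: H.
  - by rewrite det2 D10 D11 !mulr0 subr0.
  - apply/eqP => D0; move: D00; rewrite D0 mxE => /esym/eqP.
    by rewrite !mulf_eq0 (gt_eqF ep0) (gt_eqF h2) /= orbF -normr_eq0 a1 oner_eq0.
  - rewrite /Xm D00 D01 D10 D11 addr0 expr0n addr0.
    by have := sq _ (le_trans (ler_normD _ _) en); lra.
  - rewrite /Ym D00 D01 D10 D11 subr0 expr0n addr0.
    by have := sq _ (le_trans (ler_normB _ _) en); lra.
apply: le_trans (fq 0 test) _.
have [ik Ik] := has_mean_cst M; rewrite -Ik.
by apply: (le_integral_nonmeas_ae (@measurable_square R) mN N0); first exact: measurable_int ik.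
Qed.

End QuasiconvexLaminable.

Theorem theorem1p1 (R : realType) (lam : R) (theta : R -> \bar R) :
  1 < lam ->
  convex_ext theta -> lower_semicontinuous theta ->
  (forall t, (0 <= theta t)%E) ->
  [/\ (* the minimum defining h is attained on closure(O) *)
      (forall x y d, Obar (x, y, d) ->
         exists xi eta, [/\ x <= xi, y <= eta &
           forall xi' eta', x <= xi' -> y <= eta' ->
             gfun lam xi eta d <= gfun lam xi' eta' d]),
      (* H := h(x(F),y(F),det F) + theta(det F) is the largest rank-one convex
         function below W *)
      [/\ rank_one_convex (Hfun lam theta),
          (forall F, (Hfun lam theta F <= W lam theta F)%E) &
          forall f : 'M[R]_2 -> \bar R, (forall F, f F != -oo%E) ->
            rank_one_convex f -> (forall F, (f F <= W lam theta F)%E) ->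
            forall F, (f F <= Hfun lam theta F)%E],
      (* ... the largest quasiconvex function below W *)
      [/\ quasiconvex (Hfun lam theta),
          (forall F, (Hfun lam theta F <= W lam theta F)%E) &
          forall f : 'M[R]_2 -> \bar R, (forall F, f F != -oo%E) ->
            quasiconvex f -> (forall F, (f F <= W lam theta F)%E) ->
            forall F, (f F <= Hfun lam theta F)%E] &
      (* ... and the largest polyconvex function below W *)
      [/\ polyconvex (Hfun lam theta),
          (forall F, (Hfun lam theta F <= W lam theta F)%E) &
          forall f : 'M[R]_2 -> \bar R, (forall F, f F != -oo%E) ->
            polyconvex f -> (forall F, (f F <= W lam theta F)%E) ->
            forall F, (f F <= Hfun lam theta F)%E]].
Proof.
move=> lam1 tc tl t0; split; first by move=> x y d; exact: gfun_min.
- split; [exact: Hfun_rank_one_convex|exact: Hfun_le_W|].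
  move=> f _ fc fW; apply: laminable_le_Hfun => //.
    exact: rank_one_shear_laminable.
  exact: rank_one_zero_laminable.
- split; [exact: Hfun_quasiconvex|exact: Hfun_le_W|].
  move=> f fn fq fW; apply: laminable_le_Hfun => //.
    exact: (quasiconvex_shear_laminable lam1 t0 fn fq fW).
  exact: quasiconvex_zero_laminable.
- split; [exact: Hfun_polyconvex|exact: Hfun_le_W|].
  move=> f _ /polyconvex_rank_one_convex fc fW; apply: laminable_le_Hfun => //.
    exact: rank_one_shear_laminable.
  exact: rank_one_zero_laminable.
Qed.
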